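(* Assume (A1) and (A2) below. Then for every $D>0$ and $P>0$, $$R_{\mathrm{nr}}(D,P)=R(D,P).$$ (A1) For each fixed $\mu\in\mathcal P(\mathcal X)$, the map $\nu\mapsto d(\mu,\nu)$ is convex. (A2) This assumption has two parts. - For every $D>0$ and $P>0$, $R(D,P)<\infty$. - For every $D>0$, $P>0$ and $\epsilon>0$ there is a Markov kernel $p_{\tilde X|X}$ such that $\tilde X$ is discrete with support $\tilde{\mathcal X}\subseteq\mathcal X$, $|\tilde{\mathcal X}|<\infty$, and all of the following hold: - $I(X;\tilde X)\le R(D,P)+\epsilon$; - $\mathbb E[\Delta(X,\tilde X)]\le D+\epsilon$; - $\mathbb E[\max_{\tilde x\in\tilde{\mathcal X}}\Delta(X,\tilde x)]<\infty$; - $d(p_X,p_{\tilde X})\le P+\epsilon$; - $d(p_X,\gamma)<\infty$ for every distribution $\gamma$ supported on $\tilde{\mathcal X}$.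
   Context: Let $\mathcal X$ be a Polish metric space with its Borel $\sigma$-algebra, and let $\mathcal P(\mathcal X)$ be the set of Borel probability measures on $\mathcal X$. Let $X\sim p_X\in\mathcal P(\mathcal X)$, and let $\{X_t\}_{t\ge1}$ be i.i.d. with marginal $p_X$. Let $\Delta:\mathcal X\times\mathcal X\to[0,\infty)$ be a measurable distortion function with $\Delta(x,\hat x)=0$ iff $x=\hat x$. Let $d:\mathcal P(\mathcal X)\times\mathcal P(\mathcal X)\to[0,\infty]$ be a divergence with $d(\mu,\nu)=0$ iff $\mu=\nu$. The rate-distortion-perception function is $$R(D,P):=\inf I(X;\hat X),$$ where the infimum is over Markov kernels $p_{\hat X|X}$ from $\mathcal X$ to $\mathcal X$ with $\mathbb E[\Delta(X,\hat X)]\le D$ and $d(p_X,p_{\hat X})\le P$. Logarithms are base 2. Operational definitions. A rate $R$ is achievable with common randomness if, for all sufficiently large $n$, there exist: - a distribution $p_Q$ on a Polish space; - an encoder kernel $p_{Z|X^nQ}$ with $Z$ taking values in a countable set; - a decoder kernel $p_{\hat X^n|ZQ}$ with $\hat X^n\in\mathcal X^n$; such that, under $p_X^{n}p_Qp_{Z|X^nQ}p_{\hat X^n|ZQ}$, the following hold: - $\frac1nH(Z|Q)\le R$; - $\frac1n\sum_{t=1}^n\mathbb E[\Delta(X_t,\hat X_t)]\le D$; - $d(p_X,p_{\hat X_t})\le P$ for all $t\in[1:n]$. $R_{\mathrm{cr}}(D,P)$ is the infimum of such $R$. $R_{\mathrm{pr}}(D,P)$ is defined in the same way with $Q$ constant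 (private randomness only). $R_{\mathrm{nr}}(D,P)$ is defined in the same way with $Q$ constant, $Z$ a deterministic function of $X^n$, and $\hat X^n$ a deterministic function of $Z$ (no randomness). *)

(* Defs.v *)
From HB Require Import structures.
From mathcomp Require Import all_boot all_order all_algebra.
From mathcomp Require Import all_classical all_reals all_analysis.
Set Implicit Arguments. Unset Strict Implicit. Unset Printing Implicit Defensive.
Import Order.TTheory GRing.Theory Num.Theory.
Local Open Scope classical_set_scope.
Local Open Scope ring_scope.

Section RDP.
Context {R : realType}.

Definition log2 (x : R) : R := ln x / ln 2.

Section Polish.
Context {T : Type}.
Definition is_metric (rho : T -> T -> R) :=
  [/\ forall x y, 0 <= rho x y, forall x y, rho x y = 0 <-> x = y,
      forall x y, rho x y = rho y x &
      forall x y z, rho x z <= rho x y + rho y z].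
Definition metric_open (rho : T -> T -> R) (A : set T) :=
  forall x, A x -> exists2 e : R, 0 < e & [set y | rho x y < e] `<=` A.
Definition metric_separable (rho : T -> T -> R) :=
  exists s : nat -> T, forall x (e : R), 0 < e -> exists n, rho x (s n) < e.
Definition metric_complete (rho : T -> T -> R) :=
  forall u : nat -> T,
  (forall e : R, 0 < e -> exists N, forall m n, (N <= m)%N -> (N <= n)%N ->
      rho (u m) (u n) < e) ->
  exists l, forall e : R, 0 < e -> exists N, forall n, (N <= n)%N -> rho (u n) l < e.
End Polish.

Definition polish_borel {d} (T : measurableType d) (rho : T -> T -> R) :=
  [/\ is_metric rho, metric_separable rho, metric_complete rho &
      (@measurable d T) = <<s metric_open rho >>].

Section OnT.
Context {d : measure_display} {T : measurableType d}.

(* A (Borel probability) measure, seen as a set function that is 0 outside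
   the measurable sets; two measures are equal iff they agree on measurable
   sets iff their restrictions are equal. *)
Definition mrestr (mu : set T -> \bar R) : set T -> \bar R :=
  fun A => if `[< measurable A >] then mu A else 0%E.

Definition is_prob (nu : set T -> \bar R) :=
  exists mu : probability T R, nu = mrestr mu.

Definition divergence (dv : (set T -> \bar R) -> (set T -> \bar R) -> \bar R) :=
  forall mu nu, is_prob mu -> is_prob nu ->
    (0 <= dv mu nu)%E /\ (dv mu nu = 0%E <-> mu = nu).

Definition mixture (l : R) (nu1 nu2 : set T -> \bar R) : set T -> \bar R :=
  fun A => (l%:E * nu1 A + (1 - l)%:E * nu2 A)%E.

Definition A1 (dv : (set T -> \bar R) -> (set T -> \bar R) -> \bar R) :=
  forall mu nu1 nu2 (l : R), is_prob mu -> is_prob nu1 -> is_prob nu2 ->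
    0 <= l <= 1 ->
    (dv mu (mixture l nu1 nu2) <= l%:E * dv mu nu1 + (1 - l)%:E * dv mu nu2)%E.

Definition distortion (Dist : T -> T -> R) :=
  [/\ measurable_fun [set: T * T] (fun p => Dist p.1 p.2),
      forall x y, 0 <= Dist x y &
      forall x y, Dist x y = 0 <-> x = y].

Definition mpartition m (A : 'I_m -> set T) :=
  [/\ forall i, measurable (A i),
      forall i j, i != j -> A i `&` A j = set0 &
      forall x, exists i, A i x].

Definition mi_term (p q : R) : R := if p == 0 then 0 else p * log2 (p / q).

(* I(X;Y) for a joint law given on rectangles pi A B = P(X in A, Y in B) with
   marginals mu, nu: the supremum over finite measurable partitions of the
   discrete mutual informations (Gelfand-Yaglom-Perez/Dobrushin definition) *)
Definition mutual_info (pi : set T -> set T -> \bar R) (mu nu : set T -> \bar R)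
  : \bar R :=
  ereal_sup [set r | exists m k (A : 'I_m -> set T) (B : 'I_k -> set T),
    [/\ mpartition A, mpartition B &
        r = (\sum_(i < m) \sum_(j < k)
               mi_term (fine (pi (A i) (B j))) (fine (mu (A i)) * fine (nu (B j))))%:E]].

Definition joint (px : probability T R) (k : R.-pker T ~> T) :=
  fun A B => (\int[px]_(x in A) k x B)%E.
Definition outlaw (px : probability T R) (k : R.-pker T ~> T) : set T -> \bar R :=
  fun B => (\int[px]_x k x B)%E.
Definition MI_kernel (px : probability T R) (k : R.-pker T ~> T) :=
  mutual_info (joint px k) px (outlaw px k).
Definition exp_dist (px : probability T R) (k : R.-pker T ~> T) (Dist : T -> T -> R) :=
  (\int[px]_x \int[k x]_y (Dist x y)%:E)%E.

Definition RDP (dv : (set T -> \bar R) -> (set T -> \bar R) -> \bar R)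
  (Dist : T -> T -> R) (px : probability T R) (D P : R) : \bar R :=
  ereal_inf [set MI_kernel px k | k in
    [set k : R.-pker T ~> T | (exp_dist px k Dist <= D%:E)%E /\
        (dv (mrestr px) (mrestr (outlaw px k)) <= P%:E)%E]].

Definition A2 (dv : (set T -> \bar R) -> (set T -> \bar R) -> \bar R)
  (Dist : T -> T -> R) (px : probability T R) :=
  (forall D P : R, 0 < D -> 0 < P -> (RDP dv Dist px D P < +oo)%E) /\
  (forall D P eps : R, 0 < D -> 0 < P -> 0 < eps ->
    exists (k : R.-pker T ~> T) (S : seq T),
    [/\ outlaw px k [set` S] = 1%E, (MI_kernel px k <= RDP dv Dist px D P + eps%:E)%E,
        (exp_dist px k Dist <= (D + eps)%:E)%E,
        (\int[px]_x (\big[Num.max/0]_(y <- S) Dist x y)%:E < +oo)%E &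
        (dv (mrestr px) (mrestr (outlaw px k)) <= (P + eps)%:E)%E /\
        forall gamma : probability T R, gamma [set` S] = 1%E ->
          (dv (mrestr px) (mrestr gamma) < +oo)%E]).

Section Operational.
Context {dO : measure_display} {Om : measurableType dO}.

Definition iid (Pr : probability Om R) (Xs : nat -> Om -> T) (px : probability T R) :=
  (forall t, measurable_fun [set: Om] (Xs t)) /\
  forall n (A : 'I_n -> set T), (forall i, measurable (A i)) ->
    Pr (\bigcap_(i in [set: 'I_n]) (Xs i @^-1` A i)) =
    (\prod_(i < n) fine (px (A i)))%:E.

Definition cylinders n : set (set ('I_n -> T)) :=
  [set C | exists (i : 'I_n) (A : set T), measurable A /\ C = [set x | A (x i)]].
Arguments cylinders : clear implicits.

Definition entropy (Z : countType) (Pr : probability Om R) (zf : Om -> Z) : \bar R :=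
  \esum_(z in [set: Z])
    (- fine (Pr (zf @^-1` [set z])) * log2 (fine (Pr (zf @^-1` [set z]))))%:E.

Definition nr_achievable (dv : (set T -> \bar R) -> (set T -> \bar R) -> \bar R)
  (Dist : T -> T -> R) (Pr : probability Om R) (Xs : nat -> Om -> T)
  (px : probability T R) (D P Rt : R) :=
  exists N, forall n, (N <= n)%N ->
    exists (Z : countType) (f : ('I_n -> T) -> Z) (g : Z -> ('I_n -> T)),
      let Xn := fun w (i : 'I_n) => Xs i w in
      let Xhat := fun (t : 'I_n) w => g (f (Xn w)) t in
      [/\ forall z, <<s cylinders n >> (f @^-1` [set z]),
          (n%:R^-1%:E * entropy Pr (f \o Xn) <= Rt%:E)%E,
          (n%:R^-1%:E * (\sum_(t < n) \int[Pr]_w (Dist (Xs t w) (Xhat t w))%:E)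
             <= D%:E)%E &
          forall t : 'I_n,
            (dv (mrestr px) (mrestr (pushforward Pr (Xhat t))) <= P%:E)%E].

Definition Rnr dv Dist Pr Xs px (D P : R) : \bar R :=
  ereal_inf [set Rt%:E | Rt in nr_achievable dv Dist Pr Xs px D P].

End Operational.
End OnT.
End RDP.

(* Main.v *)
(* Converse: for a code with n letters, replacing the t-th source letter by a free
   argument x turns the t-th reconstruction into a kernel; the average of these n
   kernels is feasible for R(D,P), and on every pair of finite partitions Gibbs'
   inequality bounds n times its information by the entropy of the index.

   Achievability: convexity of R(D,P) gives slack in both constraints, (A2) gives a
   kernel with finite output alphabet, and averaging it over the cells of a finite
   partition reduces everything to a finite source.  There, rejection sampling from
   random codewords is a code with shared randomness whose channel is close to the
   memoryless test channel.  The shared randomness is finally extracted from a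
   constant-length prefix of the source itself, and the same realization serves all
   blocks, since only per-letter marginals matter.  The extraction fails only when
   p_X is a point mass, where a constant reconstruction is optimal. *)

Require Import Defs.
From HB Require Import structures.
From mathcomp Require Import all_boot all_order all_algebra.
From mathcomp Require Import all_classical all_reals all_analysis measurable_realfun.
From mathcomp Require Import ring lra zify.
Set Implicit Arguments. Unset Strict Implicit. Unset Printing Implicit Defensive.
Import Order.TTheory GRing.Theory Num.Theory.
Import numFieldNormedType.Exports.
Local Open Scope classical_set_scope.
Local Open Scope ring_scope.

(** The divergence is only convex, so its continuity is exploited only near a finitely supported law
    with positive masses. There a one-sided estimate is enough, because a probability vector bounded
    above by [q j + eps] is also bounded below. Hence every coding estimate is an upper bound on the
    expectation of a test function between [0] and [G1]; the distortion and the indicators of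
    letters as test functions cover both constraints. Distortion is additive and perception is
    imposed letter by letter, so only the independence of the prefix from each single block counts.
    Letters outside the blocks must still have nearly the right law, while their distortion is
    simply paid for; this is why the prefix also yields a letter. Extraction needs every symbol of
    the quantized source to have mass bounded away from one, but the quantizer may collapse the
    source; an event of intermediate probability is therefore added to its cells. Describing the
    extracted value costs a constant number of bits, hence nothing per letter in the limit. *)

Section FiniteInformation.
Context {R : realType}.

(** * Finite information inequalities and rejection sampling *)

Definition pmf (I : finType) (w : I -> R) :=
  (forall i, 0 <= w i) /\ \sum_i w i = 1.

(** Summand of relative entropy, in nats. For [q = 0 < p] total division makes it [0] where the true
    value is infinite, whence the condition [q = 0 -> p = 0] in the lemmas below. *)
Definition xlog (p q : R) : R := if p == 0 then 0 else p * ln (p / q).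

Lemma ln_le_subr1 (x : R) : 0 < x -> ln x <= x - 1.
Proof.
move=> x0; have := @le_ln1Dx R (x - 1).
by rewrite [1 + (x - 1)](_ : _ = x); [apply; lra|ring].
Qed.

(* The tangent line of the jointly convex function p ln (p / q); it yields the
   log-sum inequality with c = sum p / sum q and Gibbs' inequality with c = 1. *)
Lemma xlog_ge (p q c : R) : 0 <= p -> 0 <= q -> (q = 0 -> p = 0) -> 0 < c ->
  p * ln c + p - c * q <= xlog p q.
Proof.
move=> p0 q0 pq c0; rewrite /xlog; case: eqVneq => [->|pN0].
  by rewrite mul0r !add0r lerNl oppr0 mulr_ge0 // ltW.
have pp : 0 < p by rewrite lt_neqAle eq_sym pN0.
have qp : 0 < q.
  by rewrite lt_neqAle eq_sym q0 andbT; apply/eqP => /pq pE; rewrite pE eqxx in pN0.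
have h := ln_le_subr1 (divr_gt0 (mulr_gt0 c0 qp) pp).
have e : ln (c * q / p) = ln c - ln (p / q).
  rewrite -mulrA lnM ?posrE ?divr_gt0 //; congr (_ + _).
  by rewrite -lnV ?posrE ?divr_gt0 // invf_div.
rewrite e in h.
have := ler_wpM2l p0 h; rewrite !mulrBr mulr1.
rewrite [p * (c * q / p)](_ : _ = c * q); last by field.
lra.
Qed.

Lemma xlog_sum (I : finType) (p q : I -> R) :
  (forall i, 0 <= p i) -> (forall i, 0 <= q i) ->
  (forall i, q i = 0 -> p i = 0) ->
  xlog (\sum_i p i) (\sum_i q i) <= \sum_i xlog (p i) (q i).
Proof.
move=> p0 q0 pq; set sp := \sum_i p i; set sq := \sum_i q i.
have sp0 : 0 <= sp by exact: sumr_ge0.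
have sq0 : 0 <= sq by exact: sumr_ge0.
have [spE|spN] := eqVneq sp 0.
  rewrite /xlog spE eqxx big1 // => i _.
  have /psumr_eq0P /(_ i isT) := spE => pi; rewrite pi ?eqxx //.
have spp : 0 < sp by rewrite lt_neqAle eq_sym spN.
have sqp : 0 < sq.
  rewrite lt_neqAle eq_sym sq0 andbT; apply: contra_neq spN => sqE.
  apply: big1 => i _; apply: pq.
  by have /psumr_eq0P /(_ i isT) := sqE => ->.
have c0 : 0 < sp / sq by exact: divr_gt0.
apply: le_trans (ler_sum _ (fun i _ => xlog_ge (p0 i) (q0 i) (pq i) c0)).
rewrite sumrB big_split /= -mulr_suml -mulr_sumr -/sp -/sq divfK ?gt_eqF //.
by rewrite /xlog (negPf spN) addrK.
Qed.

(** The masses need only be ordered, not equal: the converse compares a law with a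
    subprobability. *)
Lemma gibbs (I : finType) (p q : I -> R) :
  (forall i, 0 <= p i) -> (forall i, 0 <= q i) ->
  (forall i, q i = 0 -> p i = 0) -> \sum_i q i <= \sum_i p i ->
  0 <= \sum_i xlog (p i) (q i).
Proof.
move=> p0 q0 pq spq.
apply: le_trans (ler_sum _ (fun i _ => xlog_ge (p0 i) (q0 i) (pq i) ltr01)).
by rewrite sumrB big_split /= -mulr_suml -mulr_sumr ln1 mulr0 mul1r add0r subr_ge0.
Qed.

(** Gibbs' inequality against the uniform law on [Z]. *)
Lemma entropy_le_card (Z : finType) (p : Z -> R) : pmf p ->
  \sum_z - p z * ln (p z) <= ln #|Z|%:R.
Proof.
move=> [p0 p1].
have Z0 : (0 < #|Z|)%N.
  rewrite lt0n; apply/eqP => /card0_eq Z0; move/eqP: p1.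
  by rewrite big_pred0 // eq_sym oner_eq0.
have Zp : 0 < #|Z|%:R :> R by rewrite ltr0n.
have e : \sum_(z : Z) #|Z|%:R^-1 = 1 :> R.
  by rewrite sumr_const -[LHS]mulr_natl divff ?gt_eqF.
have := @gibbs Z p (fun=> #|Z|%:R^-1) p0; rewrite e p1 => h.
have {}h : 0 <= \sum_z xlog (p z) #|Z|%:R^-1.
  by apply: h => // z /eqP; rewrite invr_eq0 gt_eqF.
suff -> : ln #|Z|%:R = \sum_z xlog (p z) #|Z|%:R^-1 + \sum_z - p z * ln (p z).
  by rewrite lerDr.
rewrite -big_split /=.
have -> : ln #|Z|%:R = (\sum_z p z) * ln #|Z|%:R by rewrite p1 mul1r.
rewrite mulr_suml; apply: eq_bigr => z _.
rewrite /xlog; case: eqVneq => [->|pz]; first by rewrite oppr0 !mul0r addr0.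
have pp : 0 < p z by rewrite lt_neqAle eq_sym pz p0.
by rewrite invrK lnM ?posrE // mulrDr mulNr addrAC subrr add0r.
Qed.

Lemma pprod_pmf (I U : finType) (b : I -> U -> R) :
  (forall i, pmf (b i)) -> pmf (fun u : {ffun I -> U} => \prod_i b i (u i)).
Proof.
move=> bp; split; first by move=> u; apply: prodr_ge0 => i _; apply: (bp i).1.
by rewrite -(bigA_distr_bigA b) big1 // => i _; rewrite (bp i).2.
Qed.

Lemma pprod_coord (I U : finType) (b : I -> U -> R) (i0 : I) (G : U -> R) :
  (forall i, pmf (b i)) ->
  \sum_(u : {ffun I -> U}) (\prod_i b i (u i)) * G (u i0) = \sum_a b i0 a * G a.
Proof.
move=> bp.
transitivity (\sum_(u : {ffun I -> U}) \prod_i (b i (u i) *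
    (if i == i0 then G (u i) else 1))).
  apply: eq_bigr => u _; rewrite big_split /=; congr (_ * _).
  by rewrite (bigD1 i0) //= eqxx big1 ?mulr1 // => i /negPf ->.
rewrite -(bigA_distr_bigA (fun i a => b i a * (if i == i0 then G a else 1))).
rewrite (bigD1 i0) //= eqxx [X in _ * X]big1 ?mulr1 // => i /negPf ->.
by under eq_bigr do rewrite mulr1; rewrite (bp i).2.
Qed.

(* [K] is the channel of a code of size [M] averaged over shared randomness. *)
Definition realizable (U S : finType) (M : nat) (K : U -> S -> R) :=
  exists (Q C : finType) (w : Q -> R) (enc : Q -> U -> C) (dec : Q -> C -> S),
    [/\ pmf w, #|C| = M &
        forall u y, K u y = \sum_o w o * (dec o (enc o u) == y)%:R].

Lemma realizable_const (U S : finType) (y0 : S) :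
  realizable 1 (fun (_ : U) y => (y0 == y)%:R).
Proof.
exists unit, unit, (fun=> 1), (fun _ _ => tt), (fun _ _ => y0).
by split; [split=> //; rewrite big_const card_unit /= addr0 | rewrite card_unit |
  move=> u y; rewrite big_const card_unit /= addr0 mul1r].
Qed.

(* Prepend a fresh codeword drawn from [q]; the source [u] accepts it with
   probability [a y u] and otherwise falls back on the previous code. *)
Lemma realizable_accept (U S : finType) (M : nat) (q : S -> R) (a : S -> U -> R)
    (K : U -> S -> R) : pmf q -> (forall y u, 0 <= a y u <= 1) ->
  realizable M K ->
  realizable M.+1
    (fun u y => q y * a y u + (1 - \sum_z q z * a z u) * K u y).
Proof.
move=> qp a01 [Q [C [w [enc [dec [wp cC KE]]]]]].
(* One independent acceptance bit is drawn for every source symbol [v], so the shared randomness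
   contains a whole function [U -> bool] and the encoder is deterministic: it reads the bit at [u]
   and sends [None] on acceptance. *)
pose b z (v : U) (c : bool) : R := if c then a z v else 1 - a z v.
have bp z v : pmf (b z v).
  split=> [[]|]; rewrite /b ?big_bool /=; have := a01 z v; lra.
have Ap z := pprod_pmf (bp z).
pose Q' : Type := (S * {ffun U -> bool} * Q)%type.
exists (S * {ffun U -> bool} * Q)%type, (option C),
  (fun o : Q' => q o.1.1 * (\prod_v b o.1.1 v (o.1.2 v)) * w o.2),
  (fun (o : Q') u => if o.1.2 u then None else Some (enc o.2 u)),
  (fun (o : Q') c => if c is Some c then dec o.2 c else o.1.1).
have fub (F : S -> {ffun U -> bool} -> Q -> R) :
    \sum_(o : Q') F o.1.1 o.1.2 o.2 = \sum_z \sum_A \sum_o F z A o.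
  by rewrite pair_bigA pair_bigA.
split; last 2 first.
- by rewrite card_option cC.
- move=> u y.
  pose G z (c : bool) : R := if c then (z == y)%:R else K u y.
  transitivity (\sum_z \sum_(A : {ffun U -> bool}) q z * ((\prod_v b z v (A v)) * G z (A u))).
    transitivity (\sum_z q z * (a z u * (z == y)%:R + (1 - a z u) * K u y)).
      under [RHS]eq_bigr do rewrite mulrDr !mulrA.
      rewrite big_split /= [X in _ = X + _](bigD1 y) //= eqxx mulr1.
      rewrite [X in _ = _ + X + _]big1 ?addr0; last first.
        by move=> z /negPf ->; rewrite mulr0.
      congr (_ + _); rewrite -mulr_suml; congr (_ * _).
      under [RHS]eq_bigr do rewrite mulrBr mulr1.
      by rewrite sumrB qp.2.
    apply: eq_bigr => z _; rewrite -mulr_sumr; congr (_ * _).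
    by rewrite (pprod_coord u (G z) (bp z)) big_bool /b /G.
  rewrite (fub (fun z (A : {ffun U -> bool}) o => q z * (\prod_v b z v (A v)) * w o *
    ((if (if A u then None else Some (enc o u)) is Some c
      then dec o c else z) == y)%:R)).
  apply: eq_bigr => z _; apply: eq_bigr => A _.
  under [RHS]eq_bigr do rewrite -mulrA.
  rewrite -mulr_sumr mulrA; congr (_ * _); rewrite /G.
  case: (A u); last exact: KE.
  by rewrite -mulr_suml wp.2 mul1r.
- split.
    move=> o; rewrite !mulr_ge0 ?wp.1 ?qp.1 ?(Ap _).1 //.
  rewrite (fub (fun z (A : {ffun U -> bool}) o => q z * (\prod_v b z v (A v)) * w o)).
  under eq_bigr do under eq_bigr do rewrite -mulr_sumr wp.2 mulr1.
  under eq_bigr do rewrite -mulr_sumr (Ap _).2 mulr1.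
  exact: qp.2.
Qed.

(** The geometric sum of the [s * (1 - s) ^+ i] over [i <= M] is at most [1], and its [M.+1] terms
    are all at least the last one. The bound is uniform in [s], so a small acceptance probability
    does no harm. *)
Lemma mul_expr_1m_le (s : R) (M : nat) : 0 <= s <= 1 ->
  s * (1 - s) ^+ M <= M.+1%:R^-1.
Proof.
move=> s01; rewrite -[leRHS]mul1r ler_pdivlMr ?ltr0n //.
have e : 1 = (1 - s) ^+ M.+1 + s * \sum_(i < M.+1) (1 - s) ^+ i.
  by have := subrX1 (1 - s) M.+1; rewrite [1 - s - 1](_ : _ = - s) ?mulNr; [lra|ring].
rewrite [leRHS]e; apply: ler_wpDl; first by apply: exprn_ge0; lra.
rewrite -mulrA ler_wpM2l //; first by lra.
rewrite mulr_natr -[X in _ *+ X](card_ord M.+1) -sumr_const ler_sum // => i _.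
by apply: ler_wiXn2l; [lra|lra|rewrite -ltnS].
Qed.

(* Rejection sampling: a code of size M + 1 reproduces the test channel [W] up
   to the mass where [W > B q] plus B / (M + 1). *)
Lemma rejection_code (U S : finType) (p : U -> R) (W : U -> S -> R) (q : S -> R)
    (B : R) (M : nat) :
  pmf p -> (forall u, pmf (W u)) -> pmf q -> (forall y, 0 < q y) -> 0 < B ->
  exists K : U -> S -> R, realizable M.+1 K /\
    forall (G : U -> S -> R) (G1 : R), (forall u y, 0 <= G u y <= G1) ->
    \sum_u p u * \sum_y K u y * G u y <= \sum_u p u * \sum_y W u y * G u y +
      G1 * (\sum_u p u * (\sum_(y | W u y > B * q y) W u y) + B / M.+1%:R).
Proof.
move=> pp Wp qp q0 B0.
have [y0 _] : exists y0 : S, True.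
  case: (pickP S) => [y0 _|S0]; first by exists y0.
  by move/eqP: qp.2; rewrite big_pred0 // eq_sym oner_eq0.
(* Acceptance probability for the envelope [B * q], truncated at [1] where the envelope fails; [s u]
   below is the probability that [u] accepts a fresh codeword. *)
pose a y u := Num.min 1 (W u y / (B * q y)).
have Bq y : 0 < B * q y by rewrite mulr_gt0.
have a01 y u : 0 <= a y u <= 1.
  rewrite /a le_min ler01 ge_min lexx /= andbT divr_ge0 ?(Wp _).1 // ltW //.
have a0 y u : 0 <= a y u by have /andP[] := a01 y u.
pose s u := \sum_y q y * a y u.
have s01 u : 0 <= s u <= 1.
  rewrite sumr_ge0 => [|y _]; last by rewrite mulr_ge0 ?qp.1.
  rewrite -qp.2 ler_sum // => y _; have := a01 y u => ?.
  by rewrite ler_piMr ?qp.1 //; lra.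
pose K := fix K M : U -> S -> R := if M is M'.+1 then
  fun u y => q y * a y u + (1 - s u) * K M' u y else fun _ y => (y0 == y)%:R.
have Kr N : realizable N.+1 (K N).
  elim: N => [|N IH]; first exact: realizable_const.
  exact: (realizable_accept qp a01 IH).
(* A lower bound suffices, since the fallback [y0] only adds mass. It is multiplied through by
   [s u], which may vanish. *)
have KE N u y : q y * a y u * (1 - (1 - s u) ^+ N) <= s u * K N u y.
  elim: N => [|N IH] /=.
    by rewrite expr0 subrr mulr0 mulr_ge0 ?ler0n //; have /andP[] := s01 u.
  have h : (1 - s u) * (q y * a y u * (1 - (1 - s u) ^+ N)) <=
      (1 - s u) * (s u * K N u y).
    by apply: ler_wpM2l => //; have := s01 u; lra.
  rewrite -/(K N) exprS; lra.
have K0 N u y : 0 <= K N u y.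
  elim: N => [|N IH] /=; first exact: ler0n.
  by rewrite addr_ge0 ?mulr_ge0 ?qp.1 //; have := s01 u; lra.
have K1 N u : \sum_y K N u y = 1.
  elim: N => [|N IH] /=; last by rewrite big_split /= -mulr_sumr IH mulr1 addrC subrK.
  by rewrite (bigD1 y0) //= eqxx big1 ?addr0 // => y; rewrite eq_sym => /negPf ->.
exists (K M); split=> // G G1 G01.
pose W' u y := if W u y <= B * q y then W u y else 0.
have W'a u y : W' u y <= B * (q y * a y u).
  rewrite /W' /a; case: ifP => h.
    rewrite min_r ?ler_pdivrMr ?mul1r // mulrA mulrCA divff ?mulr1 // gt_eqF //.
  by rewrite !mulr_ge0 ?qp.1 ?a0 // ltW.
have Bs u : B * s u <= 1.
  rewrite mulr_sumr -(Wp u).2 ler_sum // => y _; rewrite mulrA.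
  rewrite -(divfK (lt0r_neq0 (Bq y)) (W u y)) mulrC ler_wpM2r ?(ltW (Bq y)) //.
  by rewrite /a ge_min lexx orbT.
(* Multiply [KE] by [B] and drop the factor [B * s u <= 1]: the channel dominates the part [W'] of
   [W] below the envelope, up to a term carrying [(1 - s u) ^+ M], the probability that [M] rounds
   all reject. *)
have KW u y : W' u y - B * (q y * a y u) * (1 - s u) ^+ M <= K M u y.
  have h : B * (q y * a y u * (1 - (1 - s u) ^+ M)) <= B * (s u * K M u y).
    by rewrite ler_wpM2l ?KE // ltW.
  have h2 : B * s u * K M u y <= K M u y by rewrite ler_piMl.
  have := W'a u y; lra.
have step u : \sum_y K M u y * G u y <= \sum_y W u y * G u y +
    G1 * ((\sum_(y | W u y > B * q y) W u y) + B / M.+1%:R).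
  have r0 : 0 <= (1 - s u) ^+ M by apply: exprn_ge0; have := s01 u; lra.
  (* Both channels have mass one, so an upper bound for [G] is a lower bound for [G1 - G], to which
     [KW] applies. *)
  have G1G y : 0 <= G1 - G u y <= G1 by have := G01 u y; lra.
  have -> : \sum_y K M u y * G u y = G1 - \sum_y K M u y * (G1 - G u y).
    rewrite -[X in X - _](mul1r G1) -(K1 M u) mulr_suml -sumrB.
    by apply: eq_bigr => y _; ring.
  have -> : \sum_y W u y * G u y = G1 - \sum_y W u y * (G1 - G u y).
    rewrite -[X in X - _]mul1r -(Wp u).2 mulr_suml -sumrB.
    by apply: eq_bigr => y _; ring.
  have h : \sum_y (W u y * (G1 - G u y) - (W u y - W' u y) * G1 -
      B * (q y * a y u) * (1 - s u) ^+ M * G1) <= \sum_y K M u y * (G1 - G u y).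
    apply: ler_sum => y _; have [g0 g1] := andP (G1G y).
    apply: le_trans (ler_wpM2r g0 (KW u y)).
    have e1 : (W u y - W' u y) * (G1 - G u y) <= (W u y - W' u y) * G1.
      rewrite ler_wpM2l // subr_ge0 /W'; case: ifP => // _; exact: (Wp u).1.
    have e2 : B * (q y * a y u) * (1 - s u) ^+ M * (G1 - G u y) <=
       B * (q y * a y u) * (1 - s u) ^+ M * G1.
      by rewrite ler_wpM2l // !mulr_ge0 ?qp.1 // ltW.
    lra.
  have hb : \sum_(y | W u y > B * q y) W u y = \sum_y (W u y - W' u y).
    rewrite big_mkcond; apply: eq_bigr => y _.
    by rewrite /W' ltNge; case: (_ <= _); rewrite /= ?subrr ?subr0.
  have hs : B * s u * (1 - s u) ^+ M * G1 <= G1 * (B / M.+1%:R).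
    rewrite mulrC ler_wpM2l //; first by have := G01 u y0; lra.
    by rewrite -mulrA ler_wpM2l ?mul_expr_1m_le // ltW.
  have h2 : \sum_y (W u y * (G1 - G u y) - (W u y - W' u y) * G1 -
      B * (q y * a y u) * (1 - s u) ^+ M * G1) = \sum_y W u y * (G1 - G u y) -
      (\sum_y (W u y - W' u y)) * G1 - B * s u * (1 - s u) ^+ M * G1.
    by rewrite sumrB [in LHS]sumrB -!mulr_suml -mulr_sumr.
  rewrite h2 -hb in h.
  have aux (x1 x2 x3 x4 x5 : R) : x1 - x2 - x3 <= x4 -> x3 <= x5 ->
      G1 - x4 <= G1 - x1 + (x2 + x5) by lra.
  by rewrite mulrDr [G1 * \sum_(_ | _) _]mulrC; exact: aux h hs.
apply: le_trans (_ : \sum_u p u * (\sum_y W u y * G u y +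
    G1 * ((\sum_(y | W u y > B * q y) W u y) + B / M.+1%:R)) <= _).
  by apply: ler_sum => u _; rewrite ler_wpM2l ?pp.1.
under eq_bigr do rewrite mulrDr mulrCA mulrDr.
rewrite big_split /= -mulr_sumr big_split /= -mulr_suml pp.2 mul1r //.
Qed.

End FiniteInformation.

(** * Concentration, and block codes with shared randomness *)

Section BlockCoding.
Context {R : realType}.

(** Here [expR x <= (1 - x)^-1], and [1 - x] times the right-hand side is
    [1 + x ^+ 2 * (1 - 2 * x)], which is at least [1]. *)
Lemma expR_le_quad (x : R) : `|x| <= 2^-1 -> expR x <= 1 + x + 2 * x ^+ 2.
Proof.
rewrite ler_norml => xb.
have h := @expR_ge1Dx R (- x).
have hp : 0 < 1 - x by lra.
have -> : expR x = (expR (- x))^-1 by rewrite expRN invrK.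
apply: le_trans (_ : (1 - x)^-1 <= _).
  by rewrite lef_pV2 ?posrE ?expR_gt0 //.
rewrite -[leLHS]mul1r ler_pdivrMr //; nra.
Qed.

Lemma expr_small (rho eps : R) : 0 <= rho < 1 -> 0 < eps ->
  exists N, forall m, (N <= m)%N -> rho ^+ m <= eps.
Proof.
move=> /andP[r0 r1] e0.
have /cvgrPdist_le /(_ _ e0) [N _ h] : (rho ^+ n @[n --> \oo] --> (0 : R))%classic.
  by apply: cvg_expr; rewrite ger0_norm.
exists N => m Nm; have := h m Nm; rewrite sub0r normrN ger0_norm //.
by rewrite exprn_ge0.
Qed.

(** Exponential Markov inequality: the exponential moment of one centred letter is at most
    [rho < 1], and that of a sum of independent letters is its power. *)
Lemma chernoff (U S : finType) (p : U -> R) (W h : U -> S -> R) (mu eps : R) :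
  pmf p -> (forall u, pmf (W u)) -> \sum_u p u * \sum_y W u y * h u y = mu ->
  0 < eps ->
  exists2 rho : R, 0 <= rho < 1 & forall m,
    \sum_(u : {ffun 'I_m -> U}) (\prod_t p (u t)) *
      (\sum_(y : {ffun 'I_m -> S} | m%:R * (mu + eps) < \sum_t h (u t) (y t))
        \prod_t W (u t) (y t)) <= rho ^+ m.
Proof.
move=> pp Wp hmu e0.
pose h' u y := h u y - mu - eps.
pose H := 1 + eps + \sum_u \sum_y `|h' u y|.
have HP u y : `|h' u y| <= H.
  rewrite /H (bigD1 u) //= (bigD1 y) //=.
  have : 0 <= \sum_(i | i != y) `|h' u i| by apply: sumr_ge0.
  have : 0 <= \sum_(i | i != u) \sum_y `|h' i y|.
    by apply: sumr_ge0 => *; apply: sumr_ge0.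
  lra.
have He : 1 + eps <= H by rewrite /H lerDl; apply: sumr_ge0 => *; apply: sumr_ge0.
have H0 : 0 < H by lra.
(* This exponent makes the remainder [2 * (th * H) ^+ 2] half of the drift [th * eps], leaving
   [rho = 1 - th * eps / 2]. The term [1 + eps] in [H] keeps [th * H] below [4^-1], inside the range
   of [expR_le_quad]. *)
pose th := eps / (4 * H ^+ 2).
have th0 : 0 < th by rewrite divr_gt0 // mulr_gt0 ?exprn_gt0.
have thH : th * H <= 4^-1.
  rewrite /th (_ : _ * H = eps / H / 4); last by field; rewrite gt_eqF.
  by rewrite ler_piMl // ler_pdivrMr // mul1r; lra.
have thH2 : th * H ^+ 2 = eps / 4 by rewrite /th; field; rewrite gt_eqF.
pose rho := 1 - th * eps / 2.
have thee : th * eps <= 4^-1.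
  by apply: le_trans thH; rewrite ler_wpM2l ?(ltW th0) //; lra.
have te0 : 0 < th * eps by rewrite mulr_gt0.
exists rho; first by rewrite /rho; lra.
move=> m.
have mgf : \sum_u p u * \sum_y W u y * expR (th * h' u y) <= rho.
  apply: (@le_trans _ _ (\sum_u p u * \sum_y W u y *
      (1 + th * h' u y + 2 * (th * H) ^+ 2))).
    apply: ler_sum => u _; rewrite ler_wpM2l ?pp.1 //.
    apply: ler_sum => y _; rewrite ler_wpM2l ?(Wp u).1 //.
    have hb : `|th * h' u y| <= th * H.
      by rewrite normrM gtr0_norm // ler_wpM2l ?(ltW th0).
    apply: le_trans (expR_le_quad _) _; first by lra.
    rewrite lerD2l ler_wpM2l // -[leLHS]real_normK ?num_real //.
    by rewrite ler_sqr ?nnegrE // mulr_ge0 // ltW.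
  have -> : \sum_u p u * \sum_y W u y * (1 + th * h' u y + 2 * (th * H) ^+ 2) =
      1 + 2 * (th * H) ^+ 2 - th * eps.
    transitivity (\sum_u (p u * (1 + 2 * (th * H) ^+ 2 - th * mu - th * eps) +
        th * (p u * \sum_y W u y * h u y))).
      apply: eq_bigr => u _; rewrite [th * (p u * _)]mulrCA -mulrDr; congr (_ * _).
      rewrite -[X in X + _]mul1r -(Wp u).2 mulr_suml mulr_sumr -big_split /=.
      by apply: eq_bigr => y _; rewrite /h'; ring.
    by rewrite big_split /= -mulr_suml -mulr_sumr hmu pp.2; ring.
  have -> : 2 * (th * H) ^+ 2 = th * eps / 2.
    by rewrite (_ : _ * _ = 2 * th * (th * H ^+ 2)); [rewrite thH2; field | ring].
  by rewrite /rho; lra.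
apply: (@le_trans _ _ ((\sum_u p u * \sum_y W u y * expR (th * h' u y)) ^+ m)).
  rewrite -[X in _ ^+ X](card_ord m) -prodr_const.
  rewrite (bigA_distr_bigA (fun (_ : 'I_m) u => p u * \sum_y W u y * expR (th * h' u y))).
  apply: ler_sum => u _; rewrite big_split /= ler_wpM2l //.
    by apply: prodr_ge0 => *; apply: pp.1.
  rewrite (bigA_distr_bigA (fun t y => W (u t) y * expR (th * h' (u t) y))).
  rewrite big_mkcond; apply: ler_sum => y _; rewrite big_split /= -expR_sum.
  have W0 : 0 <= \prod_i W (u i) (y i) by apply: prodr_ge0 => *; apply: (Wp _).1.
  case: ifP => [hm|_]; last by rewrite mulr_ge0 ?expR_ge0.
  rewrite ler_peMr // -expR0 ler_expR -mulr_sumr mulr_ge0 ?(ltW th0) //.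
  have -> : \sum_i h' (u i) (y i) = \sum_i h (u i) (y i) - m%:R * mu - m%:R * eps.
    by rewrite /h' 2!sumrB !sumr_const card_ord !mulr_natl.
  lra.
apply: lerXn2r => //; rewrite nnegrE; last by rewrite /rho; lra.
apply: sumr_ge0 => u _; rewrite mulr_ge0 ?pp.1 // sumr_ge0 // => y _.
by rewrite mulr_ge0 ?expR_ge0 // (Wp u).1.
Qed.

(** Mutual information in nats when [q] is the output law of [W]; conversion to bits is left to the
    users. *)
Definition finite_mi (U S : finType) (p : U -> R) (W : U -> S -> R) (q : S -> R) : R :=
  \sum_u \sum_y xlog (p u * W u y) (p u * q y).

Lemma finite_mi_ge0 (U S : finType) (p : U -> R) (W : U -> S -> R) (q : S -> R) :
  pmf p -> (forall u, pmf (W u)) -> pmf q -> (forall y, 0 < q y) ->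
  0 <= finite_mi p W q.
Proof.
move=> pp Wp qp q0; rewrite /finite_mi pair_bigA /=.
apply: (gibbs (p := fun x : U * S => p x.1 * W x.1 x.2)
  (q := fun x : U * S => p x.1 * q x.2)) => [x|x|x|].
- by rewrite mulr_ge0 ?pp.1 ?(Wp _).1.
- by rewrite mulr_ge0 ?pp.1 ?qp.1.
- by move/eqP; rewrite mulf_eq0 [q _ == 0]gt_eqF // orbF => /eqP ->; rewrite mul0r.
rewrite -(pair_bigA _ (fun u y => p u * q y)) -(pair_bigA _ (fun u y => p u * W u y)) /=.
under eq_bigr do rewrite -mulr_sumr qp.2.
by under [leRHS]eq_bigr do rewrite -mulr_sumr (Wp _).2.
Qed.

(** Rejection sampling on the product alphabet, with envelope factor [B] of exponent [m * (I + e1)]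
    and about [expR (m * (I + 2 * e1))] codewords. The first exponent exceeds the mean information
    density by a margin that [chernoff] exploits; the gap between the two makes [B / M.+1]
    exponentially small. *)
Lemma block_code (U S : finType) (p : U -> R) (W : U -> S -> R) (q : S -> R)
    (eps : R) :
  pmf p -> (forall u, pmf (W u)) -> (forall y, q y = \sum_u p u * W u y) ->
  (forall y, 0 < q y) -> 0 < eps ->
  exists (m : nat) (Q C : finType) (w : Q -> R)
    (enc : Q -> {ffun 'I_m -> U} -> C) (dec : Q -> C -> {ffun 'I_m -> S}),
  [/\ (0 < m)%N, (0 < #|C|)%N, pmf w, ln #|C|%:R <= m%:R * (finite_mi p W q + eps) &
    forall (t : 'I_m) (G : U -> S -> R) (G1 : R), (forall u y, 0 <= G u y <= G1) ->
      \sum_o w o * (\sum_(u : {ffun 'I_m -> U}) (\prod_i p (u i)) *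
         G (u t) (dec o (enc o u) t)) <=
      \sum_u p u * (\sum_y W u y * G u y) + eps * G1].
Proof.
move=> pp Wp qE q0 e0.
have qp : pmf q.
  split=> [y|]; first exact: ltW.
  under eq_bigr do rewrite qE; rewrite exchange_big /=.
  by under eq_bigr do rewrite -mulr_sumr (Wp _).2 mulr1; exact: pp.2.
set I := finite_mi p W q.
have I0 : 0 <= I by exact: finite_mi_ge0.
pose h u y := ln (W u y / q y).
have hI : \sum_u p u * \sum_y W u y * h u y = I.
  apply: eq_bigr => u _; rewrite mulr_sumr; apply: eq_bigr => y _.
  rewrite /xlog /h mulf_eq0; have [->|pN] := eqVneq (p u) 0; first by rewrite mul0r.
  have [->|WN] /= := eqVneq (W u y) 0; first by rewrite !mul0r mulr0.
  by rewrite mulrA -mulf_div divff // mul1r.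
pose e1 := eps / 4.
have e10 : 0 < e1 by rewrite divr_gt0.
have e20 : 0 < eps / 2 by rewrite divr_gt0.
have [rho rho01 hrho] := chernoff pp Wp hI e10.
have [N1 hN1] := expr_small rho01 e20.
have ee : 0 <= expR (- e1) < 1 by rewrite expR_ge0 /= -expR0 ltr_expR oppr_lt0.
have [N2 hN2] := expr_small ee e20.
(* [N1] serves the concentration bound and [N2] the ratio [B / M.+1]. The last summand gives
   [1 <= m%:R * (2 * e1)], which pays for the [ln 2] lost in bounding [M.+1] by [2 * X]. *)
pose m := (maxn N1 N2 + (Num.trunc (2 * e1)^-1).+1)%N.
have mN1 : (N1 <= m)%N by rewrite (leq_trans (leq_maxl N1 N2)) // leq_addr.
have mN2 : (N2 <= m)%N by rewrite (leq_trans (leq_maxr N1 N2)) // leq_addr.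
have m0 : (0 < m)%N by rewrite /m addnS.
have me : 1 <= m%:R * (2 * e1).
  have hp : 0 < 2 * e1 by rewrite mulr_gt0.
  rewrite -ler_pdivrMr // mul1r /m natrD ler_wpDl //.
  have i0 : 0 <= (2 * e1)^-1 by rewrite invr_ge0 ltW.
  by have /andP[_ /ltW] := truncn_itv i0.
pose pm (u : {ffun 'I_m -> U}) := \prod_i p (u i).
pose Wm (u : {ffun 'I_m -> U}) (y : {ffun 'I_m -> S}) := \prod_i W (u i) (y i).
pose qm (y : {ffun 'I_m -> S}) := \prod_i q (y i).
have pmp : pmf pm by apply: (pprod_pmf (b := fun=> p)).
have Wmp u : pmf (Wm u) by apply: (pprod_pmf (b := fun t => W (u t))).
have qmp : pmf qm by apply: (pprod_pmf (b := fun=> q)).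
have qm0 y : 0 < qm y by apply: prodr_gt0.
pose B := expR (m%:R * (I + e1)).
have B0 : 0 < B by exact: expR_gt0.
pose X := expR (m%:R * (I + 2 * e1)).
pose M := Num.trunc X.
have X1 : 1 <= X.
  by rewrite -expR0 ler_expR mulr_ge0 // addr_ge0 // mulr_ge0 // ltW.
have /andP[MX XM] : M%:R <= X < M.+1%:R.
  by apply: truncn_itv; rewrite expR_ge0.
have [K [[Q [C [w [enc [dec [wp cC KE]]]]]] KG]] := rejection_code M pmp Wmp qmp qm0 B0.
exists m, Q, C, w, enc, dec; split=> //; first by rewrite cC.
  rewrite cC; apply: (@le_trans _ _ (ln (2 * X))).
    rewrite ler_ln ?posrE ?ltr0n ?mulr_gt0 ?expR_gt0 //.
    by rewrite -natr1; lra.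
  rewrite lnM ?posrE ?expR_gt0 // expRK.
  have l2 : ln 2 <= 1 :> R by have := @ln_le_subr1 R 2 (ltr0Sn _ 1); lra.
  have -> : m%:R * (I + eps) = m%:R * (2 * e1) + m%:R * (I + 2 * e1).
    by rewrite /e1; field.
  lra.
move=> t G G1 G01.
have {}KG := KG (fun u y => G (u t) (y t)) G1 (fun u y => G01 (u t) (y t)).
have -> : \sum_o w o * (\sum_(u : {ffun 'I_m -> U}) (\prod_i p (u i)) *
         G (u t) (dec o (enc o u) t)) =
   \sum_u pm u * \sum_y K u y * G (u t) (y t).
  under eq_bigr do rewrite mulr_sumr.
  rewrite exchange_big /=; apply: eq_bigr => u _.
  under eq_bigr do rewrite mulrCA.
  rewrite -mulr_sumr; congr (_ * _).
  under [RHS]eq_bigr do rewrite KE mulr_suml.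
  rewrite exchange_big /=; apply: eq_bigr => o _.
  rewrite (bigD1 (dec o (enc o u))) //= eqxx mulr1 big1 ?addr0 // => y.
  by rewrite eq_sym => /negPf ->; rewrite mulr0 mul0r.
apply: le_trans KG _; apply: lerD.
  have Wc u : \sum_y Wm u y * G (u t) (y t) = \sum_y W (u t) y * G (u t) y.
    exact: (pprod_coord t (G (u t)) (fun i => Wp (u i))).
  under eq_bigr do rewrite Wc.
  by rewrite (pprod_coord t (fun a => \sum_y W a y * G a y) (fun=> pp)).
have G10 : 0 <= G1.
  have [u0 _|U0] := pickP U; last by move/eqP: pp.2; rewrite big_pred0 // eq_sym oner_eq0.
  have [y0 _|S0] := pickP S; last by move/eqP: qp.2; rewrite big_pred0 // eq_sym oner_eq0.
  by have := G01 u0 y0; lra.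
rewrite mulrC ler_wpM2r //.
have b1 : \sum_u pm u * (\sum_(y | B * qm y < Wm u y) Wm u y) <= eps / 2.
  apply: le_trans (hN1 m mN1); apply: le_trans (hrho m).
  apply: ler_sum => u _; rewrite ler_wpM2l ?pmp.1 //.
  rewrite big_mkcond [leRHS]big_mkcond /=; apply: ler_sum => y _.
  case: ifP => [hB|_]; last by case: ifP => // _; exact: (Wmp u).1.
  suff -> : m%:R * (I + e1) < \sum_t h (u t) (y t) by [].
  rewrite -ltr_expR expR_sum -/B.
  have WN i : W (u i) (y i) != 0.
    apply/eqP => W0; have : 0 < Wm u y.
      by apply: le_lt_trans hB; rewrite mulr_ge0 ?qmp.1 // ltW.
    by rewrite /Wm (bigD1 i) //= W0 mul0r ltxx.
  have -> : \prod_i expR (h (u i) (y i)) = Wm u y / qm y.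
    rewrite -prodf_div; apply: eq_bigr => i _; rewrite /h lnK // posrE divr_gt0 //.
    by rewrite lt_neqAle eq_sym WN (Wp _).1.
  by rewrite ltr_pdivlMr.
have b2 : B / M.+1%:R <= eps / 2.
  apply: le_trans (hN2 m mN2); rewrite -expRM_natl ler_pdivrMr ?ltr0n //.
  apply: (@le_trans _ _ (expR (m%:R * - e1) * X)).
    by rewrite /X -expRD ler_expR; lra.
  by rewrite ler_wpM2l ?expR_ge0 // ltW.
by apply: le_trans (lerD b1 b2) _; rewrite -splitr.
Qed.

End BlockCoding.

(** * Deterministic codes for a finite source *)

Section DiscreteCode.
Context {R : realType}.

(** Points are assigned one by one, each to a value whose load does not exceed its target so far.
    Such a value exists because the placed mass is at most one, and the final overshoot is at most
    one point. *)
Lemma greedy_map (Om E : finType) (mu : Om -> R) (v : E -> R) (eps : R) :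
  pmf mu -> (forall o, mu o <= eps) -> pmf v ->
  exists e : Om -> E, forall x, \sum_(o | e o == x) mu o <= v x + eps.
Proof.
move=> [mu0 mu1] mue vp.
have [x0 _|E0] := pickP E; last by move/eqP: vp.2; rewrite big_pred0 // eq_sym oner_eq0.
have [w0 _|Om0] := pickP Om; last by move/eqP: mu1; rewrite big_pred0 // eq_sym oner_eq0.
have e0 : 0 <= eps by apply: le_trans (mue w0).
suff [e he] : exists e : Om -> E, forall x,
    \sum_(o <- enum Om | e o == x) mu o <= v x + eps.
  by exists e => x; have := he x; rewrite big_enum_cond.
have : uniq (enum Om) by exact: enum_uniq.
elim: (enum Om) => [_|o s IH /= /andP[os us]].
  by exists (fun=> x0) => x; rewrite big_nil addr_ge0 // vp.1.
have [e he] := IH us.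
have [x hx] : exists x, \sum_(o' <- s | e o' == x) mu o' <= v x.
  apply/not_existsP => hn.
  have : \sum_x v x < \sum_x \sum_(o' <- s | e o' == x) mu o'.
    apply: ltr_sum => [|x _]; last by rewrite ltNge; apply/negP.
    by apply/hasP; exists x0; rewrite // mem_index_enum.
  have -> : \sum_x \sum_(o' <- s | e o' == x) mu o' = \sum_(o' <- s) mu o'.
    by rewrite [RHS](partition_big e xpredT).
  rewrite vp.2 -mu1 ltNge => /negP; apply.
  by rewrite big_uniq //= [leRHS](bigID (mem s)) /= lerDl sumr_ge0.
exists (fun o' => if o' == o then x else e o') => z.
rewrite big_cons eqxx.
have -> : \sum_(j <- s | (if j == o then x else e j) == z) mu j =
    \sum_(j <- s | e j == z) mu j.
  rewrite big_seq_cond [RHS]big_seq_cond; apply: eq_bigl => j.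
  by case: (eqVneq j o) => [->|//]; rewrite (negPf os).
case: eqVneq => [<-|_]; last exact: he.
by rewrite addrC lerD.
Qed.

(** Prescribing the selected coordinates is a product of conditions, one per coordinate, so the sum
    factors by distributivity; unselected coordinates contribute [1]. *)
Lemma pprod_marginal (I J U : finType) (p : U -> R) (iota : J -> I)
    (H : {ffun J -> U} -> R) : injective iota -> pmf p ->
  \sum_(u : {ffun I -> U}) (\prod_i p (u i)) * H [ffun j => u (iota j)] =
  \sum_(v : {ffun J -> U}) (\prod_j p (v j)) * H v.
Proof.
move=> inj pp.
rewrite (partition_big (fun u : {ffun I -> U} => [ffun j => u (iota j)]) xpredT) //=.
apply: eq_bigr => v _.
rewrite (eq_bigr (fun u : {ffun I -> U} => (\prod_i p (u i)) * H v)); last first.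
  by move=> u /eqP ->.
rewrite -mulr_suml; congr (_ * _).
pose F i a : R := p a * [forall j, (iota j == i) ==> (a == v j)]%:R.
transitivity (\sum_(u : {ffun I -> U}) \prod_i F i (u i)).
  rewrite big_mkcond; apply: eq_bigr => u _; rewrite big_split /=.
  have -> : \prod_i [forall j, (iota j == i) ==> (u i == v j)]%:R =
      ([ffun j => u (iota j)] == v)%:R :> R.
    case: (eqVneq [ffun j => u (iota j)] v) => [<-|ne].
      apply: big1 => i _; suff -> : [forall j, (iota j == i) ==>
        (u i == [ffun j => u (iota j)] j)] by [].
      by apply/forallP => j; apply/implyP => /eqP <-; rewrite ffunE.
    have [j /eqP hj] : exists j, u (iota j) != v j.
      apply/existsP; apply: contra_neqT ne; rewrite negb_exists => /forallP h.
      by apply/ffunP => j; rewrite ffunE; have /negPn/eqP := h j.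
    rewrite (bigD1 (iota j)) //=.
    suff -> : [forall j0, (iota j0 == iota j) ==> (u (iota j) == v j0)] = false.
      by rewrite mul0r.
    by apply/forallP => /(_ j); rewrite eqxx /= => /eqP.
  by case: ifP; rewrite ?mulr1 ?mulr0.
rewrite -(bigA_distr_bigA F) (bigID (mem (codom iota))) /= [X in _ * X]big1; last first.
  move=> i /codomP hi; rewrite -pp.2; apply: eq_bigr => a _; rewrite /F.
  suff -> : [forall j, (iota j == i) ==> (a == v j)] by rewrite mulr1.
  by apply/forallP => j; apply/implyP => /eqP ij; case: hi; exists j.
rewrite mulr1 -big_uniq; last by rewrite map_inj_uniq ?enum_uniq.
rewrite big_map big_enum; apply: eq_bigr => j _.
rewrite (bigD1 (v j)) //= big1 => [|a av]; rewrite /F.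
  suff -> : [forall j0, (iota j0 == iota j) ==> (v j == v j0)] by rewrite mulr1 addr0.
  by apply/forallP => k; apply/implyP => /eqP /inj ->.
suff -> : [forall k, (iota k == iota j) ==> (a == v k)] = false by rewrite mulr0.
by apply/forallP => /(_ j); rewrite eqxx /= (negPf av).
Qed.

Lemma pprod_marginal2 (I A B U : finType) (p : U -> R) (ia : A -> I) (ib : B -> I)
    (H : {ffun A -> U} -> {ffun B -> U} -> R) :
  injective ia -> injective ib -> (forall a b, ia a != ib b) -> pmf p ->
  \sum_(u : {ffun I -> U}) (\prod_i p (u i)) *
     H [ffun a => u (ia a)] [ffun b => u (ib b)] =
  \sum_(a : {ffun A -> U}) (\prod_i p (a i)) *
     \sum_(b : {ffun B -> U}) (\prod_i p (b i)) * H a b.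
Proof.
move=> inja injb dab pp.
pose iota (j : A + B) := match j with inl a => ia a | inr b => ib b end.
have inji : injective iota.
  move=> [a|b] [a'|b'] //= e; first by rewrite (inja _ _ e).
  - by move/eqP: (dab a b'); rewrite e.
  - by move/eqP: (dab a' b); rewrite e.
  - by rewrite (injb _ _ e).
pose l (v : {ffun A + B -> U}) : {ffun A -> U} := [ffun a => v (inl a)].
pose r (v : {ffun A + B -> U}) : {ffun B -> U} := [ffun b => v (inr b)].
transitivity (\sum_(u : {ffun I -> U}) (\prod_i p (u i)) *
    (H (l [ffun j => u (iota j)]) (r [ffun j => u (iota j)]))).
  by apply: eq_bigr => u _; congr (_ * H _ _); apply/ffunP => x; rewrite !ffunE.
rewrite (pprod_marginal (fun v => H (l v) (r v)) inji pp).
pose jn (ab : {ffun A -> U} * {ffun B -> U}) : {ffun A + B -> U} :=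
  [ffun j => match j with inl a => ab.1 a | inr b => ab.2 b end].
rewrite (reindex jn) /=; last first.
  exists (fun v => (l v, r v)) => [[a b] _|v _].
    by congr (_, _); apply/ffunP => x; rewrite !ffunE.
  by apply/ffunP => -[x|x]; rewrite !ffunE.
under [RHS]eq_bigr do rewrite mulr_sumr.
rewrite pair_bigA /=; apply: eq_bigr => -[a b] _ /=.
rewrite big_sumType /= mulrA; congr (_ * _ * H _ _).
- by apply: eq_bigr => x _; rewrite ffunE.
- by apply: eq_bigr => x _; rewrite ffunE.
- by apply/ffunP => x; rewrite !ffunE.
- by apply/ffunP => x; rewrite !ffunE.
Qed.

(* The source prefix plays the role of shared randomness: it selects the code
   used by all the blocks, and directly the letters outside of the blocks. *)
Lemma discrete_code (U S : finType) (p : U -> R) (W : U -> S -> R) (q : S -> R)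
    (delta : U -> S -> R) (d1 c eps : R) :
  pmf p -> (forall u, pmf (W u)) -> (forall y, q y = \sum_u p u * W u y) ->
  (forall y, 0 < q y) -> (forall u, p u <= c) -> 0 <= c < 1 ->
  (forall u y, 0 <= delta u y <= d1) -> 0 < eps ->
  exists N, forall n, (N <= n)%N ->
    exists (Z : finType) (f : {ffun 'I_n -> U} -> Z) (g : Z -> 'I_n -> S),
    [/\ ln #|Z|%:R <= n%:R * (finite_mi p W q + eps),
        \sum_t \sum_(u : {ffun 'I_n -> U}) (\prod_i p (u i)) * delta (u t) (g (f u) t)
          <= n%:R * (\sum_u p u * (\sum_y W u y * delta u y) + eps) &
        forall t y, \sum_(u : {ffun 'I_n -> U} | g (f u) t == y) \prod_i p (u i)
          <= q y + eps].
Proof.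
have aux (a b l k : nat) : (a + b + l <= k)%N -> [/\ (a <= k)%N, (b <= k)%N & (l <= k)%N].
  by move=> h; split; lia.
have aux2 (n L m b r : nat) : (n - L = b + r)%N -> (r < m)%N -> (n - b <= L + m)%N.
  by lia.
move=> pp Wp qE q0 pc c01 d01 e0.
have qp : pmf q.
  split=> [y|]; first exact: ltW.
  under eq_bigr do rewrite qE; rewrite exchange_big /=.
  by under eq_bigr do rewrite -mulr_sumr (Wp _).2 mulr1; exact: pp.2.
have [u0 _|U0] := pickP U; last by move/eqP: pp.2; rewrite big_pred0 // eq_sym oner_eq0.
have [y0 _|S0] := pickP S; last by move/eqP: qp.2; rewrite big_pred0 // eq_sym oner_eq0.
have d10 : 0 <= d1 by have := d01 u0 y0; lra.
set I := finite_mi p W q.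
have I0 : 0 <= I by exact: finite_mi_ge0.
pose e1 := eps / (4 * (1 + d1)).
have dp : 0 < 1 + d1 by lra.
have e10 : 0 < e1 by rewrite divr_gt0 // mulr_gt0.
have e1d : e1 * (1 + d1) = eps / 4 by rewrite /e1; field; rewrite gt_eqF.
have e1e : e1 <= eps / 4 by rewrite -e1d mulrDr mulr1 lerDl mulr_ge0 // ltW.
have e1d1 : e1 * d1 <= eps / 4 by rewrite -e1d mulrDr mulr1 lerDr ltW.
have [m [Q [C [w [enc [dec [m0 C0 wp cC codeP]]]]]]] := block_code pp Wp qE q0 e10.
(* Target of the extraction: the shared randomness of the block code and an independent letter of
   law [q] for the positions outside the blocks. *)
pose v (x : Q * S) := w x.1 * q x.2.
have vp : pmf v.
  split=> [x|]; first by rewrite mulr_ge0 ?wp.1 ?qp.1.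
  rewrite -(pair_bigA _ (fun o y => w o * q y)) /=.
  by under eq_bigr do rewrite -mulr_sumr qp.2 mulr1; exact: wp.2.
have E0 : (0 < #|{: Q * S}|)%N.
  apply/card_gt0P; have [x0 _|Q0] := pickP Q; first by exists (x0, y0).
  by move/eqP: wp.2; rewrite big_pred0 // eq_sym oner_eq0.
have Er0 : 0 < #|{: Q * S}|%:R :> R by rewrite ltr0n.
(* The extraction error occurs once per value, hence the division by their number; [c ^+ L] bounds
   the probability of every prefix of length [L]. *)
pose e2 := e1 / #|{: Q * S}|%:R.
have e20 : 0 < e2 by rewrite divr_gt0.
have [L hL] := expr_small c01 e20.
have pLe (u : {ffun 'I_L -> U}) : \prod_i p (u i) <= e2.
  apply: le_trans (hL L (leqnn L)); rewrite -[X in _ ^+ X](card_ord L) -prodr_const.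
  by apply: ler_prod => i _; rewrite pp.1 pc.
have [e he] := greedy_map (pprod_pmf (fun _ : 'I_L => pp)) pLe vp.
have PhiP (Phi : Q * S -> R) (G1 : R) : (forall x, 0 <= Phi x <= G1) ->
    \sum_(a : {ffun 'I_L -> U}) (\prod_i p (a i)) * Phi (e a) <=
    \sum_x v x * Phi x + e1 * G1.
  move=> Phi01; rewrite (partition_big e xpredT) //=.
  have -> : e1 * G1 = \sum_(x : Q * S) e2 * G1.
    have e2E : e2 * #|{: Q * S}|%:R = e1 by rewrite divfK ?gt_eqF.
    by rewrite -e2E sumr_const -[RHS]mulr_natr mulrAC.
  rewrite -big_split /=; apply: ler_sum => x _.
  rewrite (eq_bigr (fun a : {ffun 'I_L -> U} => (\prod_i p (a i)) * Phi x)); last first.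
    by move=> a /eqP ->.
  have [f0 f1] := andP (Phi01 x).
  rewrite -mulr_suml; apply: le_trans (ler_wpM2r f0 (he x)) _.
  by rewrite mulrDl lerD2l ler_wpM2l // ltW.
pose kap := ln #|{: Q * S}|%:R : R.
(* The summands ensure that the prefix fits, that describing the extracted pair costs at most
   [n%:R * e1] nats, and that the at most [L + m] letters outside the blocks add at most [n%:R * e1]
   to the total distortion. *)
pose N := (L + (Num.trunc (`|kap| / e1)).+1 + (Num.trunc (d1 * (L + m)%:R / e1)).+1)%N.
exists N => n Nn.
have [nLn nkap nd1] := aux _ _ _ _ Nn.
have nK : kap <= n%:R * e1.
  rewrite -ler_pdivrMr //; apply: (@le_trans _ _ (`|kap| / e1)).
    by rewrite ler_pM2r ?invr_gt0 // ler_norm.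
  have i0 : 0 <= `|kap| / e1 by rewrite divr_ge0 // ltW.
  have /andP[_ /ltW h] := truncn_itv i0; apply: le_trans h _.
  by rewrite ler_nat.
have nD : d1 * (L + m)%:R <= n%:R * e1.
  rewrite -ler_pdivrMr //.
  have i0 : 0 <= d1 * (L + m)%:R / e1 by apply: divr_ge0; [apply: mulr_ge0|apply: ltW].
  have /andP[_ /ltW h] := truncn_itv i0; apply: le_trans h _.
  by rewrite ler_nat.
pose b := ((n - L) %/ m)%N.
have bm : (b * m <= n - L)%N by exact: leq_trunc_div.
have posP (x : 'I_b * 'I_m) : (L + (x.1 * m + x.2) < n)%N.
  rewrite -ltn_subRL (leq_trans _ bm) // (@leq_trans (x.1.+1 * m)) //.
    by rewrite mulSn addnC ltn_add2r.
  by rewrite leq_mul2r ltn_ord orbT.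
pose pos x : 'I_n := Ordinal (posP x).
have pos_inj : injective pos.
  move=> [i s] [i' s'] /(congr1 val) /= /addnI h.
  have hi : val i = val i'.
    by have := congr1 (divn^~ m) h; rewrite !divnMDl // !divn_small ?addn0.
  have hs : val s = val s' by move: h; rewrite hi => /addnI.
  by congr (_, _); apply: val_inj.
pose pre := widen_ord nLn.
have pre_inj : injective pre by move=> i j /(congr1 val) /= h; apply: val_inj.
have pre_pos i x : pre i != pos x.
  by rewrite neq_ltn /= (leq_trans (ltn_ord i)) // leq_addr.
pose blk (t : 'I_n) := [pick x | pos x == t].
pose upre (u : {ffun 'I_n -> U}) : {ffun 'I_L -> U} := [ffun i => u (pre i)].
pose ublk (i : 'I_b) (u : {ffun 'I_n -> U}) : {ffun 'I_m -> U} := [ffun s => u (pos (i, s))].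
(* The extracted pair is part of the transmitted index, so encoder and decoder share it. *)
pose f (u : {ffun 'I_n -> U}) := (e (upre u), [ffun i => enc (e (upre u)).1 (ublk i u)]).
pose g (z : (Q * S) * {ffun 'I_b -> C}) (t : 'I_n) : S :=
  if blk t is Some x then dec z.1.1 (z.2 x.1) x.2 else z.1.2.
exists ((Q * S) * {ffun 'I_b -> C})%type, f, g.
have someP t x (G : U -> S -> R) (G1 : R) : blk t = Some x ->
    (forall u y, 0 <= G u y <= G1) ->
    \sum_(u : {ffun 'I_n -> U}) (\prod_i p (u i)) * G (u t) (g (f u) t) <=
    \sum_u p u * (\sum_y W u y * G u y) + 2 * e1 * G1.
  move=> bt G01.
  have tx : pos x = t.
    by move: bt; rewrite /blk; case: pickP => // x' /eqP <- [<-].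
  pose ib (s : 'I_m) := pos (x.1, s).
  have ib_inj : injective ib by move=> s s' /pos_inj [].
  have dis i s : pre i != ib s by exact: pre_pos.
  (* Prefix and block are disjoint sets of source letters, so the extracted randomness is
     independent of the block being coded. *)
  have := pprod_marginal2 (fun a bl => G (bl x.2) (dec (e a).1 (enc (e a).1 bl) x.2))
    pre_inj ib_inj dis pp.
  rewrite (eq_bigr (fun u : {ffun 'I_n -> U} => (\prod_i p (u i)) * G (u t) (g (f u) t)));
    last first.
    move=> u _; congr (_ * G _ _).
      by rewrite ffunE /ib -tx; congr (u (pos _)); case: (x).
    rewrite /g bt /= ffunE; congr (dec _ (enc _ _) _).
  move=> ->.
  pose Phi (z : Q * S) := \sum_(bl : {ffun 'I_m -> U}) (\prod_i p (bl i)) *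
      G (bl x.2) (dec z.1 (enc z.1 bl) x.2).
  have PhiB z : 0 <= Phi z <= G1.
    have [pm0 pm1] := pprod_pmf (fun _ : 'I_m => pp).
    apply/andP; split.
      by apply: sumr_ge0 => bl _; rewrite mulr_ge0 //; have /andP[] := G01 (bl x.2)
        (dec z.1 (enc z.1 bl) x.2).
    rewrite -[leRHS]mul1r -pm1 mulr_suml; apply: ler_sum => bl _.
    by rewrite ler_wpM2l //; have /andP[] := G01 (bl x.2) (dec z.1 (enc z.1 bl) x.2).
  apply: le_trans (PhiP _ _ PhiB) _.
  have -> : \sum_z v z * Phi z = \sum_o w o * Phi (o, y0).
    rewrite -(pair_bigA _ (fun o y => v (o, y) * Phi (o, y))) /=.
    apply: eq_bigr => o _; rewrite /v /Phi /=.
    by rewrite -mulr_suml -mulr_sumr qp.2 mulr1.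
  by have := codeP x.2 G G1 G01; rewrite -/(Phi _); rewrite /Phi /=; lra.
have noneP t y : blk t = None ->
    \sum_(u : {ffun 'I_n -> U}) (\prod_i p (u i)) * (g (f u) t == y)%:R <=
    q y + e1.
  move=> bt; rewrite /g bt /=.
  rewrite (pprod_marginal (fun a => ((e a).2 == y)%:R) pre_inj pp).
  apply: le_trans (PhiP (fun x => (x.2 == y)%:R) 1 _) _.
    by move=> x; rewrite ler0n /= lern1 leq_b1.
  rewrite mulr1 lerD2r -(pair_bigA _ (fun o z => v (o, z) * (z == y)%:R)) /=.
  have -> // : \sum_o \sum_z v (o, z) * (z == y)%:R = q y.
  have -> : q y = (\sum_o w o) * q y by rewrite wp.2 mul1r.
  rewrite mulr_suml; apply: eq_bigr => o _.
  rewrite (bigD1 y) //= eqxx mulr1 big1 ?addr0 // => z /negPf ->.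
  by rewrite mulr0.
split.
- rewrite card_prod card_ffun card_ord natrM natrX lnM ?posrE ?exprn_gt0 ?ltr0n //.
  rewrite lnXn ?ltr0n //.
  have h1 : ln #|C|%:R *+ b <= n%:R * (I + e1).
    apply: (@le_trans _ _ (m%:R * (I + e1) *+ b)); first by rewrite lerMn2r cC orbT.
    have Ie : 0 <= I + e1 by rewrite addr_ge0 // ltW.
    rewrite -mulr_natl mulrA -natrM ler_wpM2r //.
    by rewrite ler_nat (leq_trans bm) // leq_subr.
  have : n%:R * e1 <= n%:R * (eps / 4) :> R by rewrite ler_wpM2l.
  have : 0 <= n%:R * eps by rewrite mulr_ge0 // ltW.
  rewrite -/kap; lra.
- pose Db := \sum_u p u * (\sum_y W u y * delta u y).
  have Db0 : 0 <= Db.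
    apply: sumr_ge0 => u _; rewrite mulr_ge0 ?pp.1 // sumr_ge0 // => y _.
    by rewrite mulr_ge0 ?(Wp u).1 //; have /andP[] := d01 u y.
  apply: (@le_trans _ _ (\sum_(t < n) ((Db + 2 * e1 * d1) +
      (if t \in codom pos then 0 else d1)))).
    apply: ler_sum => t _; case: ifPn => [/codomP [x tx]|nt].
      rewrite addr0; apply: (@someP t x) => //.
      by rewrite /blk; case: pickP => [x'|/(_ x)]; rewrite tx ?eqxx // => /eqP /pos_inj ->.
    have e10' := ltW e10.
    (* A prefix letter may depend on its own reconstruction, so outside the blocks only the bound
       [d1] is used. *)
    apply: (@le_trans _ _ d1); first last.
      by rewrite lerDr addr_ge0 // mulr_ge0 // mulr_ge0.
    have [pm0 pm1] := pprod_pmf (fun _ : 'I_n => pp).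
    have -> : d1 = (\sum_(u : {ffun 'I_n -> U}) \prod_i p (u i)) * d1.
      by rewrite pm1 mul1r.
    rewrite mulr_suml; apply: ler_sum => u _.
    by rewrite ler_wpM2l //; have /andP[] := d01 (u t) (g (f u) t).
  rewrite big_split /= sumr_const card_ord -[_ *+ n]mulr_natl.
  have -> : \sum_(t < n) (if t \in codom pos then 0 else d1) = d1 * (n - b * m)%:R.
    rewrite (eq_bigr (fun t => if t \notin codom pos then d1 else 0)); last first.
      by move=> t _; case: (_ \in _).
    rewrite -big_mkcond sumr_const mulr_natr; congr (_ *+ _).
    have := cardC (mem (codom pos)); rewrite card_codom // card_prod !card_ord => h.
    by rewrite -[in RHS]h addKn; apply: eq_card => t.
  have hbm : d1 * (n - b * m)%:R <= n%:R * e1.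
    apply: le_trans nD; rewrite ler_wpM2l // ler_nat.
    have hm : ((n - L) %% m < m)%N by rewrite ltn_mod.
    exact: aux2 (divn_eq (n - L) m) hm.
  have h1 : n%:R * (e1 * d1) <= n%:R * (eps / 4) by rewrite ler_wpM2l.
  have h2 : n%:R * e1 <= n%:R * (eps / 4) by rewrite ler_wpM2l.
  have : 0 <= n%:R * eps by rewrite mulr_ge0 // ltW.
  rewrite -/Db; lra.
- move=> t y.
  have -> : \sum_(u : {ffun 'I_n -> U} | g (f u) t == y) \prod_i p (u i) =
    \sum_(u : {ffun 'I_n -> U}) (\prod_i p (u i)) * (g (f u) t == y)%:R.
    by rewrite big_mkcond; apply: eq_bigr => u _; case: (_ == _); rewrite ?mulr1 ?mulr0.
  case bt : (blk t) => [x|]; last by apply: le_trans (noneP _ _ bt) _; lra.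
  apply: le_trans (@someP t x (fun _ z => (z == y)%:R) 1 bt _) _.
    by move=> _ z; rewrite ler0n /= lern1 leq_b1.
  have -> : \sum_u p u * \sum_z W u z * (z == y)%:R = q y.
    rewrite qE; apply: eq_bigr => u _; congr (_ * _).
    by rewrite (bigD1 y) //= eqxx mulr1 big1 ?addr0 // => z /negPf ->; rewrite mulr0.
  lra.
Qed.

End DiscreteCode.

(** * Image laws, mixtures of kernels, finite fibres *)

Section MeasureTools.
Context d1 d2 (X : measurableType d1) (Y : measurableType d2) (R : realType).

Definition mfun_of (phi : X -> Y) (mphi : measurable_fun setT phi) : {mfun X >-> Y} :=
  HB.pack phi (isMeasurableFun.Build _ _ _ _ _ mphi).

Definition law (P : probability X R) (phi : X -> Y)
    (mphi : measurable_fun setT phi) : probability Y R :=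
  distribution P (mfun_of mphi).

Lemma integral_law (P : probability X R) (phi : X -> Y)
    (mphi : measurable_fun setT phi) (h : Y -> \bar R) :
  measurable_fun setT h -> (forall y, (0 <= h y)%E) ->
  (\int[law P mphi]_y h y = \int[P]_x h (phi x))%E.
Proof.
by move=> mh h0; rewrite (ge0_integral_pushforward mphi P measurableT mh).
Qed.

Definition prob_of (nu : {measure set X -> \bar R}) (h : nu setT = 1%E) :
  set X -> \bar R := nu.
HB.instance Definition _ nu h := Measure.copy (@prob_of nu h) nu.
HB.instance Definition _ nu h :=
  Measure_isProbability.Build _ _ _ (@prob_of nu h) h.

Definition kmix n (v : nat -> {nonneg R}) (k : nat -> R.-pker X ~> Y) (x : X) :
  {measure set Y -> \bar R} := msum (fun i => mscale (v i) (k i x)) n.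

Lemma kmixE n v k x A :
  kmix n v k x A = (\sum_(i < n) (v i)%:num%:E * k i x A)%E.
Proof. by []. Qed.

Lemma measurable_kmix n v k A :
  measurable A -> measurable_fun [set: X] (kmix n v k ^~ A).
Proof.
move=> mA; apply: emeasurable_sum => i; apply: measurable_funeM.
exact: measurable_kernel.
Qed.

HB.instance Definition _ n v k :=
  isKernel.Build _ _ X Y R (kmix n v k) (@measurable_kmix n v k).

Lemma kmixT n (v : nat -> {nonneg R}) k (h : \sum_(i < n) (v i)%:num = 1) x : kmix n v k x setT = 1%E.
Proof.
rewrite kmixE -[1%E]/(1%:E) -h -sumEFin; apply: eq_bigr => i _.
by rewrite prob_kernel mule1.
Qed.

(** The alias takes the normalization as an argument so that the probability kernel instance can be
    inferred from the term. *)
Definition kmixp n (v : nat -> {nonneg R}) k (h : \sum_(i < n) (v i)%:num = 1) :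
  X -> {measure set Y -> \bar R} := kmix n v k.
HB.instance Definition _ n v k h := Kernel.copy (@kmixp n v k h) (kmix n v k).
HB.instance Definition _ n v k h :=
  Kernel_isProbability.Build _ _ _ _ _ (@kmixp n v k h) (kmixT k h).

Lemma integral_fin_fibers (mu : {measure set X -> \bar R}) (I : finType)
    (F : X -> I) (h : X -> \bar R) : (forall i, measurable (F @^-1` [set i])) ->
  measurable_fun setT h -> (forall x, (0 <= h x)%E) ->
  (\int[mu]_x h x = \sum_i \int[mu]_(x in F @^-1` [set i]) h x)%E.
Proof.
move=> mF mh h0.
have e : \big[setU/set0]_(i <- index_enum I) (F @^-1` [set i]) = setT.
  rewrite -bigcup_seq -subTset => x _.
  by exists (F x) => //=; rewrite mem_index_enum.
rewrite -{1}e ge0_integral_bigsetU //.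
- exact: index_enum_uniq.
- by move=> i j _ _ [x []] /= <- <-.
- by rewrite e.
Qed.

Lemma measure_fin_fibers (mu : {measure set X -> \bar R}) (I : finType)
    (F : X -> I) (E : set X) : (forall i, measurable (F @^-1` [set i])) ->
  measurable E -> (mu E = \sum_i mu (E `&` F @^-1` [set i]))%E.
Proof.
move=> mF mE; have := @integral_fin_fibers mu I F (fun x => (\1_E x)%:E) mF.
rewrite integral_indic // setIT => ->.
- by apply: eq_bigr => i _; rewrite integral_indic.
- by apply/measurable_EFinP; exact: measurable_indic.
- by move=> x; rewrite lee_fin.
Qed.

Lemma measurable_fin_fibers (I : finType) (F : X -> I) (Q : set I) :
  (forall i, measurable (F @^-1` [set i])) -> measurable (F @^-1` Q).
Proof.
move=> mF; have -> : F @^-1` Q = \bigcup_(i in Q) F @^-1` [set i].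
  by apply/seteqP; split=> [x Qx|x [i Qi /= ->]] //=; exists (F x).
exact: fin_bigcup_measurable.
Qed.

Lemma measurable_count_fibers (Z : countType) (F : X -> Z) (Q : set Z) :
  (forall i, measurable (F @^-1` [set i])) -> measurable (F @^-1` Q).
Proof.
move=> mF; have -> : F @^-1` Q = \bigcup_i (if `[< Q i >] then F @^-1` [set i] else set0).
  apply/seteqP; split=> [x Qx|x [i _]] /=.
    by exists (F x) => //; case: asboolP.
  by case: asboolP => // Qi /= ->.
apply: countable_bigcupT_measurable; first exact: countableP.
by move=> i; case: asboolP.
Qed.

End MeasureTools.

(** * Kernels obtained by freezing one argument *)

Section SectionKernel.
Context d1 d2 d3 (X : measurableType d1) (O : measurableType d2)
  (Y : measurableType d3) (R : realType) (Pr : probability O R).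
Variable (Phi : X * O -> Y).
Hypothesis (mPhi : measurable_fun setT Phi).

Lemma measurable_section x : measurable_fun setT (fun w => Phi (x, w)).
Proof. exact: measurableT_comp mPhi (pair1_measurable x). Qed.

(** An explicit stand-in for a regular conditional distribution: it is the conditional law of the
    output when the first argument is independent of the noise in [O]. *)
Definition ksec (x : X) : {measure set Y -> \bar R} := law Pr (measurable_section x).

Lemma ksecE x B : ksec x B = Pr [set w | B (Phi (x, w))].
Proof. by []. Qed.

Lemma measurable_ksec A : measurable A -> measurable_fun [set: X] (ksec ^~ A).
Proof.
move=> mA.
have mE : measurable (Phi @^-1` A) by rewrite -[_ @^-1` _]setTI; exact: mPhi.
have := measurable_fun_xsection Pr mE.
congr measurable_fun; apply/funext => x /=; congr (Pr _).
by apply/seteqP; split=> w /=; rewrite /xsection /= in_setE.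
Qed.

HB.instance Definition _ := isKernel.Build _ _ X Y R ksec measurable_ksec.

Lemma ksecT x : ksec x setT = 1%E.
Proof. exact: probability_setT (law Pr (measurable_section x)). Qed.

HB.instance Definition _ := Kernel_isProbability.Build _ _ _ _ _ ksec ksecT.

Lemma integral_ksec (px : probability X R) A B : measurable A -> measurable B ->
  (\int[px]_(x in A) ksec x B = (px \x Pr) [set z | A z.1 /\ B (Phi z)])%E.
Proof.
move=> mA mB.
rewrite integral_mkcond; apply: eq_integral => x _ /=.
rewrite /patch; case: ifPn => xA; rewrite ?ksecE.
  congr (Pr _); apply/seteqP; split=> w /=; rewrite /xsection /= in_setE /=.
    by move=> h; split=> //; apply/set_mem.
  by case.
rewrite (_ : xsection _ x = set0) ?measure0 //.
apply/seteqP; split=> w //=; rewrite /xsection /= in_setE /= => -[Ax _].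
by move/negP: xA; apply; exact/mem_set.
Qed.

Lemma integral2_ksec (px : probability X R) (h : X -> Y -> \bar R) :
  measurable_fun [set: X * Y] (fun p => h p.1 p.2) -> (forall x y, (0 <= h x y)%E) ->
  (\int[px]_x \int[ksec x]_y h x y = \int[px \x Pr]_z h z.1 (Phi z))%E.
Proof.
move=> mh h0.
rewrite (@fubini_tonelli1 _ _ _ _ _ px Pr (fun z => h z.1 (Phi z))) //; last first.
  exact: measurableT_comp mh (measurable_fun_pair measurable_fst mPhi).
apply: eq_integral => x _; rewrite /fubini_F /= /ksec.
by rewrite integral_law //; exact: measurableT_comp mh (pair1_measurable x).
Qed.

End SectionKernel.

(** * Exchanging one letter of an i.i.d. sample *)

Section IidLaw.
Context (R : realType) (dT dO : measure_display) (T : measurableType dT)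
  (Om : measurableType dO) (Pr : probability Om R) (Xs : nat -> Om -> T)
  (px : probability T R) (n : nat).

(** Rectangles rather than cylinders: they are closed under intersection, as uniqueness of measures
    requires, and their sigma-algebra contains that of the cylinders. *)
Definition rects : set (set ('I_n -> T)) :=
  [set C | exists A : 'I_n -> set T,
     (forall i, measurable (A i)) /\ C = [set x | forall i, A i (x i)]].

Definition Tn := g_sigma_algebraType rects.

Lemma measurable_cylinders (C : set Tn) : <<s @cylinders _ T n >> C -> measurable C.
Proof.
apply: sub_sigma_algebra2 => _ [i [A [mA ->]]].
exists (fun j => if j == i then A else setT); split=> [j|]; first by case: eqP.
apply/seteqP; split=> x /=; first by move=> Ax j; case: eqP => // ->.
by move/(_ i); rewrite eqxx.
Qed.

Lemma measurable_coord (i : 'I_n) : measurable_fun setT (fun x : Tn => x i).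
Proof.
move=> _ A mA; rewrite setTI; apply: measurable_cylinders; apply: sub_sigma_algebra.
by exists i, A.
Qed.

Lemma measurable_Tn d (X : measurableType d) (h : X -> Tn) :
  (forall i, measurable_fun setT (fun x => h x i)) -> measurable_fun setT h.
Proof.
move=> mh; apply: (measurability _ (erefl : @measurable _ Tn = <<s rects >>)).
move=> _ [_ [A [mA ->]] <-]; rewrite setTI.
have -> : h @^-1` [set x | forall i, A i (x i)] =
    \bigcap_(i in setT) ((fun x => h x i) @^-1` A i).
  by apply/seteqP; split=> x /= hx i; [move=> _; exact: hx|exact: hx i I].
by apply: fin_bigcap_measurable => // i _; rewrite -[_ @^-1` _]setTI; exact: mh.
Qed.

Definition sample (w : Om) : Tn := fun i => Xs i w.

Definition resample (t : 'I_n) (z : T * Om) : Tn :=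
  fun i => if i == t then z.1 else Xs i z.2.

Hypothesis Hiid : iid Pr Xs px.

Lemma measurable_sample : measurable_fun setT sample.
Proof. by apply: measurable_Tn => i; exact: Hiid.1. Qed.

Lemma measurable_iid_rect (A : 'I_n -> set T) : (forall i, measurable (A i)) ->
  measurable [set w | forall i : 'I_n, A i (Xs i w)].
Proof.
move=> mA.
rewrite (_ : [set w | _] = sample @^-1` [set x | forall i, A i (x i)]) //.
rewrite -[_ @^-1` _]setTI; apply: measurable_sample => //.
by apply: sub_sigma_algebra; exists A.
Qed.

Lemma measurable_resample t : measurable_fun setT (resample t).
Proof.
apply: measurable_Tn => i; rewrite /resample; case: eqP => _.
  exact: measurable_fst.
exact: measurableT_comp (Hiid.1 i) measurable_snd.
Qed.

Lemma iid_rect (A : 'I_n -> set T) : (forall i, measurable (A i)) ->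
  Pr [set w | forall i, A i (Xs i w)] = (\prod_(i < n) fine (px (A i)))%:E.
Proof.
move=> mA; rewrite -(Hiid.2 n A mA); congr (Pr _).
by apply/seteqP; split=> w /= h i; [move=> _; exact: h|exact: h i I].
Qed.

Lemma product_probability_setT : (px \x Pr)%E setT = 1%E.
Proof.
have := @product_measure1E _ _ T Om R px Pr _ _ measurableT measurableT.
by rewrite setXTT /= => ->; rewrite (probability_setT px) (probability_setT Pr) mule1.
Qed.

(** The two laws agree on rectangles, because letter [t] of the sample is overwritten by one drawn
    independently from [px]. This puts the joint law of a letter and its reconstruction in the form
    handled by [ksec]. *)
Lemma law_resample t (E : set Tn) : measurable E ->
  Pr (sample @^-1` E) = (px \x Pr)%E (resample t @^-1` E).
Proof.
move=> mE.
pose m1 : {measure set Tn -> \bar R} := law Pr measurable_sample.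
pose m2 : {measure set Tn -> \bar R} :=
  law (prob_of product_probability_setT) (measurable_resample t).
rewrite -[LHS]/(m1 E) -[RHS]/(m2 E).
apply: (@measure_unique _ R Tn rects (fun=> setT) erefl _ _ _ m1 m2) => //.
- move=> _ _ [A [mA ->]] [B [mB ->]]; exists (fun i => A i `&` B i); split.
    by move=> i; exact: measurableI.
  by apply/seteqP; split=> x /=; [move=> [a b] i|move=> h; split=> i; case: (h i)].
- by move=> _; exists (fun=> setT); split=> //; apply/seteqP; split.
- by rewrite bigcup_const //; exists 0%N.
- move=> _ [A [mA ->]]; rewrite [LHS](iid_rect mA) -[RHS]/((px \x Pr)%E (resample t @^-1` _)).
  pose A' i := if i == t then setT else A i.
  have mA' i : measurable (A' i) by rewrite /A'; case: eqP.
  have -> : resample t @^-1` [set x | forall i, A i (x i)] =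
      A t `*` [set w | forall i, A' i (Xs i w)].
    apply/seteqP; split=> [[x w] /= h|[x w] /= [Ax h]].
      split=> [|i]; first by have := h t; rewrite /resample eqxx.
      by rewrite /A'; have := h i; rewrite /resample; case: eqP.
    by move=> i; have := h i; rewrite /resample /A'; case: eqP => // ->.
  rewrite product_measure1E //; last exact: measurable_iid_rect.
  rewrite /= iid_rect // -[px (A t)]fineK ?fin_num_measure // -EFinM; congr EFin.
  rewrite (bigD1 t) //= [X in _ = _ * X](bigD1 t) //=.
  have -> : A' t = setT by rewrite /A' eqxx.
  rewrite probability_setT /= mul1r.
  by congr (_ * _); apply: eq_bigr => i /negPf it; rewrite /A' it.
- move=> _; rewrite -[X in (X < _)%E]/(law Pr measurable_sample setT).
  by rewrite probability_setT ltry.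
Qed.

Lemma integral_resample t (h : Tn -> \bar R) :
  measurable_fun setT h -> (forall x, (0 <= h x)%E) ->
  (\int[Pr]_w h (sample w) = \int[px \x Pr]_z h (resample t z))%E.
Proof.
move=> mh h0; rewrite -(integral_law Pr measurable_sample) //.
rewrite -[RHS](integral_law (prob_of product_probability_setT) (measurable_resample t)) //.
by apply: eq_measure_integral => E mE _; exact: law_resample.
Qed.

End IidLaw.

(** * Convexity of the divergence, and of information in the kernel *)

Section Mixtures.
Context (R : realType) (dT : measure_display) (T : measurableType dT).
Implicit Types (nu : set T -> \bar R) (dv : (set T -> \bar R) -> (set T -> \bar R) -> \bar R).

Lemma is_prob_ge0 nu A : is_prob nu -> (0 <= nu A)%E.
Proof. by move=> [mu ->]; rewrite /Defs.mrestr; case: asboolP. Qed.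

Lemma is_prob_mixture (l : R) nu1 nu2 : 0 <= l <= 1 ->
  is_prob nu1 -> is_prob nu2 -> is_prob (mixture l nu1 nu2).
Proof.
move=> /andP[l0 l1] [mu1 ->] [mu2 ->].
have l1' : 0 <= 1 - l by rewrite subr_ge0.
pose m := msum (fun i => mscale (if i == 0%N then NngNum l0 else NngNum l1')
  (if i == 0%N then mu1 else mu2)) 2.
have mE A : m A = (l%:E * mu1 A + (1 - l)%:E * mu2 A)%E.
  by rewrite /m /msum big_ord_recr /= big_ord_recr /= big_ord0 add0e.
have m1 : m setT = 1%E.
  by rewrite mE !probability_setT !mule1 -EFinD addrC subrK.
exists (prob_of m1); apply/funext => A; rewrite /mixture /Defs.mrestr.
case: asboolP => mA; last by rewrite !mule0 adde0.
exact: esym (mE A).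
Qed.

(** Induction splitting off the last weight and renormalizing the others. [Q] must contain
    [is_prob], since (A1) applies to laws only and the partial mixtures have to be laws
    themselves. *)
Lemma convex_comb_closed (Q : (set T -> \bar R) -> Prop) :
  (forall nu, Q nu -> is_prob nu) ->
  (forall l nu1 nu2, 0 <= l <= 1 -> Q nu1 -> Q nu2 -> Q (mixture l nu1 nu2)) ->
  forall n (v : 'I_n -> R) (nu : 'I_n -> set T -> \bar R),
    (forall i, 0 <= v i) -> \sum_i v i = 1 -> (forall i, Q (nu i)) ->
    Q (fun A => \sum_i (v i)%:E * nu i A)%E.
Proof.
move=> Qp Qm; elim=> [|n IH] v nu v0 v1 Qnu.
  by move/eqP: v1; rewrite big_ord0 eq_sym oner_eq0.
pose l := v ord_max.
pose s := \sum_(i < n) v (widen_ord (leqnSn n) i).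
have sl : s + l = 1 by rewrite -v1 big_ord_recr.
have s0 : 0 <= s by exact: sumr_ge0.
(* Without remaining mass nothing can be renormalized, and the combination is its last term. *)
have [sE|sN] := eqVneq s 0.
  rewrite (_ : (fun A => _) = nu ord_max); first exact: Qnu.
  apply/funext => A; rewrite big_ord_recr /= big1 ?add0e.
    by rewrite -/l (_ : l = 1) ?mul1e // -sl sE add0r.
  move=> i _; have /psumr_eq0P /(_ i isT) := sE => -> //; exact: mul0e.
have sp : 0 < s by rewrite lt_neqAle eq_sym sN.
pose v' i := v (widen_ord (leqnSn n) i) / s.
have := IH v' (fun i => nu (widen_ord (leqnSn n) i)).
move=> /(_ (fun i => divr_ge0 (v0 _) s0)).
rewrite -mulr_suml divff // => /(_ erefl (fun i => Qnu _)) Q'.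
have := Qm s _ _ _ Q' (Qnu ord_max).
have s1 : 0 <= s <= 1 by rewrite s0 /= -sl lerDl v0.
move=> /(_ s1); congr Q; apply/funext => A; rewrite /mixture big_ord_recr /=.
congr (_ + _)%E; last by congr (_%:E * _)%E; rewrite -sl addrC addKr.
rewrite ge0_sume_distrr => [|i _]; last first.
  by rewrite mule_ge0 ?lee_fin ?divr_ge0 // is_prob_ge0 //; exact/Qp/Qnu.
by apply: eq_bigr => i _; rewrite muleA -EFinM /v' mulrCA divff // mulr1.
Qed.

Lemma divergence_convex_comb dv (px : probability T R) (c : R) n (v : 'I_n -> R)
    (nu : 'I_n -> set T -> \bar R) : A1 dv ->
  (forall i, 0 <= v i) -> \sum_i v i = 1 -> (forall i, is_prob (nu i)) ->
  (forall i, (dv (Defs.mrestr px) (nu i) <= c%:E)%E) ->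
  is_prob (fun A => \sum_i (v i)%:E * nu i A)%E /\
  (dv (Defs.mrestr px) (fun A => \sum_i (v i)%:E * nu i A) <= c%:E)%E.
Proof.
move=> HA1 v0 v1 nup nuc.
have pxp : is_prob (Defs.mrestr px) by exists px.
apply: (@convex_comb_closed (fun nu => is_prob nu /\
  (dv (Defs.mrestr px) nu <= c%:E)%E)) => [? []//|l nu1 nu2 l01 [p1 c1] [p2 c2]|//|//|//].
split; first exact: is_prob_mixture.
apply: le_trans (HA1 _ _ _ _ pxp p1 p2 l01) _.
have /andP[l0 l1] := l01.
rewrite -[leRHS]/(c%:E) (_ : c%:E = l%:E * c%:E + (1 - l)%:E * c%:E)%E.
  by apply: leeD; apply: lee_wpmul2l; rewrite ?lee_fin ?subr_ge0.
by rewrite -!EFinM -EFinD; congr EFin; ring.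
Qed.

Definition moutlaw (px : probability T R) (k : R.-pker T ~> T) : set T -> \bar R :=
  outlaw px k.

Section Outlaw.
Variables (px : probability T R) (k : R.-pker T ~> T).

Lemma moutlaw0 : moutlaw px k set0 = 0%E.
Proof. by rewrite /moutlaw /outlaw integral0_eq. Qed.

Lemma moutlaw_ge0 A : (0 <= moutlaw px k A)%E.
Proof. exact: integral_ge0. Qed.

Lemma moutlaw_semi_sigma_additive : semi_sigma_additive (moutlaw px k).
Proof.
move=> F mF tF mUF.
rewrite [X in _ --> X](_ : _ = \sum_(n <oo) moutlaw px k (F n))%E.
  apply/cvg_closeP; split; last by rewrite closeE.
  by apply: is_cvg_nneseries => n _ _; exact: moutlaw_ge0.
rewrite /moutlaw /outlaw -integral_nneseries //; last first.
  by move=> n; exact: measurable_kernel.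
apply: eq_integral => x _; apply/esym/cvg_lim => //=.
exact: measure_semi_sigma_additive.
Qed.

HB.instance Definition _ := isMeasure.Build _ _ _ (moutlaw px k)
  moutlaw0 moutlaw_ge0 moutlaw_semi_sigma_additive.

Lemma moutlawT : moutlaw px k setT = 1%E.
Proof.
rewrite /moutlaw /outlaw; under eq_integral do rewrite prob_kernel.
by rewrite integral_cst // mul1e; exact: probability_setT.
Qed.

HB.instance Definition _ := Measure_isProbability.Build _ _ _ (moutlaw px k) moutlawT.

Lemma is_prob_outlaw : is_prob (Defs.mrestr (outlaw px k)).
Proof. by exists (moutlaw px k). Qed.

Lemma joint_le_marginal A B : measurable A -> measurable B ->
  (joint px k A B <= px A)%E.
Proof.
move=> mA mB; rewrite /joint -[leRHS]mul1e -integral_cst //.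
apply: ge0_le_integral => //.
- by apply: measurable_funTS; exact: measurable_kernel.
- by move=> x _ /=; rewrite -(@prob_kernel _ _ _ _ _ k x) le_measure // inE.
Qed.

Lemma joint_le_outlaw A B : measurable A -> measurable B ->
  (joint px k A B <= outlaw px k B)%E.
Proof.
move=> mA mB; apply: ge0_subset_integral => //; exact: measurable_kernel.
Qed.

Lemma joint_fin_num A B : measurable A -> measurable B ->
  joint px k A B \is a fin_num.
Proof.
move=> mA mB; rewrite ge0_fin_numE; last exact: integral_ge0.
by rewrite (le_lt_trans (joint_le_marginal mA mB)) // ltey_eq fin_num_measure.
Qed.

Lemma outlaw_fin_num B : measurable B -> outlaw px k B \is a fin_num.
Proof. by move=> mB; apply: (fin_num_measure (moutlaw px k)). Qed.

End Outlaw.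

Lemma mi_termE (p q : R) : mi_term p q = xlog p q / ln 2.
Proof. by rewrite /mi_term /xlog /log2; case: eqP; rewrite ?mul0r // mulrA. Qed.

Section KernelMixture.
Variables (px : probability T R) (n : nat) (v : nat -> {nonneg R}) (k : nat -> R.-pker T ~> T).
Hypothesis v1 : \sum_(i < n) (v i)%:num = 1.

Lemma joint_kmix A B : measurable A -> measurable B ->
  joint px (kmixp k v1) A B = (\sum_(i < n) (v i)%:num%:E * joint px (k i) A B)%E.
Proof.
move=> mA mB; rewrite /joint /kmixp.
under eq_integral do rewrite kmixE.
have mk i : measurable_fun A (k i ^~ B).
  by apply: measurable_funTS; exact: measurable_kernel.
rewrite ge0_integral_sum //; last by move=> i; apply: measurable_funeM.
by apply: eq_bigr => i _; rewrite ge0_integralZl // lee_fin.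
Qed.

Lemma outlaw_kmix B : measurable B ->
  outlaw px (kmixp k v1) B = (\sum_(i < n) (v i)%:num%:E * outlaw px (k i) B)%E.
Proof. by move=> mB; exact: joint_kmix. Qed.

Lemma mrestr_outlaw_kmix :
  Defs.mrestr (outlaw px (kmixp k v1)) =
  (fun A => \sum_(i < n) (v i)%:num%:E * Defs.mrestr (outlaw px (k i)) A)%E.
Proof.
apply/funext => A; rewrite /Defs.mrestr; case: asboolP => mA.
  by rewrite outlaw_kmix.
by rewrite big1 // => i _; rewrite mule0.
Qed.

Lemma exp_dist_kmix (Dist : T -> T -> R) : distortion Dist ->
  exp_dist px (kmixp k v1) Dist =
  (\sum_(i < n) (v i)%:num%:E * exp_dist px (k i) Dist)%E.
Proof.
move=> [mD D0 _]; rewrite /exp_dist /kmixp.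
have mDE : measurable_fun [set: T * T] (fun p => (Dist p.1 p.2)%:E).
  exact/measurable_EFinP.
have mDx x : measurable_fun setT (fun y => (Dist x y)%:E).
  exact: measurableT_comp mDE (pair1_measurable x).
have D0x x y : (0 <= (Dist x y)%:E)%E by rewrite lee_fin.
under eq_integral => x _.
  rewrite ge0_integral_measure_sum //.
  under eq_bigr do rewrite ge0_integral_mscale //.
  over.
have mk i : measurable_fun setT (fun x => \int[k i x]_y (Dist x y)%:E)%E.
  have f0 (p : T * T) : (0 <= (Dist p.1 p.2)%:E)%E by rewrite lee_fin.
  exact: (measurable_fun_integral_finite_kernel _ (k i) f0 mDE).
rewrite ge0_integral_sum //; last 2 first.
- by move=> i; apply: measurable_funeM.
- by move=> i x _; rewrite mule_ge0 ?lee_fin // integral_ge0.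
apply: eq_bigr => i _; rewrite ge0_integralZl //; first by move=> x _; exact: integral_ge0.
Qed.

(** For fixed partitions the joint and output masses are linear in the kernel and the input masses
    are common to all kernels, so the log-sum inequality applies rectangle by rectangle; the
    supremum is taken afterwards. *)
Lemma MI_kmix :
  (MI_kernel px (kmixp k v1) <= \sum_(i < n) (v i)%:num%:E * MI_kernel px (k i))%E.
Proof.
apply: ge_ereal_sup => _ [m [m' [A [B [pA pB ->]]]]].
have [mA _ _] := pA; have [mB _ _] := pB.
pose s l := \sum_(i < m) \sum_(j < m') mi_term (fine (joint px (k l) (A i) (B j)))
     (fine (px (A i)) * fine (outlaw px (k l) (B j))).
apply: (@le_trans _ _ (\sum_(l < n) (v l)%:num%:E * (s l)%:E)%E); last first.
  apply: lee_sum => l _; apply: lee_wpmul2l; first by rewrite lee_fin.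
  by apply: ereal_sup_ubound; exists m, m', A, B.
under [leRHS]eq_bigr do rewrite -EFinM.
rewrite sumEFin lee_fin /s.
under [leRHS]eq_bigr do rewrite mulr_sumr.
rewrite [leRHS]exchange_big /=; apply: ler_sum => i _.
under [leRHS]eq_bigr do rewrite mulr_sumr.
rewrite [leRHS]exchange_big /=; apply: ler_sum => j _.
have fsum (h : 'I_n -> \bar R) : (forall l, h l \is a fin_num) ->
    fine (\sum_(l < n) (v l)%:num%:E * h l)%E = \sum_(l < n) (v l)%:num * fine (h l).
  move=> hf; rewrite -[RHS]/(fine (_%:E)) -sumEFin; congr fine.
  by apply: eq_bigr => l _; rewrite EFinM fineK.
rewrite joint_kmix // outlaw_kmix // !fsum; last 2 first.
- by move=> l; exact: outlaw_fin_num.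
- by move=> l; exact: joint_fin_num.
rewrite mi_termE mulr_sumr.
have px0 : 0 <= fine (px (A i)) by rewrite fine_ge0.
have j0 l : 0 <= fine (joint px (k l) (A i) (B j)).
  by rewrite fine_ge0 //; exact: integral_ge0.
have q0 l : 0 <= fine (outlaw px (k l) (B j)).
  by rewrite fine_ge0 //; exact: integral_ge0.
have jA l : fine (joint px (k l) (A i) (B j)) <= fine (px (A i)).
  by apply: fine_le; rewrite ?fin_num_measure ?joint_fin_num // joint_le_marginal.
have jB l : fine (joint px (k l) (A i) (B j)) <= fine (outlaw px (k l) (B j)).
  by apply: fine_le; rewrite ?outlaw_fin_num ?joint_fin_num // joint_le_outlaw.
have := @xlog_sum R 'I_n (fun l => (v l)%:num * fine (joint px (k l) (A i) (B j)))
  (fun l => fine (px (A i)) * ((v l)%:num * fine (outlaw px (k l) (B j)))).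
move=> /(_ (fun l => mulr_ge0 (ge0 _) (j0 l))).
move=> /(_ (fun l => mulr_ge0 px0 (mulr_ge0 (ge0 _) (q0 l)))) h.
apply: le_trans (ler_wpM2r _ (h _)) _.
- by rewrite invr_ge0 ln_ge0 // ler1n.
(* Absolute continuity: zero input, weight or output mass forces zero weighted joint mass. *)
- move=> l /eqP; rewrite !mulf_eq0 => /or3P[/eqP pe|/eqP ->|/eqP qe].
  + by have := jA l; have := j0 l; rewrite pe => a b; rewrite (le_anti (introT andP (conj b a))) mulr0.
  + by rewrite mul0r.
  + by have := jB l; have := j0 l; rewrite qe => a b; rewrite (le_anti (introT andP (conj b a))) mulr0.
rewrite mulr_suml; apply: ler_sum => l _; rewrite mi_termE [leRHS]mulrA.
rewrite ler_wpM2r ?invr_ge0 ?ln_ge0 ?ler1n //.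
rewrite /xlog mulf_eq0; have [->|vN] := eqVneq ((v l)%:num) 0.
  by rewrite /= mul0r.
rewrite /=; case: eqP => _; first by rewrite mulr0.
rewrite -mulrA le_eqVlt; apply/orP; left; apply/eqP; congr (_ * (_ * ln _)).
by rewrite mulrCA -mulf_div divff // mul1r.
Qed.

End KernelMixture.
End Mixtures.

(** * Single-letter converse on finite alphabets *)

Section FiniteConverse.
Context {R : realType}.

(* One application of Gibbs' inequality to the law [J] of (U^n, Y^n) and the
   memoryless backward channel P(y) prod_t pi(u_t | y_t). *)
Lemma single_letter_bound (U V : finType) (n : nat) (p : U -> R)
    (J : {ffun 'I_n -> U} -> {ffun 'I_n -> V} -> R) (pi : U -> V -> R) (q : V -> R) :
  (0 < n)%N -> (forall u y, 0 <= J u y) -> \sum_u \sum_y J u y = 1 ->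
  (forall u y, J u y <= \prod_t p (u t)) ->
  (forall a, 0 <= p a) ->
  (forall a b, n%:R * pi a b =
     \sum_t \sum_u \sum_y J u y * ((u t == a) && (y t == b))%:R) ->
  (forall b, q b = \sum_a pi a b) ->
  n%:R * (\sum_a \sum_b xlog (pi a b) (p a * q b)) <=
  \sum_y - (\sum_u J u y) * ln (\sum_u J u y).
Proof.
move=> n0 J0 J1 Jp p0 piE qE.
have n0r : 0 < n%:R :> R by rewrite ltr0n.
have pi_ge u y t : J u y <= n%:R * pi (u t) (y t).
  rewrite piE (bigD1 t) //= (bigD1 u) //= (bigD1 y) //= !eqxx mulr1 -!addrA lerDl.
  by rewrite !addr_ge0 //; do ?[apply: sumr_ge0 => *]; rewrite ?mulr_ge0 ?ler0n.
have pi0 a b : 0 <= pi a b.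
  rewrite -(pmulr_rge0 _ n0r) piE.
  by do 3![apply: sumr_ge0 => ? _]; rewrite mulr_ge0 // ler0n.
have q0 b : 0 <= q b by rewrite qE sumr_ge0.
have pi_q a b : pi a b <= q b by rewrite qE (bigD1 a) //= lerDl sumr_ge0.
pose P y := \sum_u J u y.
have P0 y : 0 <= P y by exact: sumr_ge0.
have JP u y : J u y <= P y by rewrite /P (bigD1 u) //= lerDl sumr_ge0.
(* The backward channel; it vanishes where [q b = 0], so its mass is only at most one. *)
pose w a b := pi a b / q b.
have w0 a b : 0 <= w a b by rewrite divr_ge0.
pose lr a b := ln (pi a b / (p a * q b)).
have -> : n%:R * (\sum_a \sum_b xlog (pi a b) (p a * q b)) =
    \sum_u \sum_y J u y * \sum_t lr (u t) (y t).
  transitivity (\sum_a \sum_b \sum_t \sum_u \sum_y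
      J u y * ((u t == a) && (y t == b))%:R * lr a b).
    rewrite mulr_sumr; apply: eq_bigr => a _; rewrite mulr_sumr; apply: eq_bigr => b _.
    transitivity (n%:R * pi a b * lr a b).
      by rewrite /xlog /lr; case: eqP => [->|_]; rewrite ?mulr0 ?mul0r // mulrA.
    rewrite piE mulr_suml; apply: eq_bigr => t _; rewrite mulr_suml; apply: eq_bigr => u _.
    by rewrite mulr_suml.
  under eq_bigr do rewrite exchange_big /=.
  rewrite exchange_big /=.
  transitivity (\sum_t \sum_u \sum_y J u y * lr (u t) (y t)); last first.
    rewrite exchange_big /=; apply: eq_bigr => u _; rewrite exchange_big /=.
    by apply: eq_bigr => y _; rewrite mulr_sumr.
  apply: eq_bigr => t _.
  under eq_bigr do rewrite exchange_big /=.
  rewrite exchange_big /=; apply: eq_bigr => u _.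
  under eq_bigr do rewrite exchange_big /=.
  rewrite exchange_big /=; apply: eq_bigr => y _.
  rewrite (bigD1 (u t)) //= (bigD1 (y t)) //= !eqxx mulr1 big1 => [|b /negPf h]; last first.
    by rewrite eq_sym h mulr0 mul0r.
  rewrite addr0 big1 ?addr0 // => a /negPf h; apply: big1 => b _.
  by rewrite [_ == a]eq_sym h mulr0 mul0r.
have -> : \sum_y - (\sum_u J u y) * ln (\sum_u J u y) = \sum_u \sum_y - (J u y * ln (P y)).
  rewrite [RHS]exchange_big /=; apply: eq_bigr => y _.
  by rewrite sumrN -mulr_suml mulNr.
have Jpos u y : J u y != 0 -> [/\ 0 < J u y, 0 < P y, forall t, 0 < p (u t),
    forall t, 0 < pi (u t) (y t) & forall t, 0 < q (y t)].
  move=> JN; have Jp' : 0 < J u y by rewrite lt_neqAle eq_sym JN J0.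
  have pip t : 0 < pi (u t) (y t).
    by rewrite -(pmulr_rgt0 _ n0r) (lt_le_trans Jp').
  split=> // [|t|t]; [exact: lt_le_trans (JP u y)| |exact: lt_le_trans (pi_q (u t) _)].
  rewrite lt_neqAle p0 andbT eq_sym; apply/eqP => pt.
  by have := lt_le_trans Jp' (Jp u y); rewrite (bigD1 t) //= pt mul0r ltxx.
have wq b : \sum_a w a b <= 1.
  rewrite -mulr_suml -qE; have [->|qN] := eqVneq (q b) 0; first by rewrite mul0r.
  by rewrite divff.
have G : 0 <= \sum_u \sum_y xlog (J u y) (P y * \prod_t w (u t) (y t)).
  rewrite pair_bigA /=.
  apply: (gibbs (p := fun x => J x.1 x.2)
    (q := fun x => P x.2 * \prod_t w (x.1 t) (x.2 t))) => [x|x|x|].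
  - exact: J0.
  - by rewrite mulr_ge0 // prodr_ge0.
  - move/eqP; apply: contraTeq => /Jpos[_ Pp _ pip qp].
    by rewrite gt_eqF // mulr_gt0 // prodr_gt0 // => t _; rewrite divr_gt0.
  rewrite -(pair_bigA _ (fun (u : {ffun 'I_n -> U}) (y : {ffun 'I_n -> V}) => P y * \prod_t w (u t) (y t))) /=.
  rewrite -(pair_bigA _ (fun u y => J u y)) /= J1 exchange_big /=.
  apply: (@le_trans _ _ (\sum_y P y)); last by rewrite /P exchange_big /= J1.
  apply: ler_sum => y _; rewrite -mulr_sumr -[leRHS]mulr1 ler_wpM2l //.
  rewrite -(bigA_distr_bigA (fun t a => w a (y t))).
  apply: prodr_ile1 => t _; rewrite wq andbT sumr_ge0 //.
rewrite -[leLHS]addr0; apply: le_trans (lerD (lexx _) G) _.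
rewrite -big_split /=; apply: ler_sum => u _; rewrite -big_split /=.
apply: ler_sum => y _; rewrite /xlog.
have [->|JN] := eqVneq (J u y) 0; first by rewrite !mul0r addr0 oppr0.
have [Jp' Pp pp pip qp] := Jpos _ _ JN.
rewrite -mulrN -mulrDr ler_wpM2l //.
have wp t : 0 < w (u t) (y t) by rewrite divr_gt0.
have lnprod (F : 'I_n -> R) : (forall t, 0 < F t) -> ln (\prod_t F t) = \sum_t ln (F t).
  move=> Fp; apply: expR_inj; rewrite expR_sum lnK; last by rewrite posrE prodr_gt0.
  by apply: eq_bigr => t _; rewrite lnK ?posrE.
have -> : \sum_t lr (u t) (y t) = ln (\prod_t w (u t) (y t)) - ln (\prod_t p (u t)).
  rewrite !lnprod // -sumrB; apply: eq_bigr => t _.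
  rewrite -ln_div ?posrE //; congr ln; rewrite /w.
  by field; rewrite !gt_eqF.
have Wp : 0 < \prod_t w (u t) (y t) by exact: prodr_gt0.
rewrite ln_div ?posrE ?mulr_gt0 // lnM ?posrE //.
(* Given the source block, an output has conditional probability at most one: this discards the
   nonnegative conditional entropy of the output. *)
have : ln (J u y) <= ln (\prod_t p (u t)).
  by rewrite ler_ln ?posrE ?Jp // prodr_gt0.
lra.
Qed.

End FiniteConverse.

(** * Entropy of functions of a discrete variable *)

Section Fibers.
Context (R : realType) (dO : measure_display) (Om : measurableType dO)
  (Pr : probability Om R).

Lemma prob_fibers (I : finType) (F : Om -> I) (Q : pred I) :
  (forall i, measurable (F @^-1` [set i])) ->
  fine (Pr [set w | Q (F w)]) = \sum_(i | Q i) fine (Pr (F @^-1` [set i])).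
Proof.
move=> mF.
have mQ : measurable [set w | Q (F w)] by exact: (@measurable_fin_fibers _ _ _ _ [set i | Q i]).
rewrite (measure_fin_fibers Pr mF mQ) -sum_fine; last first.
  by move=> i _; rewrite fin_num_measure //; exact: measurableI.
rewrite [RHS]big_mkcond /=; apply: eq_bigr => i _; case: ifP => Qi.
  congr (fine (Pr _)); apply/seteqP; split=> w /= => [[]//|h].
  by split; rewrite // h.
rewrite (_ : _ `&` _ = set0) ?measure0 //.
by apply/seteqP; split=> w //= -[+ h]; rewrite h Qi.
Qed.

Lemma fibers_pmf (I : finType) (F : Om -> I) :
  (forall i, measurable (F @^-1` [set i])) ->
  pmf (fun i => fine (Pr (F @^-1` [set i]))).
Proof.
move=> mF; split; first by move=> i; rewrite fine_ge0.
rewrite -(@prob_fibers _ F predT mF) (_ : [set w | _] = setT) ?probability_setT //.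
by apply/seteqP; split.
Qed.

Lemma log2_le0 (x : R) : 0 <= x <= 1 -> log2 x <= 0.
Proof.
move=> x01; rewrite /log2 pmulr_lle0 ?ln_le0 ?invr_gt0 ?ln_gt0 ?ltr1n //; lra.
Qed.

(** An atom has probability at most that of its class under [h], so its [- log2] is at least that of
    the class; averaging over the atoms of each class gives the bound. *)
Lemma entropy_coarse (Z : countType) (V : finType) (F : Om -> Z) (h : Z -> V) :
  (forall z, measurable (F @^-1` [set z])) ->
  ((\sum_v - fine (Pr [set w | h (F w) = v]) * log2 (fine (Pr [set w | h (F w) = v])))%:E
    <= entropy Pr F)%E.
Proof.
move=> mF; rewrite /entropy.
set phi := fun z : Z => (- fine (Pr (F @^-1` [set z])) * log2 (fine (Pr (F @^-1` [set z]))))%:E.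
have p01 (E : set Om) : measurable E -> 0 <= fine (Pr E) <= 1.
  move=> mE; rewrite fine_ge0 //= -[leRHS]/(fine 1%:E) fine_le ?fin_num_measure //.
  exact: probability_le1.
have phi0 z : (0 <= phi z)%E.
  rewrite lee_fin mulNr -mulrN mulr_ge0 ?oppr_ge0 ?log2_le0 ?p01 //.
  by have /andP[] := p01 _ (mF z).
have -> : (\esum_(z in [set: Z]) phi z =
    \sum_(v : V) \esum_(z in [set z | h z = v]) phi z)%E.
  under eq_bigr do rewrite esum_mkcond.
  rewrite -esum_sum; last by move=> z v _ _; case: ifP.
  apply: eq_esum => z _; rewrite (bigD1 (h z)) //= mem_set // big1 ?adde0 // => v.
  by move=> /eqP vz; rewrite memNset //= => e; apply: vz.
rewrite -sumEFin; apply: lee_sum => v _.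
set E := [set w | h (F w) = v].
have mE : measurable E by exact: (measurable_count_fibers [set z | h z = v] mF).
pose c := - log2 (fine (Pr E)).
have c0 : 0 <= c by rewrite oppr_ge0 log2_le0 ?p01.
(* [pickle] splits a class into pieces with at most one element, which turns the sum over [Z] into a
   series and lets countable subadditivity apply. *)
pose J n := [set z : Z | h z = v /\ pickle z = n].
have -> : [set z | h z = v] = \bigcup_n J n.
  by apply/seteqP; split=> [z hz|z [n _ []]] //; exists (pickle z).
rewrite nneseries_sum_bigcup //; last by move=> i j _ _ [z [[_ <-] [_ <-]]].
have mG n : measurable (F @^-1` J n) by exact: measurable_count_fibers.
have sub : (Pr E <= \sum_(0 <= n <oo) Pr (F @^-1` J n))%E.
  apply: measure_sigma_subadditive => // w Ew; exists (pickle (F w)) => //.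
rewrite (_ : (_)%:E = c%:E * Pr E)%E; last first.
  by rewrite -[Pr E]fineK ?fin_num_measure // -EFinM /c mulNr -mulrN mulrC.
apply: le_trans (lee_wpmul2l _ sub) _; first by rewrite lee_fin.
rewrite -nneseriesZl; last by move=> *; exact: measure_ge0.
apply: lee_nneseries => [n _ _|n _]; first by rewrite mule_ge0 ?lee_fin.
have [[z [hz pz]]|nz] := pselect (exists z, J n z); last first.
  rewrite (_ : J n = set0) ?preimage_set0 ?measure0 ?mule0 ?esum_ge0 //.
  by apply/seteqP; split=> z // Jz; apply: nz; exists z.
have -> : J n = [set z].
  apply/seteqP; split=> [z' [_ pz']|_ -> //] /=.
  by apply: (pcan_inj pickleK); rewrite pz' pz.
rewrite esum_set1 // -[Pr _]fineK ?fin_num_measure // -EFinM /phi lee_fin.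
have [->|pN] := eqVneq (fine (Pr (F @^-1` [set z]))) 0; first by rewrite oppr0 mulr0 mul0r.
have pp : 0 < fine (Pr (F @^-1` [set z])) by rewrite lt_neqAle eq_sym pN fine_ge0.
rewrite mulrC mulNr -mulrN ler_wpM2l ?(ltW pp) // /c lerN2 /log2.
have pE : fine (Pr (F @^-1` [set z])) <= fine (Pr E).
  rewrite fine_le ?fin_num_measure // le_measure ?inE // => w /= Fw.
  by rewrite /E /= Fw.
rewrite ler_wpM2r ?invr_ge0 ?ln_ge0 ?ler1n // ler_ln ?posrE //.
exact: lt_le_trans pE.
Qed.

End Fibers.

(** * The converse for arbitrary codes *)

Section Converse.
Context (R : realType) (dT : measure_display) (T : measurableType dT)
  (px : probability T R) (dO : measure_display) (Om : measurableType dO)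
  (Pr : probability Om R) (Xs : nat -> Om -> T) (Hiid : iid Pr Xs px)
  (Dist : T -> T -> R) (HDist : distortion Dist)
  (dv : (set T -> \bar R) -> (set T -> \bar R) -> \bar R).

Lemma mpartition_index m (A : 'I_m -> set T) : mpartition A ->
  exists F : T -> 'I_m, forall i, A i = F @^-1` [set i].
Proof.
move=> [_ dA cA]; have [F hF] := choice cA; exists F => i.
apply/seteqP; split=> [x Aix|x /= <- //]; apply/eqP/negPn/negP => /dA h.
by have : (A (F x) `&` A i) x by []; rewrite h.
Qed.

Lemma converse (D P Rt : R) (n : nat) (Z : countType) (f : ('I_n -> T) -> Z)
    (g : Z -> ('I_n -> T)) : A1 dv -> (0 < n)%N ->
  (forall z, <<s @cylinders _ T n >> (f @^-1` [set z])) ->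
  (n%:R^-1%:E * entropy Pr (fun w => f (fun i : 'I_n => Xs i w)) <= Rt%:E)%E ->
  (n%:R^-1%:E * (\sum_(t < n) \int[Pr]_w
      (Dist (Xs t w) (g (f (fun i : 'I_n => Xs i w)) t))%:E) <= D%:E)%E ->
  (forall t : 'I_n, (dv (Defs.mrestr px)
     (Defs.mrestr (pushforward Pr (fun w => g (f (fun i : 'I_n => Xs i w)) t))) <= P%:E)%E) ->
  (RDP dv Dist px D P <= Rt%:E)%E.
Proof.
move=> HA1; case: n f g => // n f g _ fm Hent Hdist Hdv.
have [mD D0 _] := HDist.
have fm' z : measurable (f @^-1` [set z] : set (Tn T n.+1)).
  by apply: measurable_cylinders; exact: fm.
pose G t (x : Tn T n.+1) : T := g (f x) t.
(* Countability of [Z] makes every preimage a countable union of fibres of [f]. *)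
have mG t : measurable_fun setT (G t).
  by move=> _ B mB; rewrite setTI; exact: (measurable_count_fibers [set z | B (g z t)] fm').
pose Phi t z := G t (resample Xs t z).
have mPhi t : measurable_fun setT (Phi t).
  exact: measurableT_comp (mG t) (measurable_resample Hiid t).
pose k (i : nat) : R.-pker T ~> T := ksec Pr (mPhi (inord i)).
have n1 : 0 <= n.+1%:R^-1 :> R by rewrite invr_ge0.
pose v (i : nat) : {nonneg R} := NngNum n1.
have vE i : (v i)%:num = n.+1%:R^-1 by [].
have v1 : \sum_(i < n.+1) (v i)%:num = 1.
  under eq_bigr do rewrite vE.
  by rewrite sumr_const card_ord -[LHS]mulr_natr mulVf.
pose Xh t w := g (f (fun i : 'I_n.+1 => Xs i w)) t.
have mXh t : measurable_fun setT (Xh t).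
  exact (measurableT_comp (mG t) (measurable_sample (n := n.+1) Hiid)).
(* By resampling, the kernel of letter [t] has exactly the joint law of that letter and its
   reconstruction. *)
have jointE (t : 'I_n.+1) A B : measurable A -> measurable B ->
    joint px (k t) A B = Pr [set w | A (Xs t w) /\ B (Xh t w)].
  move=> mA mB; rewrite /joint /k inord_val integral_ksec //.
  have mE : measurable [set x : Tn T n.+1 | A (x t) /\ B (G t x)].
    apply: (@measurableI _ _ [set x : Tn T n.+1 | A (x t)] [set x | B (G t x)]).
      by rewrite -[X in measurable X]setTI; exact: measurable_coord.
    by rewrite -[X in measurable X]setTI; exact: mG.
  have := law_resample Hiid t mE => /= ->; congr ((_ \x _)%E _).
  by apply/seteqP; split=> z /=; rewrite /resample eqxx.
pose K := kmixp k v1.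
have distE : (exp_dist px K Dist <= D%:E)%E.
  rewrite /K exp_dist_kmix //; apply: le_trans Hdist.
  rewrite ge0_sume_distrr; last by move=> t _; apply: integral_ge0 => w _; rewrite lee_fin.
  apply: lee_sum => t _; rewrite vE lee_wpmul2l ?lee_fin //.
  rewrite /exp_dist /k inord_val.
  rewrite (integral2_ksec Pr (mPhi t) px (h := fun x y => (Dist x y)%:E)) //; last first.
    exact/measurable_EFinP.
  rewrite -[leRHS]/(\int[Pr]_w (fun x : Tn T n.+1 => (Dist (x t) (G t x))%:E) (sample Xs w))%E.
  rewrite (integral_resample Hiid t); last 2 first.
  - apply/measurable_EFinP.
    exact: measurableT_comp mD (measurable_fun_pair (measurable_coord t) (mG t)).
  - by move=> x; rewrite lee_fin.
  by rewrite le_eqVlt; apply/orP; left; apply/eqP; apply: eq_integral => z _;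
    rewrite /resample eqxx.
have outE (t : 'I_n.+1) : Defs.mrestr (outlaw px (k t)) = Defs.mrestr (pushforward Pr (Xh t)).
  apply/funext => B; rewrite /Defs.mrestr; case: asboolP => // mB.
  rewrite -[LHS]/(joint px (k t) setT B) jointE //; congr (Pr _).
  by apply/seteqP; split=> w /= => [[]|].
have dvE : (dv (Defs.mrestr px) (Defs.mrestr (outlaw px K)) <= P%:E)%E.
  rewrite /K mrestr_outlaw_kmix.
  apply: (divergence_convex_comb (v := fun i : 'I_n.+1 => (v i)%:num)
    (nu := fun i : 'I_n.+1 => Defs.mrestr (outlaw px (k i))) HA1 _ v1 _ _).2 => // i.
    exact: is_prob_outlaw.
  by rewrite outE; exact: Hdv.
apply: le_trans (_ : MI_kernel px K <= _)%E; first by apply: ereal_inf_lbound; exists K.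
apply: ge_ereal_sup => _ [m [m' [A [B [pA pB ->]]]]].
have [mA _ _] := pA; have [mB _ _] := pB.
have [Fa hFa] := mpartition_index pA; have [Fb hFb] := mpartition_index pB.
(* Both blocks are discretized by the given partitions, which brings in the finite converse; the
   discretized reconstruction is still a function of the index, so [entropy_coarse] bounds its
   entropy. *)
pose Ua w : {ffun 'I_n.+1 -> 'I_m} := [ffun t : 'I_n.+1 => Fa (Xs t w)].
pose Vb w : {ffun 'I_n.+1 -> 'I_m'} := [ffun t : 'I_n.+1 => Fb (Xh t w)].
pose W w := (Ua w, Vb w).
have mW x : measurable (W @^-1` [set x]).
  have -> : W @^-1` [set x] = \bigcap_(t in [set: 'I_n.+1])
      (Xs t @^-1` A (x.1 t) `&` Xh t @^-1` B (x.2 t)).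
    apply/seteqP; split=> [w <- t _|w /= h]; first by rewrite /= hFa hFb /= !ffunE.
    case: x h => u y h; congr (_, _); apply/ffunP => t;
      by rewrite ffunE; have := h t I; rewrite /= hFa hFb => -[].
  apply: fin_bigcap_measurable => // t _; apply: measurableI.
    by rewrite -[_ @^-1` _]setTI; exact: Hiid.1.
  by rewrite -[_ @^-1` _]setTI; exact: mXh.
pose J u y := fine (Pr (W @^-1` [set (u, y)])).
have [W0 W1] := fibers_pmf Pr mW.
pose pi a b := fine (joint px K (A a) (B b)).
pose p a := fine (px (A a)).
pose q b := fine (outlaw px K (B b)).
have n0r : 0 < n.+1%:R :> R by rewrite ltr0n.
have fsum (h : 'I_n.+1 -> \bar R) : (forall l, h l \is a fin_num) ->
    n.+1%:R * fine (\sum_(l < n.+1) (v l)%:num%:E * h l)%E = \sum_(l < n.+1) fine (h l).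
  move=> hf; rewrite (eq_bigr (fun l => (n.+1%:R^-1 * fine (h l))%:E)); last first.
    by move=> l _; rewrite EFinM fineK.
  by rewrite sumEFin /= -mulr_sumr mulVKf ?gt_eqF.
have piE a b : n.+1%:R * pi a b =
     \sum_t \sum_u \sum_y J u y * ((u t == a) && (y t == b))%:R.
  rewrite /pi /K joint_kmix // fsum; last by move=> l; exact: joint_fin_num.
  apply: eq_bigr => t _; rewrite jointE //.
  have -> : [set w | A a (Xs t w) /\ B b (Xh t w)] =
      [set w | [pred x : {ffun 'I_n.+1 -> 'I_m} * {ffun 'I_n.+1 -> 'I_m'} |
        (x.1 t == a) && (x.2 t == b)] (W w)].
    apply/seteqP; split=> w /=; rewrite hFa hFb !ffunE /=.
      by move=> [-> ->]; rewrite !eqxx.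
    by move=> /andP[/eqP -> /eqP ->].
  rewrite (prob_fibers _ _ mW) big_mkcond /= pair_bigA /=.
  by apply: eq_bigr => -[u y] _ /=; case: ifP; rewrite ?mulr1 ?mulr0.
have qE b : q b = \sum_a pi a b.
  apply: (mulfI (lt0r_neq0 n0r)); rewrite mulr_sumr.
  under eq_bigr do rewrite piE.
  rewrite /q /K outlaw_kmix // fsum; last by move=> l; exact: outlaw_fin_num.
  rewrite exchange_big /=; apply: eq_bigr => t _.
  rewrite -[outlaw px (k t) _]/(joint px (k t) setT (B b)) jointE //.
  have -> : [set w | setT (Xs t w) /\ B b (Xh t w)] =
      [set w | [pred x : {ffun 'I_n.+1 -> 'I_m} * {ffun 'I_n.+1 -> 'I_m'} | x.2 t == b] (W w)].
    apply/seteqP; split=> w /=; rewrite hFb !ffunE /=; first by move=> [_ ->].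
    by move=> /eqP ->.
  rewrite (prob_fibers _ _ mW) big_mkcond /=.
  rewrite [RHS]exchange_big /=.
  under [RHS]eq_bigr do rewrite exchange_big /=.
  rewrite [RHS]pair_bigA /=; apply: eq_bigr => -[u y] _ /=.
  rewrite (bigD1 (u t)) //= eqxx /= big1 ?addr0 => [|a /negPf h]; last first.
    by rewrite eq_sym h mulr0.
  by case: (_ == _); rewrite ?mulr1 ?mulr0.
have PyE y : \sum_u J u y = fine (Pr [set w | [ffun t => Fb (g (f (fun i : 'I_n.+1 => Xs i w)) t)] = y]).
  have -> : [set w | [ffun t => Fb (g (f (fun i : 'I_n.+1 => Xs i w)) t)] = y] =
     [set w | [pred x : {ffun 'I_n.+1 -> 'I_m} * {ffun 'I_n.+1 -> 'I_m'} | x.2 == y] (W w)].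
    by apply/seteqP; split=> w /= => [<-|/eqP <-].
  rewrite (prob_fibers _ _ mW) [RHS]big_mkcond /=.
  transitivity (\sum_u \sum_z (if z == y then J u z else 0)).
    by apply: eq_bigr => u _; rewrite -big_mkcond big_pred1_eq.
  by rewrite pair_bigA; apply: eq_bigr => -[u z].
have := @single_letter_bound R 'I_m 'I_m' n.+1 p J pi q isT.
move=> /(_ (fun u y => W0 (u, y))).
rewrite (pair_bigA _ J) /= (eq_bigr (fun x => fine (Pr (W @^-1` [set x])))); last first.
  by move=> [].
move=> /(_ W1) h.
have {h} := h _ _ piE qE.
have Jp u y : J u y <= \prod_t p (u t).
  rewrite -[leRHS]/(fine _%:E) -(iid_rect Hiid (A := fun t => A (u t))) //.
  have mR : measurable [set w | forall t : 'I_n.+1, A (u t) (Xs t w)].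
    exact: (measurable_iid_rect Hiid (A := fun t => A (u t))).
  apply: fine_le; rewrite ?fin_num_measure //.
  apply: le_measure; rewrite ?inE //.
  by move=> w /= [<- _] t; rewrite hFa ffunE.
move=> /(_ Jp (fun a => fine_ge0 (measure_ge0 _ _))) SL.
have mF z : measurable ((fun w => f (fun i : 'I_n.+1 => Xs i w)) @^-1` [set z]).
  have := measurable_sample (n := n.+1) Hiid measurableT (fm' z).
  by rewrite setTI.
have HC := entropy_coarse Pr (fun z => [ffun t => Fb (g z t)]) mF.
apply: le_trans (le_trans _ Hent); last exact: lexx.
apply: le_trans (lee_wpmul2l _ HC); last by rewrite lee_fin.
rewrite -EFinM lee_fin.
rewrite (_ : \sum_i \sum_j _ = (\sum_a \sum_b xlog (pi a b) (p a * q b)) / ln 2); last first.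
  rewrite mulr_suml; apply: eq_bigr => a _; rewrite mulr_suml; apply: eq_bigr => b _.
  by rewrite mi_termE.
rewrite [X in _ <= _ * X](_ : _ = (\sum_y - (\sum_u J u y) * ln (\sum_u J u y)) / ln 2); last first.
  rewrite mulr_suml; apply: eq_bigr => y _; rewrite PyE /log2 -mulrA; congr (_ * _).
have l2 : 0 < ln 2 :> R by rewrite ln_gt0 // ltr1n.
by rewrite mulrA ler_pM2r ?invr_gt0 // mulrC ler_pdivlMr // mulrC.
Qed.

End Converse.

(** * Zero-one laws on a Polish space are point masses *)

Section Polish.
Context (R : realType) (dT : measure_display) (T : measurableType dT)
  (rho : T -> T -> R) (HT : polish_borel rho) (px : probability T R).

Lemma metric_open_measurable (A : set T) : metric_open rho A -> measurable A.
Proof. by have [_ _ _ ->] := HT; exact: sub_sigma_algebra. Qed.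

Lemma measurable_point (y : T) : measurable [set y].
Proof.
have [[r0 r1 rC rT] _ _ _] := HT.
rewrite -[X in measurable X]setCK; apply: measurableC; apply: metric_open_measurable.
move=> x /= xy; exists (rho x y).
  by rewrite lt_neqAle r0 andbT eq_sym; apply/eqP => /r1.
by move=> z /= h e; move: h; rewrite e ltxx.
Qed.

Lemma measurable_metric_ball (a : T) (e : R) : measurable [set x | rho a x < e].
Proof.
have [[r0 r1 rC rT] _ _ _] := HT.
apply: metric_open_measurable => x /= ax; exists (e - rho a x).
  by rewrite subr_gt0.
by move=> z /= xz; apply: le_lt_trans (rT a x z) _; lra.
Qed.

(** For each [k] some ball of radius [k.+1%:R^-1] about the dense sequence has mass one, since
    countably many null balls cannot cover the space. The intersection of these balls has mass one
    and a single point. *)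
Lemma zero_one_dirac : (forall A, measurable A -> px A = 0%E \/ px A = 1%E) ->
  exists x0, px [set x0] = 1%E.
Proof.
move=> h01; have [[r0 r1 rC rT] [s hs] _ _] := HT.
pose b n (k : nat) := [set x | rho (s n) x < k.+1%:R^-1].
have mb n k : measurable (b n k) by exact: measurable_metric_ball.
have ex k : exists n, px (b n k) = 1%E.
  apply/not_existsP => hn.
  have b0 n : px (b n k) = 0%E by have [//|/hn] := h01 _ (mb n k).
  have : (px setT <= \sum_(0 <= n <oo) px (b n k))%E.
    apply: measure_sigma_subadditive => // x _.
    have k0 : 0 < k.+1%:R^-1 :> R by rewrite invr_gt0.
    by have [n hx] := hs x _ k0; exists n => //; rewrite /b /= rC.
  rewrite eseries0 => [|n _ _]; last exact: b0.
  by rewrite probability_setT lee_fin ler10.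
have [m hm] := choice ex.
pose C := \bigcap_k b (m k) k.
have mC : measurable C by apply: bigcapT_measurable => k; exact: mb.
have C1 : px (~` C) = 0%E.
  have : (px (~` C) <= \sum_(0 <= k <oo) px (~` b (m k) k))%E.
    apply: measure_sigma_subadditive => [k||]; [exact: measurableC|exact: measurableC|].
    by rewrite /C setC_bigcap.
  rewrite eseries0 => [|k _ _]; last by rewrite probability_setC // hm subee.
  by move=> h; apply/eqP; rewrite eq_le h measure_ge0.
have pC : px C = 1%E.
  have [e|//] := h01 _ mC.
  by move: C1; rewrite probability_setC // e sube0 => /eqP; rewrite onee_eq0.
have [x0 Cx0] : exists x0, C x0.
  apply/not_existsP => nC; move: pC; rewrite (_ : C = set0) ?measure0.
    by move/eqP; rewrite eq_sym onee_eq0.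
  by apply/seteqP; split=> x // /nC.
exists x0; apply/eqP; rewrite eq_le probability_le1 /=; last exact: measurable_point.
rewrite -pC le_measure ?inE //; first exact: measurable_point.
move=> x Cx /=; apply/r1/eqP; rewrite eq_le r0 andbT leNgt; apply/negP => p.
pose k := Num.trunc (2 / rho x x0).
have k0 : 0 <= 2 / rho x x0 by rewrite divr_ge0.
have /andP[_] := truncn_itv k0; rewrite -/k ltr_pdivrMr // => kp.
have h1 := Cx k I; have h2 := Cx0 k I; rewrite /b /= in h1 h2.
have kk : 0 < k.+1%:R :> R by rewrite ltr0n.
have := rT x (s (m k)) x0; rewrite (rC x (s (m k))) => h3.
have : rho x x0 < 2 / k.+1%:R by rewrite mulr_natl mulr2n (le_lt_trans h3) // ltrD.
by rewrite ltr_pdivlMr // mulrC => /(lt_trans kp); rewrite ltxx.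
Qed.

End Polish.

(** * Slack in both constraints at a small cost in rate *)

Section Slack.
Context (R : realType) (dT : measure_display) (T : measurableType dT)
  (px : probability T R) (Dist : T -> T -> R) (HDist : distortion Dist)
  (dv : (set T -> \bar R) -> (set T -> \bar R) -> \bar R).

Lemma MI_kernel_ge0 (k : R.-pker T ~> T) : (0 <= MI_kernel px k)%E.
Proof.
apply: ereal_sup_ubound; exists 1%N, 1%N, (fun=> setT), (fun=> setT).
have pT : mpartition (fun _ : 'I_1 => [set: T]).
  by split=> // [i j|x]; [rewrite !ord1 eqxx|exists ord0].
have o1 : outlaw px k setT = 1%E := moutlawT px k.
split=> //; rewrite !big_ord1 -[joint px k setT setT]/(outlaw px k setT) o1.
by rewrite probability_setT /mi_term /= oner_eq0 mulr1 divr1 /log2 ln1 mul0r mulr0.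
Qed.

Lemma RDP_ge0 (D P : R) : (0 <= RDP dv Dist px D P)%E.
Proof. by apply: le_ereal_inf_tmp => _ [k _ <-]; exact: MI_kernel_ge0. Qed.

(** A near-optimal kernel is mixed with a small weight [l] of a kernel meeting both constraints at
    half the level. The mixture satisfies them with factor [1 - l / 2], and its information is
    controlled by [MI_kmix]. The slack later absorbs the tolerances of (A2) and of the code. *)
Lemma RDP_slack (D P eta : R) : A1 dv ->
  (forall D P : R, 0 < D -> 0 < P -> (RDP dv Dist px D P < +oo)%E) ->
  0 < D -> 0 < P -> 0 < eta ->
  exists D' P' : R, [/\ 0 < D' < D, 0 < P' < P &
    (RDP dv Dist px D' P' <= RDP dv Dist px D P + eta%:E)%E].
Proof.
move=> HA1 fin D0 P0 eta0.
have ffin a b : 0 < a -> 0 < b -> RDP dv Dist px a b \is a fin_num.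
  by move=> a0 b0; rewrite ge0_fin_numE ?fin // RDP_ge0.
have D20 : 0 < D / 2 by rewrite divr_gt0.
have P20 : 0 < P / 2 by rewrite divr_gt0.
have e20 : 0 < eta / 2 by rewrite divr_gt0.
have [_ [k1 [d1 p1] <-] h1] := lb_ereal_inf_adherent e20 (ffin _ _ D0 P0).
have [_ [k2 [d2 p2] <-] h2] := lb_ereal_inf_adherent ltr01 (ffin _ _ D20 P20).
rewrite -!/(RDP dv Dist px _ _) in h1 h2.
pose r2 := fine (RDP dv Dist px (D / 2) (P / 2)) + 1.
have r2p : 1 <= r2 by rewrite lerDr fine_ge0 // RDP_ge0.
have h2' : (MI_kernel px k2 <= r2%:E)%E.
  by rewrite /r2 EFinD fineK ?ffin // ltW.
(* [r2] bounds the information of [k2], whose share in the mixture is then at most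
   [l * r2 <= eta / 2]; the other [eta / 2] is the gap between [k1] and the infimum. *)
pose l := Num.min (2^-1) (eta / 2 / r2).
have r20 : 0 < r2 by lra.
have l0 : 0 < l by rewrite lt_min invr_gt0 divr_gt0 // andbT.
have l1 : l <= 2^-1 by rewrite ge_min lexx.
have lr : l * r2 <= eta / 2 by rewrite -ler_pdivlMr // ge_min lexx orbT.
have l0' := ltW l0; have l1' : 0 <= 1 - l by lra.
pose v (i : nat) := if i == 0%N then NngNum l0' else NngNum l1'.
pose k (i : nat) := if i == 0%N then k2 else k1.
have v1 : \sum_(i < 2) (v i)%:num = 1.
  by rewrite big_ord_recr /= big_ord_recr /= big_ord0 add0r addrC subrK.
have two (h : nat -> \bar R) : (\sum_(i < 2) (v i)%:num%:E * h i =
    l%:E * h 0%N + (1 - l)%:E * h 1%N)%E.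
  by rewrite big_ord_recr /= big_ord_recr /= big_ord0 add0e.
exists (D * (1 - l / 2)), (P * (1 - l / 2)).
have ll : 0 < l / 2 by rewrite divr_gt0.
have ll' : 0 < 1 - l / 2 by lra.
split.
- by rewrite mulr_gt0 //= gtr_pMr //; lra.
- by rewrite mulr_gt0 //= gtr_pMr //; lra.
apply: (@le_trans _ _ (MI_kernel px (kmixp k v1))).
  apply: ereal_inf_lbound; exists (kmixp k v1) => //; split.
    rewrite exp_dist_kmix // (two (fun i => exp_dist px (k i) Dist)) /=.
    apply: (@le_trans _ _ (l%:E * (D / 2)%:E + (1 - l)%:E * D%:E)%E).
      by apply: leeD; apply: lee_wpmul2l; rewrite ?lee_fin.
    by rewrite -!EFinM -EFinD lee_fin; lra.
  have -> : Defs.mrestr (outlaw px (kmixp k v1)) =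
      mixture l (Defs.mrestr (outlaw px k2)) (Defs.mrestr (outlaw px k1)).
    rewrite mrestr_outlaw_kmix; apply/funext => A.
    by rewrite (two (fun i => Defs.mrestr (outlaw px (k i)) A)).
  have l01 : 0 <= l <= 1 by lra.
  apply: le_trans (HA1 _ _ _ _ _ _ _ l01) _; [by exists px|exact: is_prob_outlaw|exact: is_prob_outlaw|].
  apply: (@le_trans _ _ (l%:E * (P / 2)%:E + (1 - l)%:E * P%:E)%E).
    by apply: leeD; apply: lee_wpmul2l; rewrite ?lee_fin.
  by rewrite -!EFinM -EFinD lee_fin; lra.
apply: le_trans (MI_kmix _ _ _) _.
rewrite (two (fun i => MI_kernel px (k i))) /=.
apply: (@le_trans _ _ ((eta / 2)%:E + (RDP dv Dist px D P + (eta / 2)%:E))%E).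
  apply: leeD.
    apply: (@le_trans _ _ (l%:E * r2%:E)%E); first by apply: lee_wpmul2l; rewrite ?lee_fin.
    by rewrite -EFinM lee_fin.
  apply: le_trans (ltW h1).
  by apply: gee_pMl; rewrite ?MI_kernel_ge0 ?lee_fin //; lra.
by rewrite addeC -addeA -EFinD -splitr.
Qed.

End Slack.

(** * Integration over finite sets of points *)

Section Points.
Context (R : realType) (dT : measure_display) (T : measurableType dT)
  (mp : forall y : T, measurable [set y]) (mu : {measure set T -> \bar R}).

Lemma set_seqE (S : seq T) : [set` S] = \big[setU/set0]_(y <- S) [set y].
Proof.
by rewrite -bigcup_seq; apply/seteqP; split=> [y yS|y [z zS ->]] //; exists y.
Qed.

Lemma measurable_seq (S : seq T) : measurable [set` S].
Proof. by rewrite set_seqE; exact: bigsetU_measurable. Qed.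

Lemma integral_point (y : T) (h : T -> \bar R) :
  (\int[mu]_(x in [set y]) h x = h y * mu [set y])%E.
Proof.
by rewrite (eq_integral (cst (h y))) ?integral_cst // => x; rewrite inE => ->.
Qed.

Lemma integral_seq (S : seq T) (h : T -> \bar R) : uniq S ->
  measurable_fun setT h -> (forall x, (0 <= h x)%E) ->
  (\int[mu]_(x in [set` S]) h x = \sum_(y <- S) h y * mu [set y])%E.
Proof.
move=> uS mh h0; rewrite set_seqE ge0_integral_bigsetU //.
- by apply: eq_bigr => y _; rewrite integral_point.
- by move=> i j _ _ [x [/= <- <-]].
- exact: measurable_funTS.
Qed.

Lemma measure_seq (S : seq T) : uniq S -> mu [set` S] = (\sum_(y <- S) mu [set y])%E.
Proof.
move=> uS; have := integral_seq (h := cst 1%E) uS (measurable_cst _) (fun=> lee01).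
rewrite integral_cst ?mul1e; last exact: measurable_seq.
by under eq_bigr do rewrite mul1e.
Qed.

End Points.

(** * Reduction to a finite source *)

Section Quantize.
Context (R : realType) (dT : measure_display) (T : measurableType dT)
  (mp : forall y : T, measurable [set y]) (px : probability T R)
  (Dist : T -> T -> R) (HDist : distortion Dist) (k : R.-pker T ~> T) (S : seq T)
  (hS : outlaw px k [set` S] = 1%E) (A0 : set T) (mA0 : measurable A0)
  (N : nat) (N0 : (0 < N)%N).

(** Atoms without output mass are dropped, because rejection sampling divides by the output
    probabilities. *)
Definition supp : seq T := [seq y <- undup S | outlaw px k [set y] != 0%E].
Notation s := (size supp).
Definition yv (j : 'I_s) : T := tnth (in_tuple supp) j.
Definition qv (j : 'I_s) : R := fine (outlaw px k [set yv j]).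

Lemma supp_uniq : uniq supp.
Proof. by rewrite filter_uniq ?undup_uniq. Qed.

Lemma yv_in j : yv j \in supp.
Proof. exact: mem_tnth. Qed.

Lemma yvS j : yv j \in S.
Proof. by have := yv_in j; rewrite mem_filter mem_undup => /andP[]. Qed.

Lemma qv_gt0 j : 0 < qv j.
Proof.
have := yv_in j; rewrite mem_filter => /andP[h _].
rewrite lt_neqAle fine_ge0 ?andbT; last exact: (moutlaw_ge0 px k).
rewrite eq_sym; apply: contra h => /eqP h; apply/eqP.
by rewrite -[LHS]fineK ?outlaw_fin_num // -/(qv j) h.
Qed.

Lemma outlaw_supp : outlaw px k [set` supp] = 1%E.
Proof.
have su : [set` S] = [set` undup S].
  by apply/seteqP; split=> x /=; rewrite mem_undup.
rewrite -hS su -![outlaw px k _]/(moutlaw px k _) !measure_seq ?undup_uniq ?supp_uniq //.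
rewrite big_filter big_mkcond; apply: eq_bigr => y _.
by case: eqP => // h; rewrite -[RHS]/(outlaw px k [set y]) h.
Qed.

(** The masses over [A] and over its complement are at most those of [px] and add up to one, so both
    bounds are equalities. *)
Lemma joint_supp A : measurable A ->
  \sum_j fine (joint px k A [set yv j]) = fine (px A).
Proof.
move=> mA.
have sumE B : measurable B ->
    (joint px k B [set` supp] = \sum_(j < s) joint px k B [set yv j])%E.
  move=> mB; rewrite /joint.
  under eq_integral do rewrite (measure_seq mp _ supp_uniq).
  rewrite ge0_integral_sum //; last first.
    by move=> y; apply: measurable_funTS; exact: measurable_kernel.
  by rewrite big_tnth.
have mS := measurable_seq mp supp.
have le1 B : measurable B -> (joint px k B [set` supp] <= px B)%E.
  by move=> mB; exact: joint_le_marginal.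
have tot : (joint px k A [set` supp] + joint px k (~` A) [set` supp] = 1)%E.
  rewrite -outlaw_supp /joint /outlaw -ge0_integral_setU ?setUv //.
  - exact: measurableC.
  - exact: measurable_kernel.
  - by apply/eqP; rewrite setICr.
have mAC := measurableC mA.
rewrite sum_fine; last by move=> j _; exact: joint_fin_num.
rewrite -sumE //; congr fine; apply/eqP; rewrite eq_le le1 //=.
have f1 := joint_fin_num px k mA mS; have f2 := joint_fin_num px k mAC mS.
have := le1 _ mAC; rewrite probability_setC //; move: tot.
rewrite -(fineK f1) -(fineK f2) -[px A]fineK ?fin_num_measure // -EFinD -EFinB !lee_fin.
by move=> [e]; lra.
Qed.

Lemma qv_pmf : pmf qv.
Proof.
split=> [j|]; first exact/ltW/qv_gt0.
by have := joint_supp measurableT; rewrite probability_setT.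
Qed.

Lemma outlaw_yv B : measurable B ->
  outlaw px k B = (\sum_j qv j * (\1_B (yv j) : R))%:E.
Proof.
move=> mB.
have mS := measurable_seq mp supp.
have SC : moutlaw px k (~` [set` supp]) = 0%E.
  by rewrite probability_setC // -[X in (_ - X)%E]/(outlaw px k [set` supp]) outlaw_supp subee.
rewrite -[LHS]/(moutlaw px k B).
have -> : moutlaw px k B = moutlaw px k [set` [seq y <- supp | y \in B]].
  have -> : [set` [seq y <- supp | y \in B]] = B `&` [set` supp].
    apply/seteqP; split=> x /=.
      by rewrite (mem_filter (fun y => y \in B)) => /andP[/set_mem].
    by move=> [Bx xs]; rewrite (mem_filter (fun y => y \in B)) xs andbT; exact: mem_set.
  rewrite -[in LHS](setIT B) -(setUv [set` supp]) setIUr measureU //; first last.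
  - by rewrite setIACA setICr setI0.
  - by apply: measurableI => //; exact: measurableC.
  - exact: measurableI.
  rewrite [X in (_ + X)%E](_ : _ = 0%E) ?adde0 //.
  apply/eqP; rewrite eq_le measure_ge0 andbT -SC le_measure ?inE //.
  - by apply: measurableI => //; exact: measurableC.
  - exact: measurableC.
rewrite measure_seq //; last by rewrite filter_uniq ?supp_uniq.
rewrite big_filter big_mkcond big_tnth -sumEFin; apply: eq_bigr => j _.
rewrite -/(yv j) indicE; case: (_ \in _); last by rewrite mulr0.
by rewrite mulr1 /qv fineK ?outlaw_fin_num.
Qed.

(** The levels start at [N%:R^-1], since level zero is always reached. *)
Definition qbit (x : T) (ji : 'I_s * 'I_N) : bool :=
  ((ji.2.+1%:R / N%:R)%:E <= k x [set yv ji.1])%E.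

(** Without the bit for [A0] a cell could have mass one, for instance when the kernel ignores its
    input, and the source prefix would then provide no randomness. *)
Definition qcell (x : T) : {ffun 'I_s * 'I_N -> bool} * bool :=
  ([ffun ji => qbit x ji], `[< A0 x >]).
Notation U := ({ffun 'I_s * 'I_N -> bool} * bool)%type.

Lemma measurable_qcell (u : U) : measurable (qcell @^-1` [set u]).
Proof.
have -> : qcell @^-1` [set u] =
    (\bigcap_(ji in [set: 'I_s * 'I_N]) [set x | qbit x ji = u.1 ji]) `&`
    (if u.2 then A0 else ~` A0).
  apply/seteqP; split=> [x <-|x [h a]].
    split=> [ji _|] /=; first by rewrite ffunE.
    by case: asboolP.
  case: u h a => b c /= h a; congr (_, _).
    by apply/ffunP => ji; rewrite ffunE; exact: h.
  by case: c a => a; case: asboolP.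
apply: measurableI; last by case: (u.2) => //; exact: measurableC.
apply: fin_bigcap_measurable => // ji _.
have mQ : measurable [set x | qbit x ji].
  rewrite -[X in measurable X]setTI.
  exact: (emeasurable_fun_c_infty measurableT (measurable_kernel k _ (mp _))).
case: (u.1 ji) => //.
rewrite (_ : [set x | _] = ~` [set x | qbit x ji]); first exact: measurableC.
by apply/seteqP; split=> x /=; case: (qbit x ji).
Qed.

Lemma kernel_fin_num x B : measurable B -> k x B \is a fin_num.
Proof.
move=> mB; rewrite ge0_fin_numE // (@le_lt_trans _ _ 1%E) ?ltry //.
by rewrite -(@prob_kernel _ _ _ _ _ k x) le_measure // inE.
Qed.

(** Equal bits place both masses at the same level on the grid of step [N%:R^-1]. *)
Lemma qcell_close x x' j : qcell x = qcell x' ->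
  fine (k x [set yv j]) <= fine (k x' [set yv j]) + N%:R^-1.
Proof.
move=> /(congr1 fst) /= e.
have Np : 0 < N%:R :> R by rewrite ltr0n.
set a := fine _; set a' := fine _.
have a'0 : 0 <= a' by rewrite fine_ge0.
have a0 : 0 <= a by rewrite fine_ge0.
have a1 : a <= 1.
  rewrite -[leRHS]/(fine 1%E) fine_le ?kernel_fin_num //.
  by rewrite -(@prob_kernel _ _ _ _ _ k x) le_measure // inE.
pose m := Num.trunc (a * N%:R).
have aN0 : 0 <= a * N%:R by rewrite mulr_ge0 // ltW.
have /andP[ma am] := truncn_itv aN0; rewrite -/m in ma am.
have am' : a < m%:R / N%:R + N%:R^-1.
  by rewrite -[X in _ + X]mul1r -mulrDl natr1 ltr_pdivlMr.
case: (posnP m) => [m0|mp0].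
  by move: am'; rewrite m0 mul0r add0r => /ltW; lra.
have mN : (m.-1 < N)%N.
  rewrite prednK // -(ler_nat R); apply: le_trans ma _.
  by rewrite -[leRHS]mul1r ler_wpM2r // ltW.
(* [m] is the highest level reached by [x]; its bit has index [m.-1]. *)
have : qbit x (j, Ordinal mN).
  rewrite /qbit /= prednK // -[k x _]fineK ?kernel_fin_num // lee_fin -/a.
  by rewrite ler_pdivrMr.
have -> : qbit x (j, Ordinal mN) = qbit x' (j, Ordinal mN).
  by move/ffunP: e => /(_ (j, Ordinal mN)); rewrite !ffunE.
rewrite /qbit /= prednK // -[k x' _]fineK ?kernel_fin_num // lee_fin -/a'.
by move=> h; apply: ltW (lt_le_trans am' _); rewrite lerD2r.
Qed.

Notation cell_set u := (qcell @^-1` [set u]).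
Definition pv (u : U) : R := fine (px (cell_set u)).
(** Conditional law of the output given the cell; the default [qv] on null cells makes every row a
    probability vector. *)
Definition Wv (u : U) (j : 'I_s) : R :=
  if pv u == 0 then qv j else fine (joint px k (cell_set u) [set yv j]) / pv u.

Lemma pv_pmf : pmf pv.
Proof. exact: (fibers_pmf px measurable_qcell). Qed.

Lemma pvWv u j : pv u * Wv u j = fine (joint px k (cell_set u) [set yv j]).
Proof.
rewrite /Wv; have [p0|pN] := eqVneq (pv u) 0; last by rewrite mulrC divfK.
rewrite p0 mul0r; apply/esym/eqP; rewrite eq_le -[X in _ <= X]p0.
have mu := measurable_qcell u.
rewrite fine_le ?joint_fin_num ?fin_num_measure ?joint_le_marginal //=.
by rewrite fine_ge0 //; exact: integral_ge0.
Qed.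

Lemma joint_ge0 A B : 0 <= fine (joint px k A B).
Proof. by rewrite fine_ge0 //; exact: integral_ge0. Qed.

Lemma Wv_pmf u : pmf (Wv u).
Proof.
rewrite /Wv; case: eqP => [_|/eqP pN]; first exact: qv_pmf.
split=> [j|]; first by rewrite divr_ge0 ?joint_ge0 // (pv_pmf.1 u).
rewrite -mulr_suml joint_supp ?divff //; exact: measurable_qcell.
Qed.

Lemma qvE j : qv j = \sum_u pv u * Wv u j.
Proof.
under eq_bigr do rewrite pvWv.
rewrite sum_fine; last by move=> u _; exact/joint_fin_num/mp/measurable_qcell.
rewrite /qv /outlaw (integral_fin_fibers px measurable_qcell) //.
exact: measurable_kernel.
Qed.

Lemma pv_le u : pv u <= Num.max (fine (px A0)) (1 - fine (px A0)).
Proof.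
have mC := measurableC mA0; have mu := measurable_qcell u.
have [b|b] := boolP u.2.
  rewrite le_max; apply/orP; left; apply: fine_le; rewrite ?fin_num_measure //.
  by rewrite le_measure ?inE // => x /= ux; move: b; rewrite -ux => /asboolP.
rewrite le_max; apply/orP; right; rewrite -[1 - _]/(fine (_ - _)%:E) EFinB.
rewrite fineK ?fin_num_measure // -probability_setC //.
apply: fine_le; rewrite ?fin_num_measure //.
by rewrite le_measure ?inE // => x /= ux; move: b; rewrite -ux => /asboolP.
Qed.

Lemma Wv_le x j : pv (qcell x) != 0 ->
  Wv (qcell x) j <= fine (k x [set yv j]) + N%:R^-1.
Proof.
move=> pN; rewrite /Wv (negPf pN).
have pp : 0 < pv (qcell x) by rewrite lt_neqAle eq_sym pN (pv_pmf.1 _).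
have mu := measurable_qcell (qcell x).
rewrite ler_pdivrMr //.
set r := _ + _.
have -> : r * pv (qcell x) = fine (\int[px]_(z in cell_set (qcell x)) cst r%:E z)%E.
  by rewrite integral_cst // fineM // fin_num_measure.
apply: fine_le; [exact: joint_fin_num| |].
  by rewrite integral_cst // fin_numM // fin_num_measure.
have r0 : 0 <= r by rewrite addr_ge0 ?fine_ge0 ?invr_ge0.
apply: ge0_le_integral => //.
  by apply: measurable_funTS; exact: measurable_kernel.
move=> z /= zx; rewrite -[k z _]fineK ?kernel_fin_num // lee_fin.
exact: qcell_close.
Qed.

(** Cells and atoms give a pair of finite partitions, so the quantized information, in bits, is one
    of the values in the supremum that defines [MI_kernel]. *)
Lemma finite_mi_le : ((finite_mi pv Wv qv / ln 2)%:E <= MI_kernel px k)%E.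
Proof.
apply: ereal_sup_ubound.
(* The last index is the complement of the atoms; it completes the partition and carries no output
   mass. *)
pose Bs (j : 'I_s.+1) : set T :=
  if unlift ord_max j is Some j' then [set yv j'] else ~` [set` supp].
exists #|{: U}|, s.+1, (fun i => cell_set (enum_val i)), Bs.
have mS := measurable_seq mp supp.
have yv_inj : injective yv.
  move=> i j /eqP; rewrite /yv !(tnth_nth (yv i)) nth_uniq ?supp_uniq ?ltn_ord // => /eqP h.
  exact: val_inj.
split.
- split=> [i|i j ij|x]; first exact: measurable_qcell.
    apply/seteqP; split=> x //= -[-> /enum_val_inj h].
    by rewrite h eqxx in ij.
  by exists (enum_rank (qcell x)); rewrite /= enum_rankK.
- split=> [j|i j ij|x].
  + by rewrite /Bs; case: unliftP => [j' _|_] //; exact: measurableC.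
  + rewrite /Bs; case: (unliftP ord_max i) => [i' iE|iE]; case: (unliftP ord_max j) => [j' jE|jE].
    * apply/seteqP; split=> x //= -[-> /yv_inj h].
      by rewrite iE jE h eqxx in ij.
    * by apply/seteqP; split=> x //= -[->]; apply; exact: yv_in.
    * by apply/seteqP; split=> x //= -[+ xE]; rewrite xE; apply; exact: yv_in.
    * by rewrite iE jE eqxx in ij.
  + have [xs|xs] := boolP (x \in supp).
      have is_ : (index x supp < s)%N by rewrite index_mem.
      exists (lift ord_max (Ordinal is_)); rewrite /Bs liftK /=.
      by rewrite /yv (tnth_nth x) /= nth_index.
    by exists ord_max; rewrite /Bs unlift_none /=; apply/negP.
congr EFin.
rewrite /finite_mi mulr_suml -(big_enum_val (fun u => \sum_(j < s.+1)
  mi_term (fine (joint px k (cell_set u) (Bs j)))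
    (fine (px (cell_set u)) * fine (outlaw px k (Bs j))))).
rewrite /=; apply: eq_big => // u _; rewrite mulr_suml big_ord_recr /=.
have BM : Bs ord_max = ~` [set` supp] by rewrite /Bs unlift_none.
have BW j : Bs (widen_ord (leqnSn s) j) = [set yv j].
  by rewrite /Bs -[widen_ord _ _](_ : lift ord_max j = _) ?liftK //; apply: val_inj;
    rewrite /= /bump leqNgt ltn_ord.
have o0 : outlaw px k (~` [set` supp]) = 0%E.
  rewrite -[LHS]/(moutlaw px k _) probability_setC //.
  by rewrite -[X in (_ - X)%E]/(outlaw px k [set` supp]) outlaw_supp subee.
have j0 : joint px k (cell_set u) (~` [set` supp]) = 0%E.
  apply/eqP; rewrite eq_le -[X in (_ <= X)%E]o0 joint_le_outlaw //.
  - exact: integral_ge0.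
  - exact: measurable_qcell.
  - exact: measurableC.
rewrite BM j0 [X in _ = _ + X]/mi_term /= eqxx addr0.
by apply: eq_bigr => j _; rewrite BW mi_termE pvWv.
Qed.

Hypothesis max_fin : (\int[px]_x (\big[Num.max/0]_(y <- S) Dist x y)%:E < +oo)%E.

Definition Dm (A : set T) (j : 'I_s) : \bar R := (\int[px]_(x in A) (Dist x (yv j))%:E)%E.

Lemma measurable_Dist_l y : measurable_fun setT (fun x => (Dist x y)%:E).
Proof.
have [mD _ _] := HDist; apply/measurable_EFinP.
exact: measurableT_comp mD (pair2_measurable y).
Qed.

Lemma Dm_ge0 A j : (0 <= Dm A j)%E.
Proof. by have [_ D0 _] := HDist; apply: integral_ge0 => x _; rewrite lee_fin. Qed.

Lemma Dm_fin_num A j : measurable A -> Dm A j \is a fin_num.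
Proof.
have [mD D0 _] := HDist; move=> mA; rewrite ge0_fin_numE ?Dm_ge0 //.
apply: le_lt_trans max_fin.
apply: (@le_trans _ _ (Dm setT j)).
  apply: ge0_subset_integral => //; first exact: measurable_Dist_l.
  by move=> x _; rewrite lee_fin.
apply: ge0_le_integral => //.
- by move=> x _; rewrite lee_fin.
- exact: measurable_Dist_l.
- apply/measurable_EFinP.
  elim: S => [|y s0 IH]; first by under eq_fun do rewrite big_nil; exact: measurable_cst.
  under eq_fun do rewrite big_cons.
  apply: measurable_maxr => //.
  by apply/measurable_EFinP; exact: measurable_Dist_l.
- move=> x _; rewrite lee_fin; have := yvS j.
  elim: S => // z s0 IH; rewrite inE big_cons le_max => /orP[/eqP ->|/IH ->].
    by rewrite lexx.
  by rewrite orbT.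
Qed.

(** On its cell the averaged kernel exceeds the original one pointwise by at most [N%:R^-1]. This
    controls the distortion even though it may vary without bound inside a cell; the excess is
    [N%:R^-1] times a sum that [max_fin] makes finite. *)
Lemma quantized_distortion (D1 eps : R) : (exp_dist px k Dist <= D1%:E)%E ->
  N%:R^-1 * \sum_j fine (Dm setT j) <= eps ->
  \sum_u \sum_j Wv u j * fine (Dm (cell_set u) j) <= D1 + eps.
Proof.
have [mD D0 _] := HDist; move=> hD he.
have D0' x y : (0 <= (Dist x y)%:E)%E by rewrite lee_fin.
have Ni0 : 0 <= N%:R^-1 :> R by rewrite invr_ge0.
pose h j x := ((k x [set yv j] + (N%:R^-1)%:E) * (Dist x (yv j))%:E)%E.
have mk j : measurable_fun setT (k ^~ [set yv j]) by exact: measurable_kernel.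
have mh j : measurable_fun setT (h j).
  apply: emeasurable_funM; last exact: measurable_Dist_l.
  by apply: emeasurable_funD.
have h0 j x : (0 <= h j x)%E by rewrite mule_ge0 // adde_ge0 // lee_fin.
have st u j : ((Wv u j * fine (Dm (cell_set u) j))%:E <= \int[px]_(x in cell_set u) h j x)%E.
  have mu := measurable_qcell u.
  rewrite EFinM fineK ?Dm_fin_num //.
  have [p0|pN] := eqVneq (pv u) 0.
    rewrite /Dm null_set_integral ?mule0 ?integral_ge0 //.
      by apply: measurable_funTS; exact: measurable_Dist_l.
    by rewrite -[LHS]fineK ?fin_num_measure // -/(pv u) p0.
  rewrite /Dm -ge0_integralZl //; last 2 first.
  - by apply: measurable_funTS; exact: measurable_Dist_l.
  - by rewrite lee_fin (Wv_pmf u).1.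
  apply: ge0_le_integral => //.
  - by move=> x _; rewrite mule_ge0 // lee_fin (Wv_pmf u).1.
  - by apply: measurable_funeM; apply: measurable_funTS; exact: measurable_Dist_l.
  - exact: measurable_funTS.
  move=> x /= xu; apply: lee_wpmul2r => //.
  rewrite -[k x _]fineK ?kernel_fin_num // -EFinD lee_fin -xu.
  by apply: Wv_le; rewrite xu.
rewrite -lee_fin -sumEFin.
apply: (@le_trans _ _ (\sum_u \sum_j \int[px]_(x in cell_set u) h j x)%E).
  by apply: lee_sum => u _; rewrite -sumEFin; apply: lee_sum => j _.
rewrite exchange_big /=.
rewrite (eq_bigr (fun j => \int[px]_x h j x)%E); last first.
  by move=> j _; rewrite [RHS](integral_fin_fibers px measurable_qcell (mh j) (h0 j)).
rewrite -ge0_integral_sum //.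
have mDk : measurable_fun setT (fun x => \int[k x]_y (Dist x y)%:E)%E.
  have f0 (p : T * T) : (0 <= (Dist p.1 p.2)%:E)%E by rewrite lee_fin.
  have mDE : measurable_fun [set: T * T] (fun p => (Dist p.1 p.2)%:E).
    exact/measurable_EFinP.
  exact: (measurable_fun_integral_finite_kernel _ k f0 mDE).
have mDx x : measurable_fun setT (fun y => (Dist x y)%:E).
  by apply/measurable_EFinP; exact: measurableT_comp mD (pair1_measurable x).
pose e x := (\sum_j (N%:R^-1)%:E * (Dist x (yv j))%:E)%E.
have me : measurable_fun setT e.
  by apply: emeasurable_sum => j; apply: measurable_funeM; exact: measurable_Dist_l.
have e0 x : (0 <= e x)%E by apply: sume_ge0 => j _; rewrite mule_ge0 // lee_fin.
apply: (@le_trans _ _ (\int[px]_x (\int[k x]_y (Dist x y)%:E + e x))%E).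
  apply: ge0_le_integral => //.
  - by move=> x _; exact: sume_ge0.
  - exact: emeasurable_sum.
  - exact: emeasurable_funD.
  move=> x _; rewrite /h.
  under eq_bigr do rewrite ge0_muleDl ?lee_fin //.
  rewrite big_split /= leeD2r //.
  rewrite (@le_trans _ _ (\int[k x]_(y in [set` supp]) (Dist x y)%:E)%E) //.
    rewrite (integral_seq mp _ supp_uniq) // [leRHS]big_tnth.
    by apply: lee_sum => j _; rewrite muleC.
  by apply: ge0_subset_integral => //; exact: measurable_seq.
rewrite ge0_integralD //; last by move=> x _; exact: integral_ge0.
rewrite EFinD; apply: leeD => //.
rewrite /e ge0_integral_sum //; last first.
- by move=> j x _; rewrite mule_ge0 // lee_fin.
- by move=> j; apply: measurable_funeM; exact: measurable_Dist_l.
rewrite (eq_bigr (fun j => (N%:R^-1 * fine (Dm setT j))%:E)); last first.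
  move=> j _; rewrite ge0_integralZl ?lee_fin //; last exact: measurable_Dist_l.
  by rewrite EFinM fineK ?Dm_fin_num.
by rewrite sumEFin lee_fin -mulr_sumr.
Qed.

End Quantize.

(** * Divergence near a finitely supported law *)

Section DivergenceContinuity.
Context (R : realType) (dT : measure_display) (T : measurableType dT)
  (px : probability T R) (dv : (set T -> \bar R) -> (set T -> \bar R) -> \bar R)
  (s : nat) (y : 'I_s -> T).

(** Built from [mrestr], so that it equals, as a set function, the restricted law with these
    atoms. *)
Definition dirac_comb (v : 'I_s -> R) : set T -> \bar R :=
  fun A => (\sum_j (v j)%:E * Defs.mrestr (\d_(y j)) A)%E.

Lemma dirac_combE v A : dirac_comb v A =
  (\sum_j v j * fine (Defs.mrestr (\d_(y j) : set T -> \bar R) A))%:E.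
Proof.
rewrite -sumEFin; apply: eq_bigr => j _; rewrite EFinM fineK //.
by rewrite /Defs.mrestr; case: ifP => // /asboolP mA; rewrite fin_num_measure.
Qed.

(* A law gamma close to q dominates (1 - l) q, so it is a mixture of q and of a
   law with the same atoms, whose divergence is bounded by that of the atoms. *)
Lemma divergence_close (q : 'I_s -> R) (P1 P M : R) : A1 dv ->
  pmf q -> (forall j, 0 < q j) -> P1 < P ->
  (dv (Defs.mrestr px) (dirac_comb q) <= P1%:E)%E ->
  (forall j, (dv (Defs.mrestr px) (Defs.mrestr (\d_(y j))) <= M%:E)%E) ->
  exists2 eps : R, 0 < eps & forall gam, pmf gam ->
    (forall j, gam j <= q j + eps) ->
    (dv (Defs.mrestr px) (dirac_comb gam) <= P%:E)%E.
Proof.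
move=> HA1 qp q0 P1P hq hM.
have pxp : is_prob (Defs.mrestr px) by exists px.
have dp j : is_prob (Defs.mrestr (\d_(y j) : set T -> \bar R)) by exists \d_(y j).
have comb v : pmf v -> is_prob (dirac_comb v) /\
    (dv (Defs.mrestr px) (dirac_comb v) <= M%:E)%E.
  by move=> [v0 v1]; exact: divergence_convex_comb.
(* A common positive lower bound: the factors are at most one, so the product is below each of
   them. *)
pose qm := \prod_j q j.
have qm0 : 0 < qm by exact: prodr_gt0.
have q1 j : q j <= 1 by rewrite -qp.2 (bigD1 j) //= lerDl sumr_ge0 // => i _; exact/ltW.
have qmq j : qm <= q j.
  rewrite /qm (bigD1 j) //= ler_piMr ?(ltW (q0 j)) //.
  by apply: prodr_ile1 => i _; rewrite q1 andbT ltW.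
pose K := `|M| + `|P1| + 1.
have K0 : 0 < K by rewrite /K ltr_wpDl // addr_ge0.
(* Giving weight [l] to a law of divergence at most [M] raises the bound [P1] by at most
   [l * K <= P - P1]. *)
pose l := Num.min (2^-1) ((P - P1) / K).
have l0 : 0 < l by rewrite lt_min invr_gt0 divr_gt0 ?subr_gt0 // andbT.
have l1 : l <= 2^-1 by rewrite ge_min lexx.
have lK : l * K <= P - P1 by rewrite -ler_pdivlMr // ge_min lexx orbT.
have sp : 0 < s.+1%:R :> R by rewrite ltr0n.
(* The total excess of the other masses, at most [s%:R * eps], is then below [l * q j]; the lower
   bound [gl] follows because both vectors sum to one. *)
pose eps := l * qm / s.+1%:R.
have eps0 : 0 < eps by rewrite divr_gt0 // mulr_gt0.
exists eps => // gam [g0 g1] gq.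
have gl j : (1 - l) * q j <= gam j.
  have h : \sum_(i | i != j) gam i <= \sum_(i | i != j) q i + s%:R * eps.
    apply: (@le_trans _ _ (\sum_(i | i != j) (q i + eps))); first exact: ler_sum.
    rewrite big_split /= lerD2l; apply: (@le_trans _ _ (\sum_(i < s) eps)).
      by rewrite [leRHS](bigD1 j) //= lerDr ltW.
    by rewrite sumr_const card_ord mulr_natl.
  have a : gam j + \sum_(i | i != j) gam i = 1 by rewrite -g1 [RHS](bigD1 j).
  have b : q j + \sum_(i | i != j) q i = 1 by rewrite -qp.2 [RHS](bigD1 j).
  have se : s%:R * eps <= l * q j.
    apply: (@le_trans _ _ (s.+1%:R * eps)).
      by rewrite ler_wpM2r ?(ltW eps0) // ler_nat.
    rewrite /eps mulrC divfK ?gt_eqF // ler_wpM2l ?(ltW l0) //.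
  move: a b h se; lra.
pose gam' j := (gam j - (1 - l) * q j) / l.
have gp' : pmf gam'.
  split=> [j|]; first by rewrite divr_ge0 ?subr_ge0 // ltW.
  rewrite -mulr_suml sumrB -mulr_sumr g1 qp.2 mulr1 opprB addrC subrK divff // gt_eqF //.
have [pq _] := comb _ qp; have [pg' dg'] := comb _ gp'.
have -> : dirac_comb gam = mixture (1 - l) (dirac_comb q) (dirac_comb gam').
  apply/funext => A; rewrite /mixture !dirac_combE -!EFinM -EFinD; congr EFin.
  rewrite !mulr_sumr -big_split /=; apply: eq_bigr => j _; rewrite /gam'.
  by field; rewrite gt_eqF.
have ll : 0 <= 1 - l <= 1 by move: l0 l1; lra.
apply: le_trans (HA1 _ _ _ _ pxp pq pg' ll) _.
apply: (@le_trans _ _ ((1 - l)%:E * P1%:E + (1 - (1 - l))%:E * M%:E)%E).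
  by apply: leeD; apply: lee_wpmul2l; rewrite ?lee_fin //; move: l0 l1; lra.
rewrite -!EFinM -EFinD lee_fin.
have : l * (M - P1) <= l * K.
  rewrite ler_wpM2l ?(ltW l0) // /K.
  by have := ler_norm M; have := ler_norm (- P1); rewrite normrN; lra.
by move: lK; lra.
Qed.

End DivergenceContinuity.

(** * Integrals over cells of an i.i.d. sample *)

Section CellIntegral.
Context (R : realType) (dT dO : measure_display) (T : measurableType dT)
  (Om : measurableType dO) (Pr : probability Om R) (Xs : nat -> Om -> T)
  (px : probability T R) (Hiid : iid Pr Xs px) (n : nat).

(** Resampling letter [t] makes the integrand a product of a function of the fresh letter and an
    indicator of the others, so Tonelli applies. *)
Lemma iid_rect_integral (A : 'I_n -> set T) (t : 'I_n) (h : T -> \bar R) :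
  (forall i, measurable (A i)) -> measurable_fun setT h -> (forall x, (0 <= h x)%E) ->
  (\int[Pr]_(w in [set w | forall i : 'I_n, A i (Xs i w)]) h (Xs t w) =
   (\prod_(i < n | i != t) fine (px (A i)))%:E * \int[px]_(x in A t) h x)%E.
Proof.
move=> mA mh h0.
pose A' i := if i == t then setT else A i.
have mA' i : measurable (A' i) by rewrite /A'; case: eqP.
pose E := [set x : Tn T n | forall i, A i (x i)].
have mE : measurable E by apply: sub_sigma_algebra; exists A.
pose H := (fun x : Tn T n => h (x t)) \_ E.
have mH : measurable_fun setT H.
  apply/(measurable_restrictT _ mE); apply: measurable_funTS.
  exact: measurableT_comp mh (measurable_coord t).
have H0 x : (0 <= H x)%E by rewrite /H /patch; case: ifP.
have mh' : measurable_fun setT (h \_ (A t)).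
  by apply/(measurable_restrictT _ (mA t)); exact: measurable_funTS.
have h0' x : (0 <= (h \_ (A t)) x)%E by rewrite /patch; case: ifP.
pose E' := [set w | forall i : 'I_n, A' i (Xs i w)].
have mE' : measurable E' by exact: (measurable_iid_rect Hiid).
rewrite integral_mkcond.
rewrite (eq_integral (fun w => H (sample Xs w))); last first.
  move=> w _; rewrite /H /patch.
  have -> // : (sample Xs w \in E) = (w \in [set w | forall i : 'I_n, A i (Xs i w)]).
  by apply/idP/idP => /set_mem h1; exact/mem_set.
rewrite (integral_resample Hiid t mH H0).
rewrite (eq_integral (fun z => (h \_ (A t)) z.1 * (\1_E' z.2)%:E)%E); last first.
  move=> [x w] _ /=; rewrite /H /patch /= indicE.
  have -> : (resample Xs t (x, w) \in E) = (x \in A t) && (w \in E').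
    apply/idP/andP => [/set_mem h1|[/set_mem Ax /set_mem Ew]].
      split; apply/mem_set; first by have := h1 t; rewrite /resample eqxx.
      by move=> i; rewrite /A'; have := h1 i; rewrite /resample; case: eqP.
    apply/mem_set => i; have := Ew i; rewrite /A' /resample.
    by case: eqP => // ->.
  rewrite /resample eqxx; case: (x \in A t) => /=; last by rewrite mul0e.
  by case: (w \in E'); rewrite ?mule1 ?mule0.
have m1 : measurable_fun setT (fun w => (\1_E' w : R)%:E).
  by apply/measurable_EFinP; exact: measurable_indic.
have i0 w : (0 <= (\1_E' w : R)%:E)%E by rewrite lee_fin.
rewrite (fubini_tonelli1 (fun z : T * Om => (h \_ (A t)) z.1 * (\1_E' z.2)%:E)%E) //; last 2 first.
- apply: emeasurable_funM; first exact: measurableT_comp mh' measurable_fst.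
  exact: measurableT_comp m1 measurable_snd.
- by move=> z; rewrite mule_ge0 // lee_fin.
have PE : Pr E' = (\prod_(i < n | i != t) fine (px (A i)))%:E.
  rewrite (iid_rect Hiid mA') (bigD1 t) //= /A' eqxx probability_setT /= mul1r.
  by congr EFin; apply: eq_bigr => i /negPf ->.
rewrite (eq_integral (fun x => Pr E' * (h \_ (A t)) x)%E); last first.
  move=> x _; rewrite /fubini_F /=.
  rewrite (ge0_integralZl Pr measurableT m1 (fun w _ => i0 w) (h0' x)).
  by rewrite integral_indic // setIT muleC.
rewrite (ge0_integralZl px measurableT mh' (fun x _ => h0' x) (measure_ge0 Pr E')).
by rewrite -integral_mkcond; congr (_ * _)%E; exact: PE.
Qed.

End CellIntegral.

Lemma esum_finType (R : realType) (Z : finType) (phi : Z -> \bar R) :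
  (forall z, (0 <= phi z)%E) -> (\esum_(z in [set: Z]) phi z = \sum_z phi z)%E.
Proof.
move=> p0.
transitivity (\esum_(z in [set: Z]) \sum_v (if z \in [set v] then phi z else 0))%E.
  apply: eq_esum => z _; rewrite (bigD1 z) //= mem_set // big1 ?adde0 // => v /eqP vz.
  by rewrite memNset //= => e; apply: vz.
rewrite esum_sum; last by move=> z v _ _; case: ifP.
by apply: eq_bigr => v _; rewrite -esum_mkcond esum_set1.
Qed.

(** * Construction of the codes *)

Section Achievability.
Context (R : realType) (dT : measure_display) (T : measurableType dT)
  (rho : T -> T -> R) (HT : polish_borel rho) (px : probability T R)
  (dO : measure_display) (Om : measurableType dO) (Pr : probability Om R)
  (Xs : nat -> Om -> T) (Hiid : iid Pr Xs px)
  (Dist : T -> T -> R) (HDist : distortion Dist)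
  (dv : (set T -> \bar R) -> (set T -> \bar R) -> \bar R) (Hdv : divergence dv).

Lemma iid_marginal t A : measurable A -> Pr (Xs t @^-1` A) = px A.
Proof.
move=> mA; pose B (i : 'I_t.+1) := if i == ord_max then A else setT.
have mB i : measurable (B i) by rewrite /B; case: eqP.
have := iid_rect Hiid mB; rewrite (bigD1 ord_max) //= {2}/B eqxx big1 => [|i /negPf h].
  rewrite mulr1 fineK ?fin_num_measure // => <-; congr (Pr _).
  apply/seteqP; split=> w /= h; first by move=> i; rewrite /B; case: eqP => // ->.
  by have := h ord_max; rewrite /B eqxx.
by rewrite /B h probability_setT.
Qed.

Lemma degenerate_achievable (x0 : T) (D P : R) : px [set x0] = 1%E -> 0 < D -> 0 < P ->
  nr_achievable dv Dist Pr Xs px D P 0.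
Proof.
move=> hx D0 P0; exists 0%N => n _.
have [mD Dge Deq] := HDist.
have mx := measurable_point HT x0.
exists unit, (fun=> tt), (fun _ _ => x0); split.
- move=> z; rewrite (_ : _ @^-1` _ = setT); last by apply/seteqP; split=> // x _; case: z.
  exact: (@measurableT _ (g_sigma_algebraType (@cylinders _ T n))).
- rewrite /entropy esum1 ?mule0 // => -[] _.
  rewrite (_ : _ @^-1` _ = setT); last by apply/seteqP; split.
  by rewrite probability_setT /= /log2 ln1 mul0r mulr0.
- rewrite big1 ?mule0 ?lee_fin ?ltW // => t _.
  have mt : measurable_fun setT (fun w => (Dist (Xs t w) x0)%:E).
    exact: measurableT_comp (measurable_Dist_l HDist x0) (Hiid.1 t).
  have mC : measurable (Xs t @^-1` ~` [set x0]).
    by rewrite -[_ @^-1` _]setTI; apply: Hiid.1 => //; exact: measurableC.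
  have z0 : Pr (Xs t @^-1` ~` [set x0]) = 0%E.
    by rewrite iid_marginal ?probability_setC ?hx ?subee //; exact: measurableC.
  have d0 w : (0 <= (Dist (Xs t w) x0)%:E)%E by rewrite lee_fin.
  rewrite (ge0_negligible_integral mC measurableT mt (fun w _ => d0 w) z0).
  apply: integral0_eq => w [_ /= nw].
  by congr EFin; apply/Deq; apply: contrapT => h; apply: nw.
move=> t.
have -> : Defs.mrestr (pushforward Pr (fun=> x0)) = Defs.mrestr px.
  apply/funext => A; rewrite /Defs.mrestr; case: asboolP => // mA; rewrite /pushforward.
  have [Ax|nAx] := pselect (A x0).
    rewrite (_ : _ @^-1` A = setT); last by apply/seteqP; split.
    rewrite probability_setT; apply/eqP; rewrite eq_le probability_le1 // andbT -hx.
    by rewrite le_measure ?inE // => _ ->.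
  rewrite (_ : _ @^-1` A = set0); last by apply/seteqP; split.
  rewrite measure0; apply/eqP; rewrite eq_le measure_ge0 /=.
  have <- : px (~` [set x0]) = 0%E by rewrite probability_setC // hx subee.
  rewrite le_measure ?inE //; first exact: measurableC.
  by move=> x Ax /= e; apply: nAx; rewrite -e.
have pxp : is_prob (Defs.mrestr px) by exists px.
by have [_ [_ ->]] := Hdv pxp pxp; rewrite // lee_fin ltW.
Qed.

Lemma nondegenerate_achievable (D P eta : R) (A0 : set T) :
  A1 dv -> A2 dv Dist px -> 0 < D -> 0 < P -> 0 < eta ->
  measurable A0 -> 0 < fine (px A0) < 1 ->
  nr_achievable dv Dist Pr Xs px D P (fine (RDP dv Dist px D P) + eta).
Proof.
move=> HA1 [fin HA2] D0 P0 eta0 mA0 pA0.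
have mp := measurable_point HT.
have [mD Dge _] := HDist.
have e20 : 0 < eta / 2 by rewrite divr_gt0.
have [D' [P' [/andP[D'0 D'D] /andP[P'0 P'P] hR]]] :=
  RDP_slack HDist HA1 fin D0 P0 e20.
(* Budget: [e0] takes half of the distortion slack, quantization and coding a quarter each ([dd]).
   In rate, one half of [eta] went into the slack, and [e0] and the code take a quarter each. In
   perception [e0] takes half, leaving a strict gap for [divergence_close]. *)
pose e0 := Num.min (eta / 4) (Num.min ((D - D') / 2) ((P - P') / 2)).
have e00 : 0 < e0 by rewrite !lt_min !divr_gt0 ?subr_gt0.
have e0a : e0 <= eta / 4 by rewrite ge_min lexx.
have e0b : e0 <= (D - D') / 2 by rewrite !ge_min lexx !orbT.
have e0c : e0 <= (P - P') / 2 by rewrite !ge_min lexx !orbT.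
have [k [S [hS hMI hD hmax [hP hgam]]]] := HA2 _ _ _ D'0 P'0 e00.
pose tot := \sum_j fine (@Dm _ _ _ px Dist k S setT j).
pose dd := (D - D') / 4.
have dd0 : 0 < dd by rewrite divr_gt0 ?subr_gt0.
have Dm0 A j : 0 <= fine (@Dm _ _ _ px Dist k S A j).
  by rewrite fine_ge0 //; exact: (Dm_ge0 HDist).
have tot0 : 0 <= tot by exact: sumr_ge0.
pose N := (Num.trunc (tot / dd)).+1.
have Nb : N%:R^-1 * tot <= dd.
  have t0 : 0 <= tot / dd by rewrite divr_ge0 // ltW.
  have /andP[_ /ltW h] := truncn_itv t0.
  by rewrite mulrC ler_pdivrMr ?ltr0n // mulrC -ler_pdivrMr.
have N0 : (0 < N)%N by [].
pose s := size (supp px k S).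
pose q := @qv _ _ _ px k S.
pose cell := qcell px k S A0 N.
pose U := ({ffun 'I_s * 'I_N -> bool} * bool)%type.
pose p : U -> R := @pv _ _ _ px k S A0 N.
pose W : U -> 'I_s -> R := @Wv _ _ _ px k S A0 N.
pose y : 'I_s -> T := @yv _ _ _ px k S.
have mcell (u : U) : measurable (cell @^-1` [set u]) := measurable_qcell mp mA0 u.
have pp : pmf p := pv_pmf mp px k S mA0 N.
have Wp u : pmf (W u) := Wv_pmf mp hS mA0 u.
have qp : pmf q := qv_pmf mp hS.
have q0 j : 0 < q j := qv_gt0 mp j.
have qE j : q j = \sum_u p u * W u j := qvE mp mA0 N j.
pose c := Num.max (fine (px A0)) (1 - fine (px A0)).
have pc u : p u <= c := pv_le mp mA0 u.
have c01 : 0 <= c < 1 by rewrite le_max gt_max; move: pA0 => /andP[a b]; rewrite (ltW a) b /=; lra.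
pose dm (u : U) j := fine (@Dm _ _ _ px Dist k S (cell @^-1` [set u]) j).
have dmD : \sum_u \sum_j W u j * dm u j <= D' + e0 + dd.
  exact: (quantized_distortion mp HDist hS mA0 N0 hmax hD Nb).
have dm0 u j : p u = 0 -> dm u j = 0.
  move=> pu; rewrite /dm /Dm null_set_integral //.
    by apply: measurable_funTS; exact: measurable_Dist_l.
  by rewrite -[LHS]fineK ?fin_num_measure //; congr EFin.
(* Mean distortion on a cell, zero on null cells, where [dm] vanishes too, so that [pd] always
   holds. These finitely many values have a bound even if [Dist] has none. *)
pose delta u j := dm u j / p u.
have pd u j : p u * delta u j = dm u j.
  rewrite /delta; have [pu|pN] := eqVneq (p u) 0; last by rewrite mulrC divfK.
  by rewrite dm0 // !mul0r mulr0.
pose d1 := \sum_u \sum_j delta u j.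
have de0 u j : 0 <= delta u j by rewrite divr_ge0 ?Dm0 // pp.1.
have d01 u j : 0 <= delta u j <= d1.
  rewrite de0 /= /d1 (bigD1 u) //= (bigD1 j) //= -addrA lerDl addr_ge0 ?sumr_ge0 //.
  by move=> *; exact: sumr_ge0.
have ln2 : 0 < ln 2 :> R by rewrite ln_gt0 // ltr1n.
have outE : Defs.mrestr (outlaw px k) = dirac_comb y q.
  apply/funext => A; rewrite /dirac_comb /Defs.mrestr; case: asboolP => mA; last first.
    by rewrite big1 // => j _; rewrite mule0.
  rewrite (outlaw_yv mp hS mA) -sumEFin; apply: eq_bigr => j _.
  by rewrite EFinM diracE.
have hfin j : (dv (Defs.mrestr px) (Defs.mrestr (\d_(y j))) < +oo)%E.
  have e : (\d_(y j) : set T -> \bar R) [set` S] = 1%E.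
    by rewrite diracE mem_set //=; exact: yvS.
  exact: (hgam \d_(y j) e).
have dge j : (0 <= dv (Defs.mrestr px) (Defs.mrestr (\d_(y j))))%E.
  by have [] := Hdv (_ : is_prob (Defs.mrestr px)) (_ : is_prob (Defs.mrestr (\d_(y j) : set T -> \bar R)));
    [exists px|exists \d_(y j)|].
pose M := \sum_j fine (dv (Defs.mrestr px) (Defs.mrestr (\d_(y j)))).
have hM j : (dv (Defs.mrestr px) (Defs.mrestr (\d_(y j))) <= M%:E)%E.
  rewrite -[leLHS]fineK ?ge0_fin_numE // lee_fin /M (bigD1 j) //= lerDl.
  by apply: sumr_ge0 => i _; rewrite fine_ge0.
have P1P : P' + e0 < P by lra.
have [ed ed0 hed] : exists2 eps : R, 0 < eps & forall gam, pmf gam ->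
    (forall j, gam j <= q j + eps) ->
    (dv (Defs.mrestr px) (dirac_comb y gam) <= P%:E)%E.
  by apply: (divergence_close HA1 qp q0 P1P _ hM); rewrite -outE.
(* [ed] keeps the output laws within [P]; the factor [ln 2] is there because [discrete_code] counts
   in nats. *)
pose eps := Num.min ed (Num.min dd (eta * ln 2 / 4)).
have eps0 : 0 < eps by rewrite !lt_min ed0 dd0 divr_gt0 // mulr_gt0.
have epsa : eps <= ed by rewrite ge_min lexx.
have epsb : eps <= dd by rewrite !ge_min lexx !orbT.
have epsc : eps <= eta * ln 2 / 4 by rewrite !ge_min lexx !orbT.
have [N1 HN] := discrete_code pp Wp qE q0 pc c01 d01 eps0.
exists (maxn N1 1) => n; rewrite geq_max => /andP[nN1 n1].
have [Z [f0 [g0 [hZ hDs hg]]]] := HN n nN1.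
have n0 : 0 < n%:R :> R by rewrite ltr0n.
pose F (x : 'I_n -> T) : {ffun 'I_n -> U} := [ffun i => cell (x i)].
exists Z, (fun x => f0 (F x)), (fun z t => y (g0 z t)) => Xn Xhat.
pose Ux w : {ffun 'I_n -> U} := F (Xn w).
have UxE (u : {ffun 'I_n -> U}) : Ux @^-1` [set u] =
    [set w | forall i : 'I_n, (cell @^-1` [set u i]) (Xs i w)].
  apply/seteqP; split=> w /=; first by move=> <- i; rewrite ffunE.
  by move=> h; apply/ffunP => i; rewrite ffunE; exact: h.
have mUx (u : {ffun 'I_n -> U}) : measurable (Ux @^-1` [set u]).
  by rewrite UxE; exact: (measurable_iid_rect Hiid (A := fun i => cell @^-1` [set u i])).
have PUx (u : {ffun 'I_n -> U}) : fine (Pr (Ux @^-1` [set u])) = \prod_i p (u i).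
  by rewrite UxE (iid_rect Hiid (A := fun i => cell @^-1` [set u i])).
split.
- move=> z; pose Tc := g_sigma_algebraType (@cylinders _ T n).
  have mF (u : {ffun 'I_n -> U}) : @measurable _ Tc (F @^-1` [set u]).
    have -> : F @^-1` [set u] = \bigcap_(i in [set: 'I_n]) [set x | (cell @^-1` [set u i]) (x i)].
      apply/seteqP; split=> x /=; first by move=> <- i _ /=; rewrite ffunE.
      by move=> h; apply/ffunP => i; rewrite ffunE; exact: h.
    apply: fin_bigcap_measurable => // i _; apply: sub_sigma_algebra.
    by exists i, (cell @^-1` [set u i]).
  exact: (measurable_fin_fibers (X := Tc) [set u | f0 u = z] mF).
- have mZ z : measurable ((fun w => f0 (Ux w)) @^-1` [set z]).
    exact: (measurable_fin_fibers [set u | f0 u = z] mUx).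
  have Zp := fibers_pmf Pr mZ.
  rewrite /entropy esum_finType; last first.
    move=> z; rewrite lee_fin mulNr -mulrN mulr_ge0 ?Zp.1 // oppr_ge0 log2_le0 //.
    by rewrite Zp.1 /= -Zp.2 (bigD1 z) //= lerDl sumr_ge0 // => i _; exact: Zp.1.
  rewrite sumEFin -EFinM lee_fin ler_pdivrMl //.
  have := entropy_le_card Zp => hE.
  have -> : \sum_z - fine (Pr ((fun w => f0 (Ux w)) @^-1` [set z])) *
      log2 (fine (Pr ((fun w => f0 (Ux w)) @^-1` [set z]))) =
    (\sum_z - fine (Pr ((fun w => f0 (Ux w)) @^-1` [set z])) *
      ln (fine (Pr ((fun w => f0 (Ux w)) @^-1` [set z])))) / ln 2.
    by rewrite mulr_suml; apply: eq_bigr => z _; rewrite /log2 mulrA.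
  rewrite ler_pdivrMr //; apply: le_trans hE _; apply: le_trans hZ _.
  rewrite -mulrA ler_wpM2l ?(ltW n0) //.
  have hI : finite_mi p W q / ln 2 <= fine (RDP dv Dist px D P) + eta / 2 + eta / 4.
    rewrite -lee_fin; apply: le_trans (finite_mi_le mp hS mA0 N) _.
    apply: le_trans hMI _; rewrite !EFinD fineK; last by rewrite ge0_fin_numE ?fin ?RDP_ge0.
    by apply: leeD => //; rewrite lee_fin.
  move: hI; rewrite ler_pdivrMr //; move: epsc; lra.
- have step (t : 'I_n) : (\int[Pr]_w (Dist (Xs t w) (Xhat t w))%:E =
      (\sum_(u : {ffun 'I_n -> U}) (\prod_i p (u i)) * delta (u t) (g0 (f0 u) t))%:E)%E.
    rewrite (@integral_fin_fibers _ _ _ Pr _ Ux) //; last 2 first.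
    + have mXh : measurable_fun setT (Xhat t).
        move=> _ B mB; rewrite setTI.
        exact: (measurable_fin_fibers [set u | B (y (g0 (f0 u) t))] mUx).
      apply/measurable_EFinP.
      exact: (measurableT_comp mD (measurable_fun_pair (Hiid.1 t) mXh)).
    + by move=> w; rewrite lee_fin.
    rewrite -sumEFin; apply: eq_bigr => u _.
    rewrite (eq_integral (fun w => (Dist (Xs t w) (y (g0 (f0 u) t)))%:E)); last first.
      by move=> w; rewrite inE /= => <-.
    rewrite UxE (iid_rect_integral Hiid (A := fun i => cell @^-1` [set u i]) t
      (h := fun x => (Dist x (y (g0 (f0 u) t)))%:E)) //; last 2 first.
    + exact: measurable_Dist_l.
    + by move=> x; rewrite lee_fin.
    rewrite [in RHS](bigD1 t) //= [p (u t) * _]mulrC -mulrA pd EFinM; congr (_ * _)%E.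
    by rewrite /dm fineK //; exact: Dm_fin_num.
  under eq_bigr do rewrite step.
  rewrite sumEFin -EFinM lee_fin ler_pdivrMl //; apply: le_trans hDs _.
  rewrite ler_wpM2l ?(ltW n0) //.
  have -> : \sum_u p u * (\sum_j W u j * delta u j) = \sum_u \sum_j W u j * dm u j.
    apply: eq_bigr => u _; rewrite mulr_sumr; apply: eq_bigr => j _.
    by rewrite mulrCA pd.
  move: dmD epsb e0b; rewrite /dd; lra.
move=> t.
(* The reconstruction takes values in the atoms, and [hg] bounds its masses from above, which is the
   form that [divergence_close] asks for. *)
pose G w : 'I_s := g0 (f0 (Ux w)) t.
have mG j : measurable (G @^-1` [set j]).
  exact: (measurable_fin_fibers [set u | g0 (f0 u) t = j] mUx).
pose gam j := fine (Pr (G @^-1` [set j])).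
have gamp : pmf gam by exact: fibers_pmf.
have -> : Defs.mrestr (pushforward Pr (Xhat t)) = dirac_comb y gam.
  apply/funext => B; rewrite /dirac_comb /Defs.mrestr; case: asboolP => mB; last first.
    by rewrite big1 // => j _; rewrite mule0.
  have mE : measurable (Xhat t @^-1` B).
    exact: (measurable_fin_fibers [set u | B (y (g0 (f0 u) t))] mUx).
  rewrite /pushforward (measure_fin_fibers Pr mG mE); apply: eq_bigr => j _.
  rewrite diracE; case: (boolP (y j \in B)) => [/set_mem Bj|/negP Bj].
    rewrite mule1 /gam fineK ?fin_num_measure //; congr (Pr _).
    apply/seteqP; split=> w /= => [[]//|h]; split=> //.
    by rewrite /Xhat -/(Ux w) -/(G w) h.
  rewrite mule0 (_ : _ `&` _ = set0) ?measure0 //.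
  apply/seteqP; split=> w //= -[h1 h2]; apply: Bj; apply/mem_set.
  by rewrite -h2.
apply: hed => // j; rewrite /gam.
have -> : G @^-1` [set j] = [set w | [pred u | g0 (f0 u) t == j] (Ux w)].
  by apply/seteqP; split=> w /=; [move=> h; apply/eqP; exact: h|move/eqP].
rewrite (prob_fibers Pr _ mUx) /=.
under eq_bigr do rewrite PUx.
by apply: le_trans (hg t j) _; rewrite lerD2l.
Qed.

End Achievability.

Theorem theorem2 (R : realType) (dT : measure_display) (T : measurableType dT)
  (rho : T -> T -> R) (HT : polish_borel rho)
  (px : probability T R)
  (dO : measure_display) (Om : measurableType dO) (Pr : probability Om R)
  (Xs : nat -> Om -> T) (Hiid : iid Pr Xs px)
  (Dist : T -> T -> R) (HDist : distortion Dist)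
  (dv : (set T -> \bar R) -> (set T -> \bar R) -> \bar R) (Hdv : divergence dv)
  (HA1 : A1 dv) (HA2 : A2 dv Dist px) :
  forall D P : R, 0 < D -> 0 < P -> Rnr dv Dist Pr Xs px D P = RDP dv Dist px D P.
Proof.
move=> D P D0 P0; apply/eqP; rewrite eq_le; apply/andP; split; last first.
  apply: le_ereal_inf_tmp => _ [Rt [N hN] <-].
  (* One blocklength is enough for the converse; the maximum excludes [n = 0], where [n%:R^-1] is
     zero. *)
  have [Z [f [g [fm hE hD hP]]]] := hN (maxn N 1) (leq_maxl _ _).
  exact: (converse Hiid HDist HA1 (leq_maxr N 1) fm hE hD hP).
have Rfin : RDP dv Dist px D P \is a fin_num.
  by rewrite ge0_fin_numE ?RDP_ge0 //; exact: HA2.1.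
have [[A0 [mA0 p0 p1]]|h] :=
    pselect (exists A0, [/\ measurable A0, px A0 <> 0%E & px A0 <> 1%E]).
  apply/lee_addgt0Pr => eta eta0.
  rewrite -(fineK Rfin) -EFinD; apply: ereal_inf_lbound.
  exists (fine (RDP dv Dist px D P) + eta) => //.
  apply: (nondegenerate_achievable HT Hiid HDist Hdv HA1 HA2 D0 P0 eta0 mA0).
  have f0 := fin_num_measure px _ mA0.
  have h1 := probability_le1 px mA0.
  rewrite !lt_neqAle fine_ge0 // andbT; apply/and3P; split.
  - by rewrite eq_sym; apply/eqP => e; apply: p0; rewrite -[LHS]fineK // e.
  - by apply/eqP => e; apply: p1; rewrite -[LHS]fineK // e.
  - by rewrite -lee_fin fineK.
have [A mA|x0 hx] := zero_one_dirac HT (px := px).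
  have [->|n0] := eqVneq (px A) 0%E; first by left.
  by right; apply: contrapT => n1; apply: h; exists A; split=> //; exact/eqP.
apply: le_trans (RDP_ge0 _ _ _ _ _).
apply: ereal_inf_lbound; exists 0 => //.
exact: (degenerate_achievable HT Hiid HDist Hdv hx D0 P0).
Qed.
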